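(* Let $\mathbb{K}$ be a field of characteristic $0$, let $w,x,y,z$ be non-negative integers, and let $Y\subset\mathbb{P}^3=\mathbb{P}^3(\mathbb{K})$ be a general union of $w$ 5-points, $x$ 4-points, $y$ 3-points and $z$ 2-points. Then $Y$ has good postulation in degree $9$, except exactly when $(w,x,y,z)$ is one of the following 4-tuples (for which $Y$ does not have good postulation in degree $9$): $$(6,0,1,1),\ (6,0,1,0),\ (6,0,0,3),\ (6,0,0,2),\ (6,0,0,1),\ (6,0,0,0),$$ $$(5,2,0,1),\ (5,2,0,0),\ (5,1,2,1),\ (5,1,2,0),\ (5,1,1,3),\ (5,1,1,2),\ (5,1,1,1),\ (5,1,1,0),$$ $$(5,1,0,6),\ (5,1,0,5),\ (5,1,0,4),\ (5,1,0,3),\ (5,1,0,2),\ (5,1,0,1),\ (5,1,0,0),$$ $$(4,3,2,0),\ (3,6,0,0),\ (3,5,1,1),\ (3,5,1,0).$$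
   Context: The field $\mathbb{K}$ is not assumed algebraically closed. An $m$-point (fat point of multiplicity $m$) $mP$ of $\mathbb{P}^3$ is the zero-dimensional closed subscheme with ideal sheaf $(\mathcal{I}_{P,\mathbb{P}^3})^m$, where $P\in\mathbb{P}^3$; its length is $\binom{m+2}{3}$. A general union of $k$ fat points with prescribed multiplicities is $Y=m_1P_1+\dots+m_kP_k$ with $P_1,\dots,P_k$ general points of $\mathbb{P}^3$ (i.e. $(P_1,\dots,P_k)$ ranges in some non-empty Zariski open subset of $(\mathbb{P}^3)^k$); $\deg(Y)$ is the sum of the lengths of its components. A zero-dimensional scheme $Y\subset\mathbb{P}^3$ has good postulation in degree $d$ if: (a) when $\deg(Y)\le\binom{d+3}{3}$, $h^1(\mathbb{P}^3,\mathcal{I}_Y(d))=0$; and (b) when $\deg(Y)\ge\binom{d+3}{3}$, $h^0(\mathbb{P}^3,\mathcal{I}_Y(d))=0$. *)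

(* Defs.v *)
From HB Require Import structures.
From mathcomp Require Import all_boot all_order all_algebra.
From mathcomp Require Import mpoly.

Set Implicit Arguments.
Unset Strict Implicit.
Unset Printing Implicit Defensive.

Import GRing.Theory.
Local Open Scope ring_scope.

(* Points of P^3(K) are the lines of K^4. *)
Definition proj3 (K : fieldType) : Type :=
  {L : {vspace 'rV[K]_4} | \dim L == 1%N}.

(* The variables of {mpoly K[k * 4]} are indexed by the pairs (i, j) through
   mxvec_index: the j-th homogeneous coordinate of the i-th point. *)
Definition multihomog (K : fieldType) (k : nat) (F : {mpoly K[k * 4]}) : Prop :=
  exists e : 'I_k -> nat, forall mon, mon \in msupp F ->
    forall i : 'I_k, (\sum_(j < 4) mon (mxvec_index i j))%N = e i.

(* A multihomogeneous F vanishes on all vectors of the chosen lines as soon as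
   it vanishes on one choice of non-zero ones. *)
Definition vanishes_at (K : fieldType) (k : nat) (F : {mpoly K[k * 4]})
    (P : 'I_k -> proj3 K) : Prop :=
  forall A : 'M[K]_(k, 4), (forall i, row i A \in sval (P i)) ->
    F.@[fun a => mxvec A 0 a] = 0.

Definition zariski_closed (K : fieldType) (k : nat)
    (Z : ('I_k -> proj3 K) -> Prop) : Prop :=
  exists E : {mpoly K[k * 4]} -> Prop,
    (forall F, E F -> multihomog F) /\
    (forall P, Z P <-> (forall F, E F -> vanishes_at F P)).

Definition zariski_open (K : fieldType) (k : nat)
    (U : ('I_k -> proj3 K) -> Prop) : Prop :=
  exists2 Z, zariski_closed Z & forall P, U P <-> ~ Z P.

Definition for_general (K : fieldType) (k : nat)
    (Q : ('I_k -> proj3 K) -> Prop) : Prop :=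
  exists U, [/\ zariski_open U, exists P, U P & forall P, U P -> Q P].

(* Over an infinite field this is the homogeneous ideal of P. *)
Definition point_ideal (K : fieldType) (P : proj3 K) (f : {mpoly K[4]}) : Prop :=
  forall v : 'rV[K]_4, v \in sval P -> f.@[fun j => v 0 j] = 0.

(* The factors a i make this an ideal also for m = 0. *)
Definition ideal_pow (R : comNzRingType) (I : R -> Prop) (m : nat) (f : R) :
    Prop :=
  exists (N : nat) (a : 'I_N -> R) (g : 'I_N -> 'I_m -> R),
    (forall i j, I (g i j)) /\ f = \sum_(i < N) a i * \prod_(j < m) g i j.

(* Homogeneous ideal of the union of the fat points ms_i P_i, for distinct
   P_i. *)
Definition fat_ideal (K : fieldType) (ms : seq nat)
    (P : 'I_(size ms) -> proj3 K) (f : {mpoly K[4]}) : Prop :=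
  forall i, ideal_pow (point_ideal (P i)) (nth 0%N ms i) f.

Definition fat_deg (ms : seq nat) : nat := (\sum_(m <- ms) 'C(m + 2, 3))%N.

(* For a homogeneous ideal I with associated ideal sheaf J: the sections of
   J(d) over the open set where no X_i (i in A) vanishes, that is, the degree d
   part of the localisation of I at \prod_(i in A) X_i.  All of these live in
   the fraction field, where the restriction maps are inclusions. *)
Definition sections (K : fieldType) (I : {mpoly K[4]} -> Prop) (d : nat)
    (A : {set 'I_4}) (u : {fraction {mpoly K[4]}}) : Prop :=
  exists (k : nat) (f : {mpoly K[4]}),
    [/\ I f, f \is (d + k * #|A|)%N.-homog
      & u = tofrac f / tofrac (\prod_(i in A) 'X_i) ^+ k].

(* H^0(P^3, J(d)) = 0 and H^1(P^3, J(d)) = 0, by the Cech complex of the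
   standard affine cover of P^3 (full, not only alternating, cochains). *)
Definition H0_zero (K : fieldType) (I : {mpoly K[4]} -> Prop) (d : nat) : Prop :=
  forall s : 'I_4 -> {fraction {mpoly K[4]}},
    (forall i, sections I d [set i] (s i)) ->
    (forall i j, s j - s i = 0) ->
    forall i, s i = 0.

Definition H1_zero (K : fieldType) (I : {mpoly K[4]} -> Prop) (d : nat) : Prop :=
  forall s : 'I_4 -> 'I_4 -> {fraction {mpoly K[4]}},
    (forall i j, sections I d [set i; j] (s i j)) ->
    (forall i j k, s j k - s i k + s i j = 0) ->
    exists2 t : 'I_4 -> {fraction {mpoly K[4]}},
      forall i, sections I d [set i] (t i) & forall i j, s i j = t j - t i.

Definition good_postulation (K : fieldType) (d : nat) (ms : seq nat)
    (P : 'I_(size ms) -> proj3 K) : Prop :=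
  ((fat_deg ms <= 'C(d + 3, 3))%N -> H1_zero (fat_ideal P) d) /\
  (('C(d + 3, 3) <= fat_deg ms)%N -> H0_zero (fat_ideal P) d).

Definition mults (w x y z : nat) : seq nat :=
  nseq w 5 ++ nseq x 4 ++ nseq y 3 ++ nseq z 2.

Definition exceptions9 : seq (nat * nat * nat * nat) :=
  [:: (6, 0, 1, 1); (6, 0, 1, 0); (6, 0, 0, 3); (6, 0, 0, 2); (6, 0, 0, 1);
      (6, 0, 0, 0);
      (5, 2, 0, 1); (5, 2, 0, 0); (5, 1, 2, 1); (5, 1, 2, 0); (5, 1, 1, 3);
      (5, 1, 1, 2); (5, 1, 1, 1); (5, 1, 1, 0);
      (5, 1, 0, 6); (5, 1, 0, 5); (5, 1, 0, 4); (5, 1, 0, 3); (5, 1, 0, 2);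
      (5, 1, 0, 1); (5, 1, 0, 0);
      (4, 3, 2, 0); (3, 6, 0, 0); (3, 5, 1, 1); (3, 5, 1, 0)]%N.

(* Main.v *)
(* By Cech cohomology of the standard cover, H^0 and H^1 of the ideal sheaf of fat points with
   coordinates in the torus vanish in degree d if and only if the map from forms of degree d to
   jets at the points is injective, respectively surjective. Both are open conditions on the
   points, so a single configuration decides the general one.

   Configurations with good postulation come from toric degenerations: if a hyperplane cuts the
   exponents of degree d in two, and one configuration works for the forms spanned by each half,
   then their union works after moving one of them along a one-parameter subgroup, since the jet
   matrix becomes block triangular in the limit. Cutting until every cell carries one point leaves
   the question whether a cell has independent jets, which is settled by slicing it into planes
   and lines. A 4-point is a limit of five 2-points, and domination of the multiplicities reduces
   everything to finitely many cases. For five or six 5-points a Cremona transformation first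
   lowers the degree to 7 or 5.

   The exceptions have geometric reasons: multiples of a quadric through nine of the points, the
   twisted cubic through five 5-points and a 4-point (a form in degree 9 restricts to degree 27
   and would have 28 zeros), and, for six 5-points and degree at least 220, Cremona transforms of
   cubics and quadrics that exist for dimension reasons. *)

Require Import Defs.
From HB Require Import structures.
From mathcomp Require Import all_boot all_order all_algebra.
From mathcomp Require Import mpoly.
From mathcomp Require Import perm ring zify.

Set Implicit Arguments.
Unset Strict Implicit.
Unset Printing Implicit Defensive.

Import GRing.Theory.
Local Open Scope ring_scope.

(** * Order of vanishing *)

(** Everything is said about forms over [K] and matrices of coordinates, so algebraic closure never
    enters. Characteristic 0 supplies parameters among the natural numbers and keeps distinct
    integers distinct in [K]. On a form, an m-fold point with non-zero X_0-coordinate imposes just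
    the derivatives of order below m in X_1, X_2, X_3. The jet matrix therefore has as many columns
    as the degree of the scheme; it is square in degree 220, where injectivity and surjectivity are
    the same. Cremona transformations carry non-zero forms to non-zero forms and thus transport
    injectivity only. Surjectivity for five 5-points is therefore obtained from square cases,
    completed by simple points where necessary. Being an involution, the transformation serves both
    to construct good configurations and to refute them. The degenerations are given as explicit
    trees of cuts. Checking a tree involves natural numbers only, so one computation is valid for
    all fields of characteristic 0. *)

Definition shift (R : comNzRingType) n (v : 'I_n -> R) (f : {mpoly R[n]}) :=
  f \mPo [tuple 'X_i + (v i)%:MP | i < n].

Definition low (R : nzRingType) n (m : nat) (g : {mpoly R[n]}) :=
  forall b : 'X_{1..n}, (mdeg b < m)%N -> g@_b = 0.

(** The coefficient of Z^b in (v + Z)^a, that is, the divided derivative of X^a at v. It is zero as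
    soon as some [b j] exceeds [a j], so the truncated subtraction does no damage. *)
Definition hasse (R : nzRingType) n (a b : 'X_{1..n}) (v : 'I_n -> R) : R :=
  \prod_(j < n) (v j ^+ (a j - b j) *+ 'C(a j, b j)).

Section Expansion.
Variables (R : comNzRingType) (n : nat).
Implicit Types (v : 'I_n -> R) (f g : {mpoly R[n]}) (a b : 'X_{1..n}).

Definition mnm_of_ffun D (p : {ffun 'I_n -> 'I_D}) : 'X_{1..n} :=
  [multinom (p i : nat) | i < n].

(** Binomial expansion in each variable, then distributivity. One common bound [D] for the exponents
    makes the result a sum over a finite type; the surplus terms carry a zero binomial
    coefficient. *)
Lemma prod_exp_add (S : comNzRingType) (x z : 'I_n -> S) a D :
  (forall i, a i < D)%N ->
  \prod_j (x j + z j) ^+ a j =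
  \sum_(p : {ffun 'I_n -> 'I_D}) hasse a (mnm_of_ffun p) x * \prod_j z j ^+ p j.
Proof.
move=> aD; pose t j (b : 'I_D) := x j ^+ (a j - b) *+ 'C(a j, b) * z j ^+ b.
transitivity (\prod_j \sum_(b < D) t j b).
  apply: eq_bigr => j _; rewrite exprDn.
  rewrite (big_ord_widen_cond D predT
    (fun i => x j ^+ (a j - i) * z j ^+ i *+ 'C(a j, i))) ?ltnS //=.
  rewrite big_mkcond; apply: eq_bigr => b _; rewrite /t ltnS.
  by case: leqP => [|ab]; rewrite ?mulrnAl // bin_small // mulr0n mul0r.
rewrite bigA_distr_bigA; apply: eq_bigr => p _.
rewrite /hasse -big_split; apply: eq_bigr => j _ /=.
by rewrite /t mnmE.
Qed.

Lemma shiftE v a :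
  shift v 'X_[a] = \prod_j ((v j)%:MP + 'X_j) ^+ a j.
Proof.
by rewrite /shift comp_mpolyX; apply: eq_bigr => j _; rewrite tnth_mktuple addrC.
Qed.

Lemma mcoeff_shiftX v a b : (shift v 'X_[a])@_b = hasse a b v.
Proof.
pose D := (mdeg a + mdeg b).+1.
have le1 (c : 'X_{1..n}) i : (c i <= mdeg c)%N.
  by rewrite mdegE (bigD1 i) //= leq_addr.
have aD i : (a i < D)%N by rewrite ltnS (leq_trans (le1 a i)) ?leq_addr.
have bD i : (b i < D)%N by rewrite ltnS (leq_trans (le1 b i)) ?leq_addl.
rewrite shiftE (prod_exp_add _ _ aD) raddf_sum /=.
pose p0 := [ffun i => Ordinal (bD i)].
have mp0 : mnm_of_ffun p0 = b by apply/mnmP=> i; rewrite mnmE ffunE.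
have E (p : {ffun 'I_n -> 'I_D}) : \prod_j ('X_j : {mpoly R[n]}) ^+ p j = 'X_[mnm_of_ffun p].
  by rewrite (mpolyXE_id _ (mnm_of_ffun p)); apply: eq_bigr => j _; rewrite mnmE.
have H c : hasse a c (fun j => (v j)%:MP) = (hasse a c v)%:MP_[n].
  rewrite /hasse rmorph_prod; apply: eq_bigr => j _.
  by rewrite rmorphMn rmorphXn.
rewrite (bigD1 p0) //= E H mcoeffCM mcoeffX mp0 eqxx mulr1 big1 ?addr0 // => p pn.
rewrite E H mcoeffCM mcoeffX; case: eqP => [pb|]; rewrite ?mulr0 //.
case/eqP: pn; apply/ffunP=> i; apply: val_inj.
by rewrite ffunE /= -pb mnmE.
Qed.

Lemma mcoeff_shift v f b : (shift v f)@_b = \sum_(a <- msupp f) f@_a * hasse a b v.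
Proof.
have -> : shift v f = \sum_(a <- msupp f) f@_a *: shift v 'X_[a].
  rewrite [LHS]/shift [X in X \mPo _]mpolyE linear_sum.
  by apply: eq_bigr => a _; rewrite linearZ.
rewrite (raddf_sum (mcoeff b)); apply: eq_bigr => a _.
by rewrite /= mcoeffZ mcoeff_shiftX.
Qed.

Lemma shiftM v : {morph shift v : f g / f * g}.
Proof. exact: rmorphM. Qed.

Lemma shiftD v : {morph shift v : f g / f + g}.
Proof. exact: raddfD. Qed.

Lemma shiftB v : {morph shift v : f g / f - g}.
Proof. exact: raddfB. Qed.

Lemma shift_sum v (I : Type) (r : seq I) (P : pred I) (F : I -> {mpoly R[n]}) :
  shift v (\sum_(i <- r | P i) F i) = \sum_(i <- r | P i) shift v (F i).
Proof. exact: raddf_sum. Qed.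

Lemma shift_prod v (I : Type) (r : seq I) (P : pred I) (F : I -> {mpoly R[n]}) :
  shift v (\prod_(i <- r | P i) F i) = \prod_(i <- r | P i) shift v (F i).
Proof. exact: rmorph_prod. Qed.

Lemma shiftXn v f k : shift v (f ^+ k) = shift v f ^+ k.
Proof. exact: rmorphXn. Qed.

Lemma shiftZ v c f : shift v (c *: f) = c *: shift v f.
Proof. by rewrite /shift linearZ. Qed.

Lemma shiftX1 v i : shift v 'X_i = 'X_i + (v i)%:MP.
Proof. by rewrite /shift comp_mpolyXU -tnth_nth tnth_mktuple. Qed.

Lemma shift_coef0 v f : (shift v f)@_0 = f.@[v].
Proof.
rewrite mcoeff_shift mevalE; apply: eq_bigr => a _; congr (_ * _).
by apply: eq_bigr => i _; rewrite mnm0E subn0 bin0 mulr1n.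
Qed.

Lemma lowD m f g : low m f -> low m g -> low m (f + g).
Proof. by move=> lf lg b bm; rewrite mcoeffD lf ?lg ?addr0. Qed.

Lemma lowB m f g : low m f -> low m g -> low m (f - g).
Proof. by move=> lf lg b bm; rewrite mcoeffB lf ?lg ?subr0. Qed.

Lemma low_sum m (I : Type) (r : seq I) (P : pred I) (F : I -> {mpoly R[n]}) :
  (forall i, P i -> low m (F i)) -> low m (\sum_(i <- r | P i) F i).
Proof. by move=> lF b bm; rewrite raddf_sum /= big1 // => i Pi; rewrite lF. Qed.

Lemma lowM m k f g : low m f -> low k g -> low (m + k) (f * g).
Proof.
move=> lf lg b bm; rewrite mcoeffM big1 // => p /eqP pb.
case: (ltnP (mdeg p.1) m) => [/lf->|mp]; first by rewrite mul0r.
have bE := congr1 (@mdeg n) pb; rewrite mdegD in bE.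
rewrite lg ?mulr0 // -(ltn_add2l m); apply: leq_ltn_trans bm.
have H : (m + mdeg p.2 <= mdeg p.1 + mdeg p.2)%N by rewrite leq_add2r.
by rewrite -bE in H.
Qed.

Lemma low0 f : low 0 f. Proof. by []. Qed.

Lemma low_mull m f g : low m g -> low m (f * g).
Proof. by move=> lg; apply: (@lowM 0) lg; apply: low0. Qed.

Lemma low_mulr m f g : low m f -> low m (f * g).
Proof. by rewrite mulrC; apply: low_mull. Qed.

Lemma low_leq m k f : (k <= m)%N -> low m f -> low k f.
Proof. by move=> km lf b bk; rewrite lf // (leq_trans bk). Qed.

Lemma low_prod m (F : 'I_m -> {mpoly R[n]}) :
  (forall i, low 1 (F i)) -> low m (\prod_i F i).
Proof.
elim: m F => [|m IHm] F lF; first exact: low0.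
by rewrite big_ord_recl; apply: (@lowM 1 m) => //; apply: IHm.
Qed.

Lemma lowX m k f : low m f -> low (m * k) (f ^+ k).
Proof.
move=> lf; elim: k => [|k IHk]; first by rewrite muln0.
by rewrite mulnS exprS; apply: lowM.
Qed.

Lemma low1P f : low 1 f <-> f@_0 = 0.
Proof.
split=> [->//|f0 b]; first by rewrite mdeg0.
by rewrite ltnS leqn0 mdeg_eq0 => /eqP->.
Qed.
End Expansion.

(** [g] is a unit of the local ring at the origin: the coefficient of [f * g] at b is [f@_b * g@_0]
    plus products with coefficients of [f] of smaller degree, whence the induction on the degree. *)
Lemma low_cancel (R : idomainType) n m (f g : {mpoly R[n]}) :
  g@_0 != 0 -> low m (f * g) -> low m f.
Proof.
move=> g0 lfg b; have [d] := ubnP (mdeg b); elim: d b => // d IHd b bd bm.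
move: (lfg b bm); rewrite mcoeffM.
have b1 : (mdeg b < (mdeg b).+1)%N by [].
have z1 : (mdeg (0%MM : 'X_{1..n}) < (mdeg b).+1)%N by rewrite mdeg0.
rewrite (bigD1 (BMultinom b1, BMultinom z1)) /= ?addm0 // big1 ?addr0.
  by move/eqP; rewrite mulf_eq0 (negPf g0) orbF => /eqP.
move=> [p q] /= /andP[/eqP bpq pq].
have bE := congr1 (@mdeg n) bpq; rewrite mdegD in bE.
rewrite IHd ?mul0r //.
  rewrite -ltnS; apply: leq_trans bd; rewrite ltnS.
  suff H : (mdeg p < mdeg p + mdeg q)%N by rewrite -bE in H.
  rewrite -[ltnLHS]addn0 ltn_add2l lt0n mdeg_eq0.
  apply: contraNN pq => /eqP q0; rewrite xpair_eqE; apply/andP; split.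
    by apply/eqP/val_inj; have := bpq; rewrite q0 addm0 /=.
  by apply/eqP/val_inj; rewrite /= q0.
have H : (mdeg p <= mdeg p + mdeg q)%N by rewrite leq_addr.
by rewrite -bE in H; apply: leq_ltn_trans bm.
Qed.

(** * Powers of an ideal *)

Section IdealPow.
Variables (R : comNzRingType) (I : R -> Prop).

Lemma ideal_pow_unit : ideal_pow I 0 1.
Proof.
exists 1, (fun=> 1), (fun _ _ => 0); split=> [i []//|].
by rewrite big_ord1 big_ord0 mulr1.
Qed.

Lemma ideal_pow0 m : ideal_pow I m 0.
Proof.
exists 0, (fun=> 0), (fun _ _ => 0); split=> [[]//|].
by rewrite big_ord0.
Qed.

Lemma ideal_powD m f g : ideal_pow I m f -> ideal_pow I m g -> ideal_pow I m (f + g).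
Proof.
move=> [N [a [u [Iu ->]]]] [M [b [w [Iw ->]]]].
exists (N + M)%N, (fun i => match split i with inl j => a j | inr j => b j end),
  (fun i => match split i with inl j => u j | inr j => w j end); split.
  by move=> i j; case: (split i).
rewrite big_split_ord; congr (_ + _); apply: eq_bigr => i _.
  by rewrite (unsplitK (inl i)).
by rewrite (unsplitK (inr i)).
Qed.

Lemma ideal_pow_mull m f g : ideal_pow I m g -> ideal_pow I m (f * g).
Proof.
move=> [N [a [u [Iu ->]]]]; exists N, (fun i => f * a i), u; split=> //.
by rewrite big_distrr; apply: eq_bigr => i _ /=; rewrite mulrA.
Qed.

Lemma ideal_pow_sum m (J : Type) (r : seq J) (P : pred J) F :
  (forall i, P i -> ideal_pow I m (F i)) -> ideal_pow I m (\sum_(i <- r | P i) F i).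
Proof.
by move=> IF; apply: (big_ind (ideal_pow I m)) => //;
  [apply: ideal_pow0 | apply: ideal_powD].
Qed.

Lemma ideal_powS m f g : ideal_pow I m f -> I g -> ideal_pow I m.+1 (g * f).
Proof.
move=> [N [a [u [Iu ->]]]] Ig.
exists N, a, (fun i j => oapp (u i) g (unlift ord0 j)); split.
  by move=> i j; case: (unlift ord0 j) => [k|] /=.
rewrite big_distrr; apply: eq_bigr => i _ /=.
rewrite big_ord_recl unlift_none /= mulrCA; congr (_ * (_ * _)).
by apply: eq_bigr => j _; rewrite liftK.
Qed.

Lemma ideal_powW m f : ideal_pow I m.+1 f -> ideal_pow I m f.
Proof.
move=> [N [a [u [Iu ->]]]].
exists N, (fun i => a i * u i ord0), (fun i j => u i (lift ord0 j)); split=> //.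
by apply: eq_bigr => i _; rewrite big_ord_recl mulrA.
Qed.

Lemma ideal_pow_leq m k f : (k <= m)%N -> ideal_pow I m f -> ideal_pow I k f.
Proof.
move=> /subnK<-; elim: (m - k)%N => // d IHd H.
by apply: IHd; apply: ideal_powW.
Qed.

Lemma ideal_powX m k f g : ideal_pow I m f -> I g -> ideal_pow I (k + m) (g ^+ k * f).
Proof.
move=> If Ig; elim: k => [|k IHk]; first by rewrite mul1r.
by rewrite exprS -mulrA addSn; apply: ideal_powS.
Qed.

Lemma ideal_pow_prod (J : Type) (r : seq J) (F : J -> R) (e : J -> nat) :
  (forall j, I (F j)) -> ideal_pow I (\sum_(j <- r) e j)%N (\prod_(j <- r) F j ^+ e j).
Proof.
move=> IF; elim: r => [|j r IHr]; first by rewrite !big_nil; apply: ideal_pow_unit.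
by rewrite !big_cons; apply: ideal_powX.
Qed.
End IdealPow.

Lemma mdeg_mnm_of_ffun n D (p : {ffun 'I_n -> 'I_D}) :
  mdeg (mnm_of_ffun p) = (\sum_i p i)%N.
Proof. by rewrite mdegE; apply: eq_bigr => i _; rewrite mnmE. Qed.

(** * Taylor expansion of forms and membership in powers of a point ideal *)

Section Homog.
Variables (K : fieldType) (n : nat).
Implicit Types (v : 'I_n.+1 -> K) (f g : {mpoly K[n.+1]}).

(** The affine coordinate X_j / X_0 - v_j / v_0, made homogeneous. For j = 0 it is zero, which is
    why the expansions run over [p] with [p ord0 == ord0]. *)
Definition local_var v j : {mpoly K[n.+1]} := 'X_j - (v j / v ord0) *: 'X_ord0.

(* Taylor expansion around the point X_0 / v_0 of the line spanned by v. *)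
Lemma homog_taylor f D v : f \is D.-homog -> v ord0 != 0 ->
  f = \sum_(p : {ffun 'I_n.+1 -> 'I_D.+1} | p ord0 == ord0)
        (shift v f)@_(mnm_of_ffun p) *:
        (((v ord0)^-1 *: 'X_ord0) ^+ (D - mdeg (mnm_of_ffun p))
         * \prod_j local_var v j ^+ p j).
Proof.
move=> /dhomogP fD v0; set s := _ *: _.
have XE j : 'X_j = v j *: s + local_var v j :> {mpoly K[n.+1]}.
  by rewrite /s /local_var scalerA addrC subrK.
have y0 : local_var v ord0 = 0 by rewrite /local_var divff // scale1r subrr.
have HX a : mdeg a = D -> 'X_[a] = \sum_(p : {ffun 'I_n.+1 -> 'I_D.+1} | p ord0 == ord0)
    hasse a (mnm_of_ffun p) v *: (s ^+ (D - mdeg (mnm_of_ffun p))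
         * \prod_j local_var v j ^+ p j).
  move=> aD; rewrite mpolyXE_id.
  under eq_bigr => i _ do rewrite XE.
  have ai i : (a i < D.+1)%N by rewrite ltnS -aD mdegE (bigD1 i) //= leq_addr.
  rewrite (prod_exp_add _ _ ai) [RHS]big_mkcond; apply: eq_bigr => p _.
  case: eqP => [_|p0]; last first.
    rewrite (bigD1 ord0) //= y0 expr0n; case: eqP => [p00|_]; last by rewrite mul0r mulr0.
    by case: p0; apply: val_inj.
  rewrite scalerAl; congr (_ * _).
  case: (boolP [forall i, p i <= a i]%N) => [/forallP pa|].
    have -> : (D - mdeg (mnm_of_ffun p) = \sum_i (a i - mnm_of_ffun p i))%N.
      by rewrite sumnB -?mdegE ?aD // => i _; rewrite mnmE.
    rewrite -prodrXr /hasse -scaler_prod; apply: eq_bigr => i _.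
    by rewrite exprZn scalerMnl.
  rewrite negb_forall => /existsP[i]; rewrite -ltnNge => ap.
  rewrite /hasse (bigD1 i) //= [in RHS](bigD1 i) //= !mnmE bin_small // !mulr0n.
  by rewrite !mul0r scale0r.
rewrite {1}[f]mpolyE big_seq.
under [RHS]eq_bigr => p _ do rewrite mcoeff_shift scaler_suml.
rewrite exchange_big /= [RHS]big_seq; apply: eq_bigr => a af.
rewrite (HX _ (fD _ af)) scaler_sumr; apply: eq_bigr => p _.
by rewrite scalerA.
Qed.

Lemma low_comp m k f (lq : n.+1.-tuple {mpoly K[k]}) :
  (forall i, low 1 (tnth lq i)) -> low m f -> low m (f \mPo lq).
Proof.
move=> l1 lf; rewrite comp_mpolyEX; apply: low_sum => a _.
case: (ltnP (mdeg a) m) => [/lf->|ma]; first by rewrite scale0r => b _; rewrite mcoeff0.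
rewrite -mul_mpolyC; apply: low_mull; apply: low_leq ma _.
rewrite comp_mpolyX mdegE; elim: (index_enum _) => [|i r IHr].
  by rewrite !big_nil; apply: low0.
by rewrite !big_cons; apply: lowM => //; rewrite -[X in low X _]mul1n; apply: lowX.
Qed.
End Homog.

Section FatPoints.
Variable K : fieldType.
Implicit Types (v : 'rV[K]_4) (f : {mpoly K[4]}) (P : proj3 K).

Definition vshift v f := shift (fun j => v 0 j) f.

(** Only derivatives without X_0 are listed. If the X_0-coordinate of [v] is non-zero, these imply
    the others for a form ([jets_vanish_low]), and their number is the length of the fat point. *)
Definition jets_vanish m v f :=
  forall b : 'X_{1..4}, b ord0 = 0%N -> (mdeg b < m)%N -> (vshift v f)@_b = 0.

Lemma ideal_pow_low P m v f : v \in sval P ->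
  ideal_pow (point_ideal P) m f -> low m (vshift v f).
Proof.
move=> vP [N [a [g [Ig ->]]]]; rewrite /vshift shift_sum; apply: low_sum => i _.
rewrite shiftM shift_prod; apply: low_mull; apply: low_prod => j.
by apply/low1P; rewrite shift_coef0; apply: Ig.
Qed.

(** In the Taylor expansion the terms of order below m drop out, and every other term contains at
    least m factors [local_var], all of which vanish on the line. *)
Lemma jets_vanish_pow P m v f D : sval P = <[v]>%VS -> v 0 ord0 != 0 ->
  f \is D.-homog -> jets_vanish m v f -> ideal_pow (point_ideal P) m f.
Proof.
move=> Pv v0 fD jf; rewrite (homog_taylor fD (v := fun j => v 0 j) v0).
apply: ideal_pow_sum => p /eqP p0.
case: (ltnP (mdeg (mnm_of_ffun p)) m) => [pm|mp].
  rewrite [X in X *: _](_ : _ = 0) ?scale0r; first exact: ideal_pow0.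
  by apply: jf; rewrite // mnmE p0.
rewrite -mul_mpolyC mulrA; apply: ideal_pow_mull; apply: ideal_pow_leq mp _.
rewrite mdeg_mnm_of_ffun; apply: ideal_pow_prod => j w; rewrite Pv => /vlineP[c ->].
by rewrite /local_var mevalB mevalZ !mevalXU !mxE mulrCA divfK // subrr.
Qed.

Lemma jets_vanish_low P m v f D : sval P = <[v]>%VS -> v 0 ord0 != 0 ->
  f \is D.-homog -> jets_vanish m v f -> low m (vshift v f).
Proof.
move=> Pv v0 fD jf; apply: (@ideal_pow_low P); first by rewrite Pv memv_line.
exact: jets_vanish_pow fD jf.
Qed.
End FatPoints.

(** * Cech cocycles *)

Section DivX.
Variables (R : idomainType) (n : nat).
Implicit Types (f g q r : {mpoly R[n]}) (i j : 'I_n).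

Lemma mcoeffMXn f i N (a : 'X_{1..n}) :
  (f * 'X_i ^+ N)@_a = if (N <= a i)%N then f@_(a - U_(i) *+ N) else 0.
Proof.
rewrite mpolyXn; case: leqP => Na.
  rewrite -[a in LHS](@submK _ (U_(i) *+ N)%MM) ?mcoeffMX //.
    by rewrite addmC mcoeffMX.
  apply/mnm_lepP=> j; rewrite mulmnE mnmE; case: eqP => [<-|_]; by rewrite ?mul1n ?mul0n.
rewrite mcoeffM big1 // => p /eqP pa; rewrite mcoeffX.
case: eqP => [p2|_]; last by rewrite mulr0.
have := congr1 (fun m : 'X_{1..n} => m i) pa.
rewrite /= mnmDE -p2 mulmnE mnm1E eqxx mul1n => ai.
by move: Na; rewrite ai ltnNge leq_addl.
Qed.

Lemma split_pow f i N d : f \is (d + N).-homog ->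
  exists q r, [/\ f = r + q * 'X_i ^+ N, q \is d.-homog, r \is (d + N).-homog
    & forall a : 'X_{1..n}, (N <= a i)%N -> r@_a = 0].
Proof.
move=> /dhomogP fh.
pose q := \sum_(a <- msupp f | (N <= a i)%N) f@_a *: 'X_[(a - U_(i) *+ N)%MM] : {mpoly R[n]}.
pose r := \sum_(a <- msupp f | ~~ (N <= a i)%N) f@_a *: 'X_[a] : {mpoly R[n]}.
have le (a : 'X_{1..n}) : (N <= a i)%N -> (U_(i) *+ N <= a)%MM.
  move=> Na; apply/mnm_lepP=> j; rewrite mulmnE mnmE.
  by case: eqP => [<-|_]; rewrite ?mul1n ?mul0n.
exists q, r; split.
- rewrite {1}[f]mpolyE (bigID (fun a : 'X_{1..n} => (N <= a i)%N)) /= addrC; congr (_ + _).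
  rewrite mulr_suml; apply: eq_bigr => a Na.
  by rewrite -scalerAl mpolyXn -mpolyXD submK // le.
- rewrite /q big_seq_cond; apply: rpred_sum => a /andP[af Na].
  apply: rpredZ; rewrite dhomogX; apply/eqP => /=.
  have := fh _ af; rewrite /= -{1}(submK (le _ Na)) mdegD mdegMn mdeg1 mul1n.
  by move/addIn.
- rewrite /r big_seq_cond; apply: rpred_sum => a /andP[af _].
  by apply: rpredZ; rewrite dhomogX; apply/eqP; apply: fh.
move=> a Na; rewrite /r raddf_sum big1 // => b nb /=.
rewrite mcoeffZ mcoeffX; case: eqP => [ba|_]; last by rewrite mulr0.
by move: nb; rewrite ba Na.
Qed.

(** Divisibility by X_i^N is read off from the exponents of X_i, and multiplying by a power of
    another variable leaves these unchanged; so the remainder of [f] is zero. *)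
Lemma dvd_pow f g i j N M d : i != j -> f \is (d + N).-homog ->
  f * 'X_j ^+ M = g * 'X_i ^+ N -> exists2 h, h \is d.-homog & f = h * 'X_i ^+ N.
Proof.
move=> ij fh E; have [q [r [fE qh _ r0]]] := split_pow i fh.
exists q => //; rewrite fE [r](_ : _ = 0) ?add0r //.
apply/mpolyP=> a; rewrite mcoeff0; case: (leqP N (a i)) => [/r0//|aN].
have := congr1 (fun p : {mpoly R[n]} => p@_(a + U_(j) *+ M)%MM) E.
have aji : ((a + U_(j) *+ M)%MM i = a i)%N.
  by rewrite mnmDE mulmnE mnm1E eq_sym (negPf ij) mul0n addn0.
rewrite fE mulrDl mcoeffD (mulrAC q) !mcoeffMXn aji (leqNgt N (a i)) aN /= addr0.
by rewrite mnmDE mulmnE mnm1E eqxx mul1n leq_addl addmK.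
Qed.
End DivX.

Section Sections.
Variable K : fieldType.
Implicit Types (I : {mpoly K[4]} -> Prop) (f g : {mpoly K[4]}).

Local Notation x i := (tofrac ('X_i : {mpoly K[4]})).

Lemma tofrac_inj f g : tofrac f = tofrac g -> f = g.
Proof. by move/eqP; rewrite tofrac_eq => /eqP. Qed.

Lemma x_neq0 (i : 'I_4) N : x i ^+ N != 0.
Proof.
rewrite expf_neq0 // tofrac_eq0; apply/eqP => /(congr1 (fun p : {mpoly K[4]} => p@_U_(i))) /eqP.
by rewrite mcoeffX eqxx mcoeff0 oner_eq0.
Qed.

Lemma sections1P I d i u : sections I d [set i] u <->
  exists k f, [/\ I f, f \is (d + k).-homog & u = tofrac f / x i ^+ k].
Proof.
by split=> -[k [f]]; rewrite ?cards1 ?muln1 ?big_set1 => H; exists k, f;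
  rewrite ?cards1 ?muln1 ?big_set1.
Qed.

Lemma sections2P I d i j u : i != j -> sections I d [set i; j] u <->
  exists k f, [/\ I f, f \is (d + k + k).-homog & u = tofrac f / (x i ^+ k * x j ^+ k)].
Proof.
move=> ij; have Pij k : tofrac (\prod_(l in [set i; j]) 'X_l : {mpoly K[4]}) ^+ k
    = x i ^+ k * x j ^+ k.
  by rewrite (big_setU1 _ _ (A := [set j])) ?inE // big_set1 tofracM exprMn.
by split=> -[k [f]]; rewrite ?Pij ?cards2 ?ij ?muln2 -?addnn ?addnA => H; exists k, f;
  rewrite ?Pij ?cards2 ?ij ?muln2 -?addnn ?addnA.
Qed.

Lemma frac_eq f g i j N M :
  tofrac f / x i ^+ N = tofrac g / x j ^+ M -> f * 'X_j ^+ M = g * 'X_i ^+ N.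
Proof.
move/eqP; rewrite eqr_div ?x_neq0 // -!tofracXn -!tofracM => /eqP.
by move/tofrac_inj.
Qed.

(** The charts 0 and 1 alone show that no denominator remains, since powers of two different
    variables are coprime; the numerators on all charts then follow. *)
Lemma glue u d (k : 'I_4 -> nat) (f : 'I_4 -> {mpoly K[4]}) :
  (forall i, f i \is (d + k i).-homog) -> (forall i, u = tofrac (f i) / x i ^+ k i) ->
  exists2 g, g \is d.-homog & u = tofrac g /\ forall i, f i = g * 'X_i ^+ k i.
Proof.
move=> fh uE; pose i0 : 'I_4 := inord 0; pose i1 : 'I_4 := inord 1.
have i01 : i0 != i1 by apply/eqP => /(congr1 val); rewrite /= !inordK.
have E01 : f i0 * 'X_i1 ^+ k i1 = f i1 * 'X_i0 ^+ k i0.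
  by apply: frac_eq; rewrite -!uE.
have [g gh f0] := dvd_pow i01 (fh i0) E01.
have uG : u = tofrac g by rewrite (uE i0) f0 tofracM tofracXn mulfK ?x_neq0.
exists g; first exact: gh.
split=> [|i]; first exact: uG.
apply: tofrac_inj.
by rewrite tofracM tofracXn -uG (uE i) divfK ?x_neq0.
Qed.
End Sections.

(** This is H^1(P^3, O(d)) = 0 made explicit. Split each [F ord0 j] into a multiple of X_0^N and a
    remainder [r j]. By the cocycle relation, X_0^N divides r_j X_i^N - r_i X_j^N, whose exponents
    of X_0 are below N; so this is zero, and every r_j is one common form times X_j^N. *)
Lemma cocycle_split (R : idomainType) d N (F : 'I_4 -> 'I_4 -> {mpoly R[4]}) :
  (forall j, j != ord0 -> F ord0 j \is (d + N + N).-homog) ->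
  (forall i j, i != ord0 -> j != ord0 -> i != j ->
     F i j * 'X_ord0 ^+ N - F ord0 j * 'X_i ^+ N + F ord0 i * 'X_j ^+ N = 0) ->
  exists g : 'I_4 -> {mpoly R[4]}, (forall i, g i \is (d + N).-homog) /\
    forall j, j != ord0 -> F ord0 j = g j * 'X_ord0 ^+ N - g ord0 * 'X_j ^+ N.
Proof.
move=> Fh FE.
have /fin_all_exists[q /fin_all_exists[r H]] j : exists q r, j != ord0 ->
    [/\ F ord0 j = r + q * 'X_ord0 ^+ N, q \is (d + N).-homog, r \is (d + N + N).-homog
    & forall a : 'X_{1..4}, (N <= a ord0)%N -> r@_a = 0].
  case: (eqVneq j ord0) => [_|j0]; first by exists 0, 0.
  by have [q [r H]] := split_pow ord0 (Fh j j0); exists q, r.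
have rE i j : i != ord0 -> j != ord0 -> r j * 'X_i ^+ N = r i * 'X_j ^+ N.
  move=> i0 j0; case: (eqVneq i j) => [->//|ij].
  have [Fi _ _ ri] := H i i0; have [Fj _ _ rj] := H j j0.
  have E : r j * 'X_i ^+ N - r i * 'X_j ^+ N =
      (F i j - q j * 'X_i ^+ N + q i * 'X_j ^+ N) * 'X_ord0 ^+ N.
    apply/eqP; rewrite -subr_eq0 -oppr_eq0 -{}[X in _ == X](FE i j) // Fi Fj.
    by apply/eqP; ring.
  apply/eqP; rewrite -subr_eq0; apply/eqP/mpolyP=> a; rewrite mcoeff0.
  case: (leqP N (a ord0)) => [Na|aN]; last by rewrite E mcoeffMXn leqNgt aN.
  have aE (l : 'I_4) : l != ord0 -> ((a - U_(l) *+ N)%MM ord0 = a ord0).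
    by move=> l0; rewrite mnmBE mulmnE mnm1E (negPf l0) mul0n subn0.
  by rewrite mcoeffB !mcoeffMXn rj ?ri ?aE // !if_same subrr.
(* A second index besides 0 and [i1] is needed to see that X_1^N divides [r i1]; the quotient then
   serves for every j. *)
pose i1 : 'I_4 := inord 1; pose i2 : 'I_4 := inord 2.
have i10 : i1 != ord0 by apply/eqP => /(congr1 val); rewrite /= inordK.
have i20 : i2 != ord0 by apply/eqP => /(congr1 val); rewrite /= inordK.
have i12 : i1 != i2 by apply/eqP => /(congr1 val); rewrite /= !inordK.
have [_ _ r1h _] := H i1 i10.
have [r0 r0h r1E] := dvd_pow i12 r1h (rE _ _ i20 i10).
exists (fun j => if j == ord0 then - r0 else q j); split.
  move=> i; case: eqP => [_|/eqP i0]; first by rewrite rpredN.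
  by have [] := H i i0.
move=> j j0; rewrite eqxx (negPf j0) mulNr opprK addrC; have [-> _ _ _] := H j j0.
congr (_ + _); apply: (mulIf (x := 'X_i1 ^+ N)).
  rewrite expf_neq0 //; apply/eqP => /(congr1 (fun p : {mpoly R[4]} => p@_U_(i1))) /eqP.
  by rewrite mcoeffX eqxx mcoeff0 oner_eq0.
by rewrite (rE i1 j i10 j0) r1E mulrAC.
Qed.

Lemma frac_cocycle (F : fieldType) (X Y Z A B C : F) : X != 0 -> Y != 0 -> Z != 0 ->
  (A / (Y * Z) - B / (X * Z) + C / (X * Y)) * (X * Y * Z) = A * X - B * Y + C * Z.
Proof. by move=> X0 Y0 Z0; field; rewrite X0 Y0 Z0. Qed.

Lemma frac_sub (F : fieldType) (X Y A B : F) : X != 0 -> Y != 0 ->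
  (A * X - B * Y) / (X * Y) = A / Y - B / X.
Proof. by move=> X0 Y0; field; rewrite X0 Y0. Qed.

Lemma frac_subh (F : fieldType) (X Y A B H : F) : X != 0 -> Y != 0 ->
  (A - H * X) / X - (B - H * Y) / Y = A / X - B / Y.
Proof. by move=> X0 Y0; field; rewrite X0 Y0. Qed.

Section Tofrac.
Variables (R : idomainType) (n : nat).
Implicit Types f g : {mpoly R[n]}.

Lemma tofracMX f i N : tofrac (f * 'X_i ^+ N) = tofrac f * tofrac ('X_i : {mpoly R[n]}) ^+ N.
Proof. by rewrite (tofracM f) (tofracXn _ 'X_i). Qed.

Lemma tofracMX2 f g i j N M :
  tofrac (f * 'X_i ^+ N - g * 'X_j ^+ M) =
  tofrac f * tofrac ('X_i : {mpoly R[n]}) ^+ N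
  - tofrac g * tofrac ('X_j : {mpoly R[n]}) ^+ M.
Proof. by rewrite (tofracB (f * 'X_i ^+ N)) !tofracMX. Qed.
End Tofrac.

(** All terms of the shifted power but the constant c^N contain X_0. On jets without X_0,
    multiplication by X_0^N thus becomes a scalar, which [H1_zero_of_surj] divides out. *)
Lemma mcoeff_mulXD (R : idomainType) n (f : {mpoly R[n.+1]}) c N (b : 'X_{1..n.+1}) :
  b ord0 = 0%N -> (f * ('X_ord0 + c%:MP) ^+ N)@_b = c ^+ N * f@_b.
Proof.
move=> b0; elim: N => [|N IHN]; first by rewrite mulr1 mul1r.
rewrite exprSr mulrA mulrDr mcoeffD -['X_ord0 in X in X + _]expr1 mcoeffMXn b0 add0r.
by rewrite mulrC mcoeffCM IHN mulrA -exprS.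
Qed.

Section Cech.
Variables (K : fieldType) (ms : seq nat).
Variables (P : 'I_(size ms) -> proj3 K) (V : 'I_(size ms) -> 'rV[K]_4).
Hypothesis PV : forall a, sval (P a) = <[V a]>%VS.
Hypothesis V0 : forall a j, V a 0 j != 0.
Implicit Types (f g h : {mpoly K[4]}).

Local Notation mult a := (nth 0%N ms a).
Local Notation x i := (tofrac ('X_i : {mpoly K[4]})).

Definition jets_inj d := forall f, f \is d.-homog ->
  (forall a : 'I_(size ms), jets_vanish (mult a) (V a) f) -> f = 0.

Definition jets_surj d := forall tau : 'I_(size ms) -> 'X_{1..4} -> K,
  exists2 h, h \is d.-homog & forall (a : 'I_(size ms)) (b : 'X_{1..4}), b ord0 = 0%N ->
    (mdeg b < mult a)%N -> (vshift (V a) h)@_b = tau a b.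

Lemma fat_low f : fat_ideal P f -> forall a : 'I_(size ms), low (mult a) (vshift (V a) f).
Proof.
by move=> If a; apply: ideal_pow_low (If a); rewrite PV memv_line.
Qed.

Lemma low_fat f d : f \is d.-homog ->
  (forall a : 'I_(size ms), low (mult a) (vshift (V a) f)) -> fat_ideal P f.
Proof.
move=> fh lf a; apply: jets_vanish_pow (PV a) (V0 _ _) fh _ => b _.
exact: lf.
Qed.

Lemma jets_low f d (a : 'I_(size ms)) : f \is d.-homog ->
  jets_vanish (mult a) (V a) f -> low (mult a) (vshift (V a) f).
Proof. exact: jets_vanish_low (PV a) (V0 _ _). Qed.

Lemma shiftX0 a i N : (vshift (V a) ('X_i ^+ N))@_0 != 0.
Proof. by rewrite /vshift shift_coef0 rmorphXn /= mevalXU expf_neq0. Qed.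

Lemma low_cancelX a i N m f :
  low m (vshift (V a) (f * 'X_i ^+ N)) -> low m (vshift (V a) f).
Proof. by rewrite /vshift shiftM; apply: low_cancel; apply: shiftX0. Qed.

Lemma H0_zero_of_inj d : jets_inj d -> H0_zero (fat_ideal P) d.
Proof.
move=> inj s sI sE.
have /fin_all_exists[k /fin_all_exists[f H]] i : exists k f,
    [/\ fat_ideal P f, f \is (d + k).-homog & s i = tofrac f / x i ^+ k].
  by apply/sections1P; apply: sI.
have s0 i : s i = s ord0 by apply/eqP; rewrite -subr_eq0 sE.
have [i|i|g gh [sg fg]] := @glue _ (s ord0) d k f.
- by have [] := H i.
- by rewrite -(s0 i); have [] := H i.
move=> i; rewrite s0 sg (inj g) ?tofrac0 // => a b _; move: b.
apply: (@low_cancelX a ord0 (k ord0)); rewrite -fg; apply: fat_low.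
by have [] := H ord0.
Qed.

Lemma inj_of_H0_zero d : H0_zero (fat_ideal P) d -> jets_inj d.
Proof.
move=> H0 f fh jf; apply: tofrac_inj; rewrite tofrac0.
apply: (H0 (fun=> tofrac f)) ord0 => [i|i j]; last exact: subrr.
apply/sections1P; exists 0%N, f; split; rewrite ?addn0 //.
  by apply: (low_fat fh) => a; apply: (jets_low fh).
by rewrite expr0 divr1.
Qed.

(** A cocycle of the ideal sheaf is the coboundary of sections g_i / X_i^N of O(d). Their
    differences lie in the ideal sheaf, so at each point they all have the same jets. Subtracting a
    global form with these jets leaves sections of the ideal sheaf. *)
Lemma H1_zero_of_surj d : jets_surj d -> H1_zero (fat_ideal P) d.
Proof.
move=> surj s sI sE.
have s00 i : s i i = 0 by have := sE i i i; rewrite subrr add0r.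
have sB i j : s i j = s ord0 j - s ord0 i.
  by apply/eqP; rewrite -subr_eq0 opprB addrA; apply/eqP; rewrite -[RHS](sE ord0 i j) addrAC.
have mulI i N f : fat_ideal P f -> fat_ideal P (f * 'X_i ^+ N).
  by move=> If a; rewrite mulrC; apply: ideal_pow_mull.
have /fin_all_exists[k /fin_all_exists[f0 H0]] (p : 'I_4 * 'I_4) : exists k f, p.1 != p.2 ->
    [/\ fat_ideal P f, f \is (d + k + k).-homog
      & s p.1 p.2 = tofrac f / (x p.1 ^+ k * x p.2 ^+ k)].
  case: (eqVneq p.1 p.2) => [_|ij]; first by exists 0%N, 0.
  by have [k [f H]] := (sections2P _ d (s p.1 p.2) ij).1 (sI _ _); exists k, f.
(* One exponent for all denominators; the sum is merely a convenient upper bound. *)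
pose N := (\sum_p k p)%N.
have kN p : (k p <= N)%N by rewrite /N (bigD1 p) //= leq_addr.
pose F i j := f0 (i, j) * 'X_i ^+ (N - k (i, j)) * 'X_j ^+ (N - k (i, j)).
have FI i j : i != j -> fat_ideal P (F i j).
  by move=> ij; have [H _ _] := H0 (i, j) ij; apply: (mulI _ _ _ (mulI _ _ _ H)).
have Xh i M : ('X_i ^+ M : {mpoly K[4]}) \is M.-homog.
  by rewrite -[X in X.-homog]mul1n; apply: dhomogMn; rewrite dhomogX /= mdeg1.
have Fh i j : i != j -> F i j \is (d + N + N).-homog.
  move=> ij; have [_ H _] := H0 (i, j) ij.
  have -> : (d + N + N = d + k (i, j) + k (i, j) + (N - k (i, j)) + (N - k (i, j)))%N.
    by have := kN (i, j); lia.
  by apply: dhomogM => //; apply: dhomogM.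
have sF i j : i != j -> s i j = tofrac (F i j) / (x i ^+ N * x j ^+ N).
  move=> ij; have [_ _ /= ->] := H0 (i, j) ij.
  apply/eqP; rewrite eqr_div ?mulf_neq0 ?x_neq0 // !tofracM !tofracXn.
  rewrite -{1 2}(subnK (kN (i, j))) !exprD; apply/eqP; ring.
have [j j0|i j i0 j0 ij|g [gh gE]] := @cocycle_split _ d N F.
- by apply: Fh; rewrite eq_sym.
- apply: tofrac_inj; rewrite tofrac0 -[RHS](mul0r (x ord0 ^+ N * x i ^+ N * x j ^+ N)).
  rewrite -(sE ord0 i j) !sF 1?eq_sym //; last by rewrite eq_sym.
  rewrite frac_cocycle ?x_neq0 // (tofracD (_ - _)) tofracMX2.
  by rewrite tofracMX.
(* [h] receives the jets of g_0 / X_0^N at every point. *)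
have [h hh hE] := surj (fun a b => (V a 0 ord0) ^- N * (vshift (V a) (g ord0))@_b).
have Gh i : g i - h * 'X_i ^+ N \is (d + N).-homog by apply: rpredB => //; apply: dhomogM.
have l0 (a : 'I_(size ms)) : low (mult a) (vshift (V a) (g ord0 - h * 'X_ord0 ^+ N)).
  apply: (jets_low (Gh _)) => b b0 bm.
  rewrite /vshift shiftB mcoeffB shiftM shiftXn shiftX1 mcoeff_mulXD //.
  by rewrite hE // mulrA divff ?expf_neq0 // mul1r subrr.
(* Only chart 0 was corrected by choice of [h]. As [F ord0 j] lies in the ideal and X_0^N is a unit
   at the point, the same [h] corrects chart j. *)
have lj (a : 'I_(size ms)) j : low (mult a) (vshift (V a) (g j - h * 'X_j ^+ N)).
  case: (eqVneq j ord0) => [->//|j0]; apply: (@low_cancelX a ord0 N).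
  have -> : (g j - h * 'X_j ^+ N) * 'X_ord0 ^+ N =
      (g ord0 - h * 'X_ord0 ^+ N) * 'X_j ^+ N + F ord0 j by rewrite gE //; ring.
  rewrite /vshift shiftD shiftM; apply: lowD; first exact: low_mulr (l0 a).
  by apply: fat_low; apply: FI; rewrite eq_sym.
exists (fun i => tofrac (g i - h * 'X_i ^+ N) / x i ^+ N).
  move=> i; apply/sections1P; exists N, (g i - h * 'X_i ^+ N); split=> //.
  exact: (low_fat (Gh i) (fun a => lj a i)).
have s0 j : s ord0 j = tofrac (g j - h * 'X_j ^+ N) / x j ^+ N
    - tofrac (g ord0 - h * 'X_ord0 ^+ N) / x ord0 ^+ N.
  case: (eqVneq j ord0) => [->|j0]; first by rewrite s00 subrr.
  rewrite sF 1?eq_sym // gE // tofracMX2 frac_sub ?x_neq0 //.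
  rewrite !(tofracB (g _)) !tofracMX frac_subh ?x_neq0 //.
by move=> i j; rewrite sB (s0 i) (s0 j) opprB addrA subrK.
Qed.
End Cech.

Section HomogProd.
Variables (R : comNzRingType) (n : nat).
Implicit Types p q : {mpoly R[n]}.

Lemma dhomogM_eq d d1 d2 p q : p \is d1.-homog -> q \is d2.-homog -> d = (d1 + d2)%N ->
  p * q \is d.-homog.
Proof. by move=> ph qh ->; apply: dhomogM. Qed.

Lemma dhomog1X p k : p \is 1.-homog -> p ^+ k \is k.-homog.
Proof. by move=> ph; have := dhomogMn k ph; rewrite mul1n. Qed.

Lemma dhomog_prodX (J : Type) (r : seq J) (F : J -> {mpoly R[n]}) (e : J -> nat) :
  (forall j, F j \is 1.-homog) -> \prod_(j <- r) F j ^+ e j \is (\sum_(j <- r) e j)%N.-homog.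
Proof.
move=> Fh; elim: r => [|j r IHr]; first by rewrite !big_nil dhomog1.
by rewrite !big_cons; apply: dhomogM => //; apply: dhomog1X.
Qed.

Lemma dhomogXi (i : 'I_n) : ('X_i : {mpoly R[n]}) \is 1.-homog.
Proof. by rewrite dhomogX /= mdeg1. Qed.
End HomogProd.

(** * Forms with prescribed jets, at one point and at several *)

Section OnePoint.
Variable K : fieldType.
Implicit Types (v : 'rV[K]_4).

(** Setting X_0 = 0 after a shift is a ring morphism that keeps exactly the coefficients free of
    X_0, so jets of products can be computed factor by factor. *)
Definition killX0 : 4.-tuple {mpoly K[4]} :=
  [tuple if i == ord0 then 0 else 'X_i | i < 4].

Lemma mcoeff_killX0 (f : {mpoly K[4]}) (b : 'X_{1..4}) :
  b ord0 = 0%N -> (f \mPo killX0)@_b = f@_b.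
Proof.
move=> b0; rewrite comp_mpolyEX [in RHS](mpolyE f) !raddf_sum /=; apply: eq_bigr => a _.
rewrite !mcoeffZ; congr (_ * _); rewrite comp_mpolyX mcoeffX.
case: (eqVneq (a ord0) 0%N) => a0.
  rewrite (_ : \prod_i _ = 'X_[a]) ?mcoeffX // mpolyXE_id; apply: eq_bigr => i _.
  by rewrite tnth_mktuple; case: eqP => [->|//]; rewrite a0.
rewrite (bigD1 ord0) //= tnth_mktuple eqxx expr0n (negPf a0) mul0r mcoeff0.
by case: eqP => // ab; case/eqP: a0; rewrite ab.
Qed.

(** The Taylor polynomial with coefficients [tau], made homogeneous of degree d. After the shift and
    X_0 = 0 the scaled X_0 becomes 1 and the j-th local variable becomes X_j. *)
Definition jet_form v d (tau : 'X_{1..4} -> K) m : {mpoly K[4]} :=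
  \sum_(p : {ffun 'I_4 -> 'I_d.+1} |
        (p ord0 == ord0) && (mdeg (mnm_of_ffun p) < m)%N)
    tau (mnm_of_ffun p) *:
      (((v 0 ord0)^-1 *: 'X_ord0) ^+ (d - mdeg (mnm_of_ffun p))
       * \prod_j local_var (fun j => v 0 j) j ^+ p j).

Lemma jet_form_homog v d tau m : (m <= d.+1)%N -> jet_form v d tau m \is d.-homog.
Proof.
move=> md; apply: rpred_sum => p /andP[_ pm]; apply: rpredZ.
have pd : (mdeg (mnm_of_ffun p) <= d)%N by rewrite -ltnS (leq_trans pm).
apply: dhomogM_eq (esym (subnK pd)); first by apply: dhomog1X; apply/rpredZ/dhomogXi.
rewrite mdeg_mnm_of_ffun; apply: dhomog_prodX => i.
by apply: rpredB; [|apply: rpredZ]; apply: dhomogXi.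
Qed.

Lemma jet_formE v d tau m (b : 'X_{1..4}) : v 0 ord0 != 0 -> (m <= d.+1)%N ->
  b ord0 = 0%N -> (mdeg b < m)%N -> (vshift v (jet_form v d tau m))@_b = tau b.
Proof.
move=> v0 md b0 bm; rewrite -mcoeff_killX0 //.
have sX i : shift (fun j => v 0 j) 'X_i \mPo killX0 =
    (if i == ord0 then 0 else 'X_i) + (v 0 i)%:MP.
  by rewrite shiftX1 raddfD /= comp_mpolyC comp_mpolyXU -tnth_nth tnth_mktuple.
have sy j : shift (fun j => v 0 j) (local_var (fun j => v 0 j) j) \mPo killX0 =
    if j == ord0 then 0 else 'X_j.
  rewrite /local_var shiftB shiftZ raddfB /= linearZ /= !sX eqxx add0r.
  rewrite -mul_mpolyC -mpolyCM divfK // addrK; by [].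
have ss : shift (fun j => v 0 j) ((v 0 ord0)^-1 *: 'X_ord0) \mPo killX0 = 1.
  by rewrite shiftZ linearZ /= sX eqxx add0r -mul_mpolyC -mpolyCM mulVf.
have -> : vshift v (jet_form v d tau m) \mPo killX0 =
  \sum_(p : {ffun 'I_4 -> 'I_d.+1} |
      (p ord0 == ord0) && (mdeg (mnm_of_ffun p) < m)%N)
    tau (mnm_of_ffun p) *: 'X_[mnm_of_ffun p].
  rewrite /vshift /jet_form shift_sum raddf_sum; apply: eq_bigr => p /andP[/eqP p0 _] /=.
  rewrite shiftZ linearZ /=; congr (_ *: _).
  rewrite shiftM rmorphM /= shiftXn rmorphXn /= ss expr1n mul1r shift_prod rmorph_prod /=.
  rewrite mpolyXE_id; apply: eq_bigr => j _.
  rewrite shiftXn rmorphXn /= sy mnmE; case: eqP => // ->.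
  by rewrite p0.
have bd i : (b i < d.+1)%N.
  by rewrite (leq_trans _ md) // (leq_ltn_trans _ bm) // mdegE (bigD1 i) //= leq_addr.
pose pb := [ffun i => Ordinal (bd i)].
have mpb : mnm_of_ffun pb = b by apply/mnmP=> i; rewrite mnmE ffunE.
rewrite raddf_sum (bigD1 pb) /=; last first.
  by rewrite mpb bm andbT; apply/eqP/val_inj; rewrite ffunE.
rewrite mcoeffZ mcoeffX mpb eqxx mulr1 big1 ?addr0 // => p /andP[_ pn] /=.
rewrite mcoeffZ mcoeffX; case: eqP => [pE|]; rewrite ?mulr0 //.
by case/eqP: pn; apply/ffunP=> i; apply: val_inj; rewrite ffunE /= -pE mnmE.
Qed.
End OnePoint.

Section Separate.
Variables (K : fieldType) (k mu : nat) (V : 'I_k -> 'rV[K]_4).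
Hypothesis V0 : forall a j, V a 0 j != 0.
Let i0 : 'I_4 := ord0.
Let i1 : 'I_4 := inord 1.
Hypothesis Vd : forall a b, a != b -> V b 0 i0 * V a 0 i1 != V b 0 i1 * V a 0 i0.

(* Writing E for the power of X_l and L for the product of linear forms through
   the other points, both with value 1 at V a, this is the part of the binomial
   expansion of ((E - L) + L)^(2 mu) that is divisible by L^mu. *)
Lemma separating_form a l : exists2 F : {mpoly K[4]},
  F \is (k * mu.*2).-homog &
  low mu (vshift (V a) (F - 'X_l ^+ (k * mu.*2))) /\
  forall b, b != a -> low mu (vshift (V b) F).
Proof.
pose c := V a 0 l; pose E : {mpoly K[4]} := (c^-1 *: 'X_l) ^+ k.
(* For b other than a: the plane through [V b] in the pencil of X_0 and X_1, scaled to the value 1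
   at [V a]; by [Vd] it misses [V a]. *)
pose lin b : {mpoly K[4]} := if b == a then c^-1 *: 'X_l else
  (V b 0 i0 * V a 0 i1 - V b 0 i1 * V a 0 i0)^-1 *:
    (V b 0 i0 *: 'X_i1 - V b 0 i1 *: 'X_i0).
pose L := \prod_b lin b.
have linh b : lin b \is 1.-homog.
  by rewrite /lin; case: eqP => _; repeat (apply: rpredZ || apply: rpredB || apply: dhomogXi).
have Eh : E \is k.-homog.
  by apply: dhomog1X; apply: rpredZ; apply: dhomogXi.
have Lh : L \is k.-homog.
  by have := dhomog_prodX (index_enum 'I_k) (fun=> 1%N) linh; rewrite sum1_card card_ord.
have Ea : E.@[fun j => V a 0 j] = 1.
  by rewrite rmorphXn /= mevalZ mevalXU mulVf ?expr1n ?V0.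
have La : L.@[fun j => V a 0 j] = 1.
  rewrite rmorph_prod big1 // => b _; rewrite /= /lin; case: eqP => [_|/eqP ba].
    by rewrite mevalZ mevalXU mulVf ?V0.
  by rewrite mevalZ mevalB !mevalZ !mevalXU mulVf // subr_eq0 Vd // eq_sym.
have Lb b : b != a -> L.@[fun j => V b 0 j] = 0.
  move=> ba; rewrite rmorph_prod (bigD1 b) //= /lin (negPf ba).
  by rewrite mevalZ mevalB !mevalZ !mevalXU (mulrC (V b 0 i1) (V b 0 i0)) subrr mulr0 mul0r.
have lowE : low 1 (vshift (V a) (E - L)).
  by apply/low1P; rewrite /vshift shift_coef0 mevalB Ea La subrr.
have lowL b : b != a -> low 1 (vshift (V b) L).
  by move=> ba; apply/low1P; rewrite /vshift shift_coef0 Lb.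
pose term (i : nat) := ((E - L) ^+ (mu.*2 - i) * L ^+ i) *+ 'C(mu.*2, i).
have EE : E ^+ mu.*2 = \sum_(i < mu.*2.+1) term i.
  by rewrite -[E in LHS](subrK L) exprDn.
pose S := \sum_(i < mu.*2.+1 | (mu <= i)%N) term i.
have XlE : 'X_l ^+ (k * mu.*2) = c ^+ (k * mu.*2) *: E ^+ mu.*2.
  by rewrite -exprM exprZn scalerA -exprMn divff ?expr1n ?scale1r ?V0.
exists (c ^+ (k * mu.*2) *: S).
  apply: rpredZ; apply: rpred_sum => i _; apply: rpredMn.
  have iE : (k * mu.*2 = k * (mu.*2 - i) + k * i)%N.
    by rewrite -mulnDr subnK // -ltnS.
  by apply: dhomogM_eq iE; apply: dhomogMn => //; apply: rpredB.
split.
  rewrite XlE -scalerBr EE (bigID (fun i : 'I__ => (mu <= i)%N)) /= -/S opprD addNKr.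
  rewrite /vshift shiftZ -mul_mpolyC; apply: low_mull.
  rewrite -mulN1r shiftM; apply: low_mull; rewrite shift_sum; apply: low_sum => i.
  rewrite -ltnNge => im; rewrite /term -mulr_natr shiftM; apply: low_mulr.
  rewrite shiftM; apply: low_mulr; rewrite shiftXn.
  apply: (low_leq (m := 1 * (mu.*2 - i))); last exact: lowX.
  by rewrite mul1n; lia.
move=> b ba; rewrite /vshift shiftZ -mul_mpolyC; apply: low_mull.
rewrite shift_sum; apply: low_sum => i im.
rewrite /term -mulr_natr shiftM; apply: low_mulr; rewrite shiftM; apply: low_mull.
rewrite shiftXn; apply: (low_leq (m := 1 * i)); last by apply: lowX; apply: lowL.
by rewrite mul1n.
Qed.
End Separate.

Lemma coboundary_cocycle (R : comNzRingType) (X Y Z : R) : Z - Y - (Z - X) + (Y - X) = 0.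
Proof. ring. Qed.

Lemma sub_exchange (R : comNzRingType) (A B C D : R) : B - A = D - C -> A - C = B - D.
Proof.
move=> E; have -> : B = A + (D - C) by rewrite -E addrC subrK.
ring.
Qed.

Section CechConverse.
Variables (K : fieldType) (ms : seq nat).
Variables (P : 'I_(size ms) -> proj3 K) (V : 'I_(size ms) -> 'rV[K]_4).
Hypothesis PV : forall a, sval (P a) = <[V a]>%VS.
Hypothesis V0 : forall a j, V a 0 j != 0.
Hypothesis Vd : forall a b, a != b ->
  V b 0 ord0 * V a 0 (inord 1) != V b 0 (inord 1) * V a 0 ord0.

Local Notation mult a := (nth 0%N ms a).
Local Notation x i := (tofrac ('X_i : {mpoly K[4]})).

(** The forms [h a] realise the jets at one point each, and the separating forms patch them into
    [G l] such that G_l / X_l^N has the wanted jets at every point. The differences between charts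
    are a cocycle of the ideal sheaf; once it is a coboundary, correcting by it leaves a global form
    with the wanted jets. *)
Lemma surj_of_H1_zero d : {in ms, forall m, m <= d.+1}%N ->
  H1_zero (fat_ideal P) d -> jets_surj V d.
Proof.
move=> msd H1 tau; pose k := size ms.
have md (a : 'I_k) : (mult a <= d.+1)%N by apply: msd; apply: mem_nth.
(* Separation to order d + 1 covers all multiplicities with a single degree. *)
pose N := (k * d.+1.*2)%N.
have /fin_all_exists[F0 HF] (p : 'I_k * 'I_4) : exists F : {mpoly K[4]}, F \is N.-homog /\
  (low d.+1 (vshift (V p.1) (F - 'X_p.2 ^+ N)) /\
   forall b, b != p.1 -> low d.+1 (vshift (V b) F)).
  by have [F ? ?] := separating_form d.+1 V0 Vd p.1 p.2; exists F.
pose F a l := F0 (a, l).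
pose h a := jet_form (V a) d (tau a) (mult a).
have hh a : h a \is d.-homog by apply: jet_form_homog.
pose G l := \sum_a F a l * h a.
have Gh l : G l \is (d + N).-homog.
  apply: rpred_sum => a _; apply: dhomogM_eq (hh a) (addnC _ _).
  by have [] := HF (a, l).
have lG (a : 'I_k) l : low (mult a) (vshift (V a) (G l - h a * 'X_l ^+ N)).
  rewrite /G (bigD1 a) //= addrAC (mulrC (h a)) -mulrBl /vshift shiftD shiftM.
  apply: (low_leq (md a)); apply: lowD.
    by apply: low_mulr; have [_ []] := HF (a, l).
  rewrite shift_sum; apply: low_sum => b ba; rewrite shiftM; apply: low_mulr.
  by have [_ [_ H]] := HF (b, l); apply: H; rewrite eq_sym.
have GXh i j : G j * 'X_i ^+ N - G i * 'X_j ^+ N \is (d + N + N).-homog.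
  by apply: rpredB; apply: dhomogM => //; apply/dhomog1X/dhomogXi.
pose t0 i := tofrac (G i) / x i ^+ N.
have [i j|i j l|t tI tE] := H1 (fun i j => t0 j - t0 i).
- case: (eqVneq i j) => [->|ij].
    rewrite subrr; exists 0%N, 0; split; last by rewrite tofrac0 mul0r.
      by move=> a; apply: ideal_pow0.
    exact: rpred0.
  apply/(sections2P _ _ _ ij); exists N, (G j * 'X_i ^+ N - G i * 'X_j ^+ N); split.
  + apply: (low_fat PV V0 (GXh i j)) => a.
    have -> : G j * 'X_i ^+ N - G i * 'X_j ^+ N =
      (G j - h a * 'X_j ^+ N) * 'X_i ^+ N - (G i - h a * 'X_i ^+ N) * 'X_j ^+ N by ring.
    by rewrite /vshift shiftB !shiftM; apply: lowB; apply: low_mulr; apply: lG.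
  + exact: GXh.
  + by rewrite tofracMX2 frac_sub ?x_neq0.
- exact: coboundary_cocycle.
have /fin_all_exists[e /fin_all_exists[f Hf]] i : exists k f,
    [/\ fat_ideal P f, f \is (d + k).-homog & t i = tofrac f / x i ^+ k].
  by apply/sections1P; apply: tI.
have uE i : t0 ord0 - t ord0 = t0 i - t i.
  by apply: sub_exchange; apply: tE.
have [i|i|g gh [_ gE]] := @glue _ (t0 ord0 - t ord0) d (fun i => N + e i)%N
  (fun i => G i * 'X_i ^+ e i - f i * 'X_i ^+ N).
- have [_ fh _] := Hf i; apply: rpredB.
    by rewrite addnA; apply: dhomogM => //; apply/dhomog1X/dhomogXi.
  by rewrite (addnC N) addnA; apply: dhomogM => //; apply/dhomog1X/dhomogXi.
- rewrite (uE i); have [_ _ ->] := Hf i.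
  rewrite tofracMX2 exprD [X in _ = _ / X]mulrC.
  by rewrite frac_sub ?x_neq0.
exists g => // a b b0 bm.
suff lg : low (mult a) (vshift (V a) (h a - g)).
  have := lg b bm; rewrite /vshift shiftB mcoeffB => /eqP.
  by rewrite subr_eq0 => /eqP<-; apply: jet_formE.
apply: (low_cancelX V0 (i := ord0) (N := N + e ord0)).
have -> : (h a - g) * 'X_ord0 ^+ (N + e ord0) =
  f ord0 * 'X_ord0 ^+ N - (G ord0 - h a * 'X_ord0 ^+ N) * 'X_ord0 ^+ e ord0.
  by rewrite mulrBl -gE exprD; ring.
rewrite /vshift shiftB !shiftM; apply: lowB; apply: low_mulr; last exact: lG.
by apply: (fat_low PV); have [] := Hf ord0.
Qed.
End CechConverse.

(** * The jet matrix *)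

Definition quad := (nat * nat * nat * nat)%type.

Definition mnm_of_quad (q : quad) : 'X_{1..4} :=
  let: (a, b, c, e) := q in [multinom of [:: a; b; c; e]].

Definition monomials d : seq quad :=
  [seq (a.1, a.2, c, d - a.1 - a.2 - c)%N |
     a <- [seq (a, b) | a <- iota 0 d.+1, b <- iota 0 (d - a).+1],
     c <- iota 0 (d - a.1 - a.2).+1].

(* The partial derivatives of order < m not involving X_0. *)
Definition jet_indices m : seq quad :=
  [seq (0, a.1, a.2, c)%N |
     a <- [seq (a, b) | a <- iota 0 m, b <- iota 0 (m - a)],
     c <- iota 0 (m - a.1 - a.2)].

Lemma mnm_quadK (a : 'X_{1..4}) :
  mnm_of_quad (a ord0, a (inord 1), a (inord 2), a (inord 3)) = a.
Proof.
apply/mnmP=> i; rewrite multinomE (tnth_nth 0%N) /=.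
case: i => [[|[|[|[|//]]]]] Hi /=; congr (a _); apply: val_inj; rewrite /= ?inordK //.
Qed.

Lemma mdeg_quad a b c e : mdeg (mnm_of_quad (a, b, c, e)) = (a + b + c + e)%N.
Proof. by rewrite mdegE !big_ord_recl big_ord0 !multinomE !(tnth_nth 0%N) /= addn0 !addnA. Qed.

Lemma mem_monomials d a b c e :
  ((a, b, c, e) \in monomials d) = (a + b + c + e == d)%N.
Proof.
rewrite /monomials; apply/allpairsPdep/eqP.
  move=> [[a' b'] [c' [/allpairsPdep[x [y [xd yd [-> ->]]]] cd]]] /= [-> -> -> ->].
  by move: xd yd cd; rewrite !mem_iota /=; lia.
move=> <-; exists (a, b), c; split.
- by apply/allpairsPdep; exists a, b; rewrite !mem_iota; split=> //; lia.
- by rewrite mem_iota /=; lia.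
- by congr (_, _, _, _) => /=; lia.
Qed.

Lemma mem_jet_indices m a b c e :
  ((a, b, c, e) \in jet_indices m) = (a == 0)%N && (b + c + e < m)%N.
Proof.
rewrite /jet_indices; apply/allpairsPdep/andP.
  move=> [[a' b'] [c' [/allpairsPdep[x [y [xd yd [-> ->]]]] cd]]] /= [-> -> -> ->].
  by move: xd yd cd; rewrite !mem_iota /=; lia.
move=> [/eqP-> H]; exists (b, c), e; split=> //; last by rewrite mem_iota /=; lia.
by apply/allpairsPdep; exists b, c; rewrite !mem_iota; split=> //; lia.
Qed.

Lemma uniq_monomials d : uniq (monomials d).
Proof.
apply: allpairs_uniq_dep.
- by apply: allpairs_uniq_dep => [|a _|[a b] [a' b'] _ _ /= [-> ->]]; rewrite ?iota_uniq.
- by move=> a _; apply: iota_uniq.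
by move=> [[a b] c] [[a' b'] c'] _ _ /= [-> -> ->].
Qed.

Lemma uniq_jet_indices m : uniq (jet_indices m).
Proof.
apply: allpairs_uniq_dep.
- by apply: allpairs_uniq_dep => [|a _|[a b] [a' b'] _ _ /= [-> ->]]; rewrite ?iota_uniq.
- by move=> a _; apply: iota_uniq.
by move=> [[a b] c] [[a' b'] c'] _ _ /= [-> -> ->].
Qed.

Lemma mnm_of_quad_inj : injective mnm_of_quad.
Proof.
move=> [[[a b] c] e] [[[a' b'] c'] e'] /mnmP E.
have := E ord0; have := E (inord 1); have := E (inord 2); have := E (inord 3).
by rewrite !multinomE !(tnth_nth 0%N) /= !inordK //= => -> -> -> ->.
Qed.

Section JetMatrix.
Variables (R : comNzRingType) (ms : seq nat) (d : nat).

Definition conditions : seq ('I_(size ms) * quad) :=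
  [seq (i, b) | i <- enum 'I_(size ms), b <- jet_indices (nth 0%N ms (nat_of_ord i))].

(** Coefficient vectors of forms multiply from the left: [row_free] says that no non-zero form of
    degree d meets all conditions, [row_full] that the conditions are independent. *)
Definition jet_mx (A : 'M[R]_(size ms, 4)) : 'M[R]_(size (monomials d), size conditions) :=
  \matrix_(r, c) hasse (mnm_of_quad (tnth (in_tuple (monomials d)) r))
     (mnm_of_quad (tnth (in_tuple conditions) c).2)
     (fun l => A (tnth (in_tuple conditions) c).1 l).
End JetMatrix.

Section Link.
Variables (K : fieldType) (ms : seq nat) (d : nat).
Implicit Types (f : {mpoly K[4]}) (A : 'M[K]_(size ms, 4)).

Definition form_of (c : 'rV[K]_(size (monomials d))) : {mpoly K[4]} :=
  \sum_r c 0 r *: 'X_[mnm_of_quad (tnth (in_tuple (monomials d)) r)].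

Definition coef_of f : 'rV[K]_(size (monomials d)) :=
  \row_r f@_(mnm_of_quad (tnth (in_tuple (monomials d)) r)).

Lemma form_of_homog c : form_of c \is d.-homog.
Proof.
apply: rpred_sum => r _; apply: rpredZ; rewrite dhomogX /=.
have := mem_tnth r (in_tuple (monomials d)).
by case: (tnth _ r) => [[[a b] e] g]; rewrite mem_monomials mdeg_quad.
Qed.

Lemma form_ofK c : coef_of (form_of c) = c.
Proof.
apply/rowP=> r; rewrite mxE /form_of raddf_sum (bigD1 r) //= mcoeffZ mcoeffX eqxx mulr1.
rewrite big1 ?addr0 // => r' rr'; rewrite mcoeffZ mcoeffX; case: eqP => [|_]; last by rewrite mulr0.
move/mnm_of_quad_inj => E; case/eqP: rr'; apply/val_inj/eqP.
move/eqP: E; rewrite !(tnth_nth (0,0,0,0)%N) /=.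
by rewrite nth_uniq ?uniq_monomials // ltn_ord.
Qed.

Lemma coef_ofK f : f \is d.-homog -> form_of (coef_of f) = f.
Proof.
move=> /dhomogP fh; apply/mpolyP => a.
case: (eqVneq (mdeg a) d) => ad; last first.
  rewrite (memN_msupp_eq0 (p := f)); last by apply: contraNN ad => /fh ->.
  apply: memN_msupp_eq0; apply: contraNN ad.
  by move/dhomogP: (form_of_homog (coef_of f)) => H /H ->.
have am : (a ord0, a (inord 1), a (inord 2), a (inord 3)) \in monomials d.
  by rewrite mem_monomials -mdeg_quad mnm_quadK ad.
have /tnthP[r rE] : (a ord0, a (inord 1), a (inord 2), a (inord 3)) \in in_tuple (monomials d).
  by [].
have := congr1 (fun u : 'rV_ _ => u 0 r) (form_ofK (coef_of f)).
by rewrite !mxE -rE mnm_quadK.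
Qed.

Lemma coef_of0 f : f \is d.-homog -> coef_of f = 0 -> f = 0.
Proof.
move=> fh f0; rewrite -(coef_ofK fh) f0 /form_of big1 // => r _.
by rewrite mxE scale0r.
Qed.

Lemma jet_mxE A f c : f \is d.-homog ->
  (coef_of f *m jet_mx d A) 0 c = (vshift (row (tnth (in_tuple (conditions ms)) c).1 A) f)@_
    (mnm_of_quad (tnth (in_tuple (conditions ms)) c).2).
Proof.
move=> fh; rewrite -{2}(coef_ofK fh) /vshift /form_of shift_sum raddf_sum mxE.
apply: eq_bigr => r _ /=; rewrite shiftZ mcoeffZ mcoeff_shiftX !mxE; congr (_ * _).
by apply: eq_bigr => l _; rewrite mxE.
Qed.

Lemma condition_tnth (i : 'I_(size ms)) (b : 'X_{1..4}) : b ord0 = 0%N ->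
  (mdeg b < nth 0%N ms i)%N -> exists c,
  (tnth (in_tuple (conditions ms)) c).1 = i /\
  mnm_of_quad (tnth (in_tuple (conditions ms)) c).2 = b.
Proof.
move=> b0 bm; pose q := (b ord0, b (inord 1), b (inord 2), b (inord 3)).
have /tnthP[c cE] : (i, q) \in in_tuple (conditions ms).
  apply/allpairsPdep; exists i, q; rewrite mem_enum; split=> //.
  rewrite mem_jet_indices b0 /=; move: bm.
  by rewrite -{1}(mnm_quadK b) mdeg_quad b0.
by exists c; rewrite -cE mnm_quadK.
Qed.

Lemma conditionsP c : let ib := tnth (in_tuple (conditions ms)) c in
  (mnm_of_quad ib.2) ord0 = 0%N /\ (mdeg (mnm_of_quad ib.2) < nth 0%N ms ib.1)%N.
Proof.
move=> ib; have := mem_tnth c (in_tuple (conditions ms)); rewrite -/ib.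
case/allpairsPdep => i [[[[a b'] e] g] [_ H ->]] /=; move: H.
rewrite mem_jet_indices mdeg_quad multinomE => /andP[/eqP-> ?].
by split=> //; rewrite (tnth_nth 0%N).
Qed.

Lemma jets_inj_row_free A : row_free (jet_mx d A) <-> jets_inj (fun i => row i A) d.
Proof.
split.
  move=> Af f fh fj; apply: (coef_of0 fh); apply: (row_free_inj Af).
  rewrite mul0mx; apply/rowP=> c; rewrite jet_mxE // mxE.
  by have [? ?] := conditionsP c; apply: fj.
move=> inj; apply/inj_row_free => u uA.
rewrite -(form_ofK u) (inj (form_of u)) ?form_of_homog //.
  by apply/rowP=> r; rewrite !mxE mcoeff0.
move=> i b b0 bm; have [c [<- <-]] := condition_tnth b0 bm.
by rewrite -jet_mxE ?form_of_homog // form_ofK uA mxE.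
Qed.

Lemma jets_surj_row_full A : row_full (jet_mx d A) <-> jets_surj (fun i => row i A) d.
Proof.
split.
  move=> Af tau; pose t := \row_c tau (tnth (in_tuple (conditions ms)) c).1
     (mnm_of_quad (tnth (in_tuple (conditions ms)) c).2).
  have /submxP[u uE] : (t <= jet_mx d A)%MS by apply: submx_full.
  exists (form_of u); first exact: form_of_homog.
  move=> i b b0 bm; have [c [<- <-]] := condition_tnth b0 bm.
  by rewrite -jet_mxE ?form_of_homog // form_ofK -uE mxE.
move=> surj; rewrite -sub1mx; apply/row_subP => c0.
have cu : uniq (conditions ms).
  by apply: allpairs_uniq_dep => [|i _|[i b] [i' b'] _ _ /= [-> ->]];
    rewrite ?enum_uniq ?uniq_jet_indices.
pose ib := tnth (in_tuple (conditions ms)) c0.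
have [h hh hE] := surj (fun i b => ((i == ib.1) && (b == mnm_of_quad ib.2))%:R).
apply/submxP; exists (coef_of h); apply/rowP=> c; rewrite jet_mxE //.
have [? ?] := conditionsP c; rewrite hE // !mxE; congr (_%:R).
congr nat_of_bool; apply/eqP/andP => [<-//|[/eqP E1 /eqP/mnm_of_quad_inj E2]].
apply/val_inj/eqP; rewrite -(nth_uniq (ib) _ _ cu) ?ltn_ord //.
rewrite -!(tnth_nth ib (in_tuple _)) -/ib eq_sym.
by apply/eqP; move: E1 E2; case: (tnth _ c) => [i b] /= -> ->; case: (ib).
Qed.
End Link.

(** * Open conditions on the points *)

Section Multihomog.
Variables (K : fieldType) (k : nat).
Implicit Types (F G : {mpoly K[k * 4]}) (e : 'I_k -> nat) (A : 'M[K]_(k, 4)).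

Definition multideg (m : 'X_{1..k * 4}) (i : 'I_k) := (\sum_(j < 4) m (mxvec_index i j))%N.

Definition has_multideg e F := forall m, m \in msupp F -> forall i, multideg m i = e i.

Definition gen_mx : 'M[{mpoly K[k * 4]}]_(k, 4) := \matrix_(i, j) 'X_(mxvec_index i j).

Definition eval_mx A F := F.@[fun a => mxvec A 0 a].

Lemma multidegD m1 m2 i : multideg (m1 + m2)%MM i = (multideg m1 i + multideg m2 i)%N.
Proof. by rewrite /multideg -big_split; apply: eq_bigr => j _; rewrite mnmDE. Qed.

Lemma has_multideg0 e : has_multideg e 0.
Proof. by move=> m; rewrite msupp0. Qed.

Lemma has_multideg1 : has_multideg (fun=> 0%N) 1.
Proof.
move=> m; rewrite msupp1 inE => /eqP-> i.
by rewrite /multideg big1 // => j _; rewrite mnm0E.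
Qed.

Lemma has_multidegD e F G : has_multideg e F -> has_multideg e G -> has_multideg e (F + G).
Proof. by move=> hF hG m /msuppD_le; rewrite mem_cat => /orP[/hF|/hG]. Qed.

Lemma has_multideg_sum e (I : Type) (r : seq I) (P : pred I) (H : I -> {mpoly K[k * 4]}) :
  (forall i, P i -> has_multideg e (H i)) -> has_multideg e (\sum_(i <- r | P i) H i).
Proof.
by move=> hH; apply: big_ind hH; [apply: has_multideg0 | apply: has_multidegD].
Qed.

Lemma has_multidegM e1 e2 F G : has_multideg e1 F -> has_multideg e2 G ->
  has_multideg (fun i => e1 i + e2 i)%N (F * G).
Proof.
move=> hF hG m /msuppM_le /allpairsP[[m1 m2] /= [m1F m2G ->]] i.
by rewrite multidegD (hF _ m1F) (hG _ m2G).
Qed.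

Lemma has_multidegN e F : has_multideg e F -> has_multideg e (- F).
Proof. by move=> hF m; rewrite (perm_mem (msuppN F)); apply: hF. Qed.

Lemma has_multidegMn e F n : has_multideg e F -> has_multideg e (F *+ n).
Proof.
move=> hF; elim: n => [|n IHn]; first exact: has_multideg0.
by rewrite mulrS; apply: has_multidegD.
Qed.

Lemma has_multideg_prod (I : Type) (r : seq I) (H : I -> {mpoly K[k * 4]})
    (e : I -> 'I_k -> nat) :
  (forall x, has_multideg (e x) (H x)) ->
  has_multideg (fun i => \sum_(x <- r) e x i)%N (\prod_(x <- r) H x).
Proof.
move=> hH; elim: r => [|x r IHr].
  by rewrite big_nil => m /has_multideg1 E i; rewrite E big_nil.
rewrite big_cons => m /(has_multidegM (hH x) IHr) E i.
by rewrite E big_cons.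
Qed.

Lemma has_multidegX e F n : has_multideg e F -> has_multideg (fun i => n * e i)%N (F ^+ n).
Proof.
move=> hF; elim: n => [|n IHn]; first exact: has_multideg1.
by rewrite exprS => m /(has_multidegM hF IHn) E i; rewrite E mulSn.
Qed.

Lemma mxvec_index_inj (i i' : 'I_k) (j j' : 'I_4) :
  mxvec_index i j = mxvec_index i' j' -> i = i' /\ j = j'.
Proof. by move/cast_ord_inj/enum_rank_inj => -[-> ->]. Qed.

Lemma has_multideg_gen i j : has_multideg (fun l => (l == i) : nat) (gen_mx i j).
Proof.
move=> m; rewrite mxE msuppX inE => /eqP-> l; rewrite /multideg.
case: eqP => [->|li].
  rewrite (bigD1 j) //= mnm1E eqxx big1 // => j' jj'; rewrite mnm1E.
  by case: eqP => // /mxvec_index_inj[_ E]; rewrite E eqxx in jj'.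
rewrite big1 // => j' _; rewrite mnm1E.
by case: eqP => // /mxvec_index_inj[E _]; case: li.
Qed.

Lemma big_mxvec (R : Type) (idx : R) (op : Monoid.com_law idx) (H : 'I_(k * 4) -> R) :
  \big[op/idx]_a H a = \big[op/idx]_i \big[op/idx]_j H (mxvec_index i j).
Proof.
rewrite (reindex (uncurry (@mxvec_index k 4))) /=; last exact: curry_mxvec_bij.
by rewrite pair_bigA; apply: eq_bigr => -[].
Qed.

Lemma eval_scale e F A B (c : 'I_k -> K) : has_multideg e F ->
  (forall i, row i B = c i *: row i A) -> eval_mx B F = \prod_i c i ^+ e i * eval_mx A F.
Proof.
move=> hF BA; rewrite /eval_mx !mevalE mulr_sumr big_seq [RHS]big_seq.
apply: eq_bigr => m mF; rewrite mulrCA; congr (_ * _).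
rewrite !big_mxvec -big_split; apply: eq_bigr => i _ /=.
rewrite -(hF m mF i) /multideg -prodrXr -big_split; apply: eq_bigr => j _ /=.
rewrite !mxvecE -exprMn; congr (_ ^+ _).
by have := congr1 (fun u : 'rV_4 => u 0 j) (BA i); rewrite !mxE.
Qed.

Lemma eval_gen A i j : eval_mx A (gen_mx i j) = A i j.
Proof. by rewrite /eval_mx mxE mevalXU mxvecE. Qed.

Lemma map_gen A : map_mx (eval_mx A) gen_mx = A.
Proof. by apply/matrixP=> i j; rewrite -[RHS]eval_gen !mxE. Qed.

Definition torus_poly : {mpoly K[k * 4]} := \prod_i \prod_j gen_mx i j.

Lemma eval_torus A : (eval_mx A torus_poly != 0) = [forall i, forall j, A i j != 0].
Proof.
have -> : eval_mx A torus_poly = \prod_i \prod_j A i j.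
  rewrite /torus_poly /eval_mx rmorph_prod; apply: eq_bigr => i _ /=.
  by rewrite rmorph_prod; apply: eq_bigr => j _; apply: eval_gen.
apply/prodf_neq0/'forall_forallP => H i; last by move=> _; apply/prodf_neq0.
by move=> j; have /prodf_neq0/(_ j isT) := H i isT.
Qed.

Lemma line_of_proj (P : proj3 K) : {v : 'rV[K]_4 | sval P = <[v]>%VS}.
Proof.
exists (vpick (sval P)); apply/esym/eqP; rewrite eqEdim -memvE memv_pick /=.
have /eqP dP := svalP P; rewrite dP dim_vline.
have : sval P != 0%VS by rewrite -dimv_eq0 dP.
by rewrite -vpick0 => ->.
Qed.

(** By multihomogeneity the non-vanishing of [F] does not depend on the vectors chosen on the lines,
    and [A0] shows that the open set is not empty. *)
Lemma for_general_intro e F (Q : ('I_k -> proj3 K) -> Prop) A0 :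
  has_multideg e F -> eval_mx A0 F != 0 -> (forall i, row i A0 != 0) ->
  (forall P V, (forall i, sval (P i) = <[row i V]>%VS) -> eval_mx V F != 0 -> Q P) ->
  for_general Q.
Proof.
move=> hF FA0 A0n H; exists (fun P => ~ vanishes_at F P); split.
- exists (vanishes_at F); last by [].
  exists (eq F); split=> [_ <-|P]; first by exists e.
  by split=> [vP _ <-|/(_ F erefl)].
- have dimA i : \dim <[row i A0]>%VS == 1%N by rewrite dim_vline A0n.
  exists (fun i => exist (fun L : {vspace 'rV[K]_4} => \dim L == 1%N) _ (dimA i)) => vP; case/eqP: FA0; apply: vP => i /=.
  exact: memv_line.
move=> P nP; pose V : 'M[K]_(k, 4) := \matrix_i sval (line_of_proj (P i)).
have PV i : sval (P i) = <[row i V]>%VS.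
  by rewrite rowK; case: (line_of_proj _).
apply: (H P V PV); apply/eqP => FV; apply: nP => A PA.
have cA i : exists c, row i A = c *: row i V by apply/vlineP; rewrite -PV.
have [c cE] := fin_all_exists cA.
by rewrite -/(eval_mx _ _) (eval_scale hF cE) FV mulr0.
Qed.
End Multihomog.

Section GeneralMinor.
Variables (K : fieldType) (ms : seq nat) (d : nat).
Local Notation k := (size ms).
Implicit Types (A V : 'M[K]_(k, 4)).

Lemma map_jet_mx (R S : comNzRingType) (phi : {rmorphism R -> S}) (A : 'M[R]_(k, 4)) :
  map_mx phi (jet_mx d A) = jet_mx d (map_mx phi A).
Proof.
apply/matrixP=> r c; rewrite !mxE /hasse rmorph_prod; apply: eq_bigr => j _.
by rewrite rmorphMn rmorphXn mxE.
Qed.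

Definition minor (R : comNzRingType) n f g (A : 'M[R]_(k, 4)) : R :=
  \det (mxsub (n' := n) (m' := n) f g (jet_mx d A)).

Lemma eval_minor n f g A : eval_mx A (minor (n := n) f g (gen_mx K k)) = minor f g A.
Proof.
rewrite /minor /eval_mx -det_map_mx map_mxsub map_jet_mx.
by congr (\det (mxsub _ _ (jet_mx d _))); exact: map_gen.
Qed.

(** The column of a condition (i, b) has degree d - |b| in the coordinates of point i and degree 0
    in the others. Each product in the determinant takes one entry from every column, so its
    multidegree is the same for all permutations. *)
Lemma minor_multideg n f g : exists e, has_multideg e (minor (n := n) f g (gen_mx K k)).
Proof.
pose ib x := tnth (in_tuple (conditions ms)) (g x).
pose deg x := (d - mdeg (mnm_of_quad (ib x).2))%N.
exists (fun i => \sum_x (i == (ib x).1) * deg x)%N; rewrite /minor /determinant.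
have ent x y : has_multideg (fun i => (i == (ib y).1) * deg y)%N
    (mxsub f g (jet_mx d (gen_mx K k)) x y).
  rewrite !mxE /hasse -/(ib y).
  set a := mnm_of_quad _; set b := mnm_of_quad _.
  case: (boolP [forall j, b j <= a j]%N) => [/forallP ba|]; last first.
    rewrite negb_forall => /existsP[j]; rewrite -ltnNge => ab.
    rewrite (bigD1 j) //= bin_small // mulr0n mul0r; exact: has_multideg0.
  have ad : mdeg a = d.
    rewrite /a; have := mem_tnth (f x) (in_tuple (monomials d)).
    by case: (tnth _ _) => [[[a1 a2] a3] a4]; rewrite mem_monomials mdeg_quad => /eqP.
  move=> m Hm i.
  have -> : deg y = (\sum_j (a j - b j))%N.
    by rewrite /deg -/b -ad !mdegE sumnB.
  rewrite big_distrr /=; move: m Hm i; apply: has_multideg_prod => j.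
  apply: has_multidegMn => m Hm i; rewrite mulnC; move: m Hm i.
  by apply: has_multidegX; apply: has_multideg_gen.
apply: has_multideg_sum => s _.
have hs : has_multideg (fun i => \sum_x (i == (ib x).1) * deg x)%N
    (\prod_x mxsub f g (jet_mx d (gen_mx K k)) x (s x)).
  move=> m /(has_multideg_prod (fun x => ent x (s x))) E i.
  by rewrite E [RHS](reindex_inj (@perm_inj _ s)).
by rewrite mulr_sign; case: ifP => _ //; apply: has_multidegN.
Qed.

Lemma torus_multideg : exists e, has_multideg e (torus_poly K k).
Proof.
exists (fun l => \sum_i \sum_(j < 4) (l == i))%N.
by apply: has_multideg_prod => i; apply: has_multideg_prod => j; apply: has_multideg_gen.
Qed.

Lemma for_general_minor n f g A0 (Q : ('I_k -> proj3 K) -> Prop) :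
  (forall i j, A0 i j != 0) -> minor (n := n) f g A0 != 0 ->
  (forall P V, (forall i, sval (P i) = <[row i V]>%VS) -> (forall i j, V i j != 0) ->
     minor (n := n) f g V != 0 -> Q P) ->
  for_general Q.
Proof.
move=> A0n mA0 H; have [e1 h1] := minor_multideg f g; have [e2 h2] := torus_multideg.
apply: (for_general_intro (A0 := A0) (has_multidegM h1 h2)).
- rewrite /eval_mx rmorphM mulf_neq0 //= -/(eval_mx _ _) ?eval_minor //.
  by rewrite eval_torus; apply/'forall_forallP.
- by move=> i; apply/eqP => /rowP/(_ ord0); rewrite !mxE; apply/eqP.
move=> P V PV; rewrite /eval_mx rmorphM mulf_eq0 negb_or /= -!/(eval_mx _ _) eval_minor.
by rewrite eval_torus => /andP[mV /'forall_forallP Vn]; apply: (H P V).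
Qed.

Lemma row_full_tr (m n : nat) (M : 'M[K]_(m, n)) : row_full M^T = row_free M.
Proof. by rewrite /row_full mxrank_tr. Qed.

(** Good postulation demands both vanishings when the degree of the scheme equals the number of
    monomials, and on one common open set; in that case the same minor gives both. *)
Lemma general_H1_zero A0 : (forall i j, A0 i j != 0) -> row_full (jet_mx d A0) ->
  for_general (fun P : 'I_k -> proj3 K => H1_zero (fat_ideal P) d /\
    (size (conditions ms) = size (monomials d) -> H0_zero (fat_ideal P) d)).
Proof.
move=> A0n Af; apply: (for_general_minor (f := fullrankfun Af) (g := id) A0n).
  by have := fullrowsub_unit Af; rewrite unitmxE unitfE.
move=> P V PV Vn mV.
have Vf : row_full (jet_mx d V).
  rewrite -sub1mx; apply: submx_trans (rowsub_sub (fullrankfun Af) _).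
  by rewrite sub1mx row_full_unit unitmxE unitfE.
have V0 i j : (row i V) 0 j != 0 by rewrite mxE.
split=> [|sz]; first by apply: (H1_zero_of_surj PV V0); apply/jets_surj_row_full.
apply: (H0_zero_of_inj PV V0); apply/jets_inj_row_free.
by move: Vf; rewrite /row_full /row_free => /eqP->; apply/eqP.
Qed.

Lemma general_H0_zero A0 : (forall i j, A0 i j != 0) -> row_free (jet_mx d A0) ->
  for_general (fun P : 'I_k -> proj3 K => H0_zero (fat_ideal P) d).
Proof.
rewrite -row_full_tr => A0n Af.
apply: (for_general_minor (f := id) (g := fullrankfun Af) A0n).
  have := fullrowsub_unit Af; rewrite unitmxE unitfE -det_tr.
  by rewrite trmx_mxsub trmxK.
move=> P V PV Vn mV.
have V0 i j : (row i V) 0 j != 0 by rewrite mxE.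
apply: (H0_zero_of_inj PV V0); apply/jets_inj_row_free.
rewrite -row_full_tr -sub1mx; apply: submx_trans (rowsub_sub (fullrankfun Af) _).
rewrite sub1mx row_full_unit unitmxE unitfE -det_tr.
by rewrite trmx_mxsub trmxK.
Qed.
End GeneralMinor.

(** * Toric degeneration *)

Section Infinite.
Variable K : fieldType.
Hypothesis charK : [pchar K] =i pred0.

Lemma natr_inj_pchar0 : injective (fun n : nat => n%:R : K).
Proof.
move=> m n; wlog mn : m n / (m <= n)%N => [H E|].
  by case: (leqP m n) => [/H->//|/ltnW/H->].
move=> E; have : (n - m)%:R == 0 :> K by rewrite natrB // E subrr.
by rewrite ((pcharf0P K).1 charK) subn_eq0 => nm; apply/eqP; rewrite eqn_leq mn.
Qed.

Lemma exists_nonroot (p : {poly K}) : p != 0 -> exists2 s, s != 0 & ~~ root p s.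
Proof.
move=> p0; pose rs : seq K := [seq n%:R | n <- iota 1 (size p)].
case: (boolP (all (root p) rs)) => [rts|/allPn[s /mapP[n]]].
  have := max_poly_roots p0 rts; rewrite map_inj_uniq ?iota_uniq; last exact: natr_inj_pchar0.
  by rewrite size_map size_iota ltnn => /(_ isT).
rewrite mem_iota => /andP[n0 _] -> ns; exists n%:R => //.
by rewrite ((pcharf0P K).1 charK) -lt0n.
Qed.
End Infinite.

Section Indep.
Variable K : fieldType.

(** Natural numbers as indices spare casts for concatenated lists and shifted positions. *)
Definition indep (r c : nat) (g : nat -> nat -> K) := forall u : nat -> K,
  (forall j, (j < c)%N -> \sum_(i < r) u i * g i j = 0) -> forall i, (i < r)%N -> u i = 0.

Lemma indep_row_free r c g :
  indep r c g <-> row_free (\matrix_(i < r, j < c) g i j).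
Proof.
split=> [gi|gf u uE i ir].
  apply/inj_row_free => v vE; apply/rowP=> i; rewrite mxE.
  have vi (l : 'I_r) : odflt 0 (omap (v 0) (insub (l : nat))) = v 0 l by rewrite valK.
  rewrite -vi; apply: (gi (fun l => odflt 0 (omap (v 0) (insub l)))) => // j jc.
  have := congr1 (fun w : 'rV_c => w 0 (Ordinal jc)) vE; rewrite !mxE => E.
  by rewrite -[RHS]E; apply: eq_bigr => l _; rewrite vi mxE.
have : (\row_(l < r) u l) *m \matrix_(i < r, j < c) g i j == 0.
  apply/eqP/rowP=> j; rewrite !mxE -[RHS](uE j) //.
  by apply: eq_bigr => l _; rewrite !mxE.
by rewrite mulmx_free_eq0 // => /eqP/rowP/(_ (Ordinal ir)); rewrite !mxE.
Qed.

Hypothesis charK : [pchar K] =i pred0.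

(** At s = 0 only the entries with exponent 0 remain. A maximal minor that is non-zero there is a
    non-zero polynomial in s, so it also survives at some non-zero s. *)
Lemma indep_deform r c (e : nat -> nat -> nat) (g : nat -> nat -> K) :
  indep r c (fun i j => (e i j == 0%N)%:R * g i j) ->
  exists2 s, s != 0 & indep r c (fun i j => s ^+ e i j * g i j).
Proof.
move/indep_row_free => M0.
pose M : 'M[{poly K}]_(r, c) := \matrix_(i, j) ('X ^+ e i j * (g i j)%:P).
have ME s : map_mx (horner_eval s) M = \matrix_(i < r, j < c) (s ^+ e i j * g i j).
  by apply/matrixP=> i j; rewrite !mxE /horner_eval hornerM hornerXn hornerC.
have E0 : map_mx (horner_eval 0) M = \matrix_(i < r, j < c) ((e i j == 0%N)%:R * g i j).
  by rewrite ME; apply/matrixP=> i j; rewrite !mxE expr0n.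
move: M0; rewrite -E0 -row_full_tr => M0.
pose f := fullrankfun M0; pose p := \det (colsub f M).
have pE s : p.[s] = \det (colsub f (map_mx (horner_eval s) M)).
  by rewrite -[LHS]/(horner_eval s p) -det_map_mx map_mxsub.
have p0 : p != 0.
  apply: contraTneq (fullrowsub_unit M0) => p0.
  by rewrite unitmxE unitfE -det_tr trmx_mxsub trmxK -pE p0 horner0 eqxx.
have [s s0 ps] := exists_nonroot charK p0.
exists s => //; apply/indep_row_free; rewrite -ME -row_full_tr -sub1mx.
apply: submx_trans (rowsub_sub f _); rewrite sub1mx row_full_unit unitmxE unitfE -det_tr.
by rewrite trmx_mxsub trmxK -pE.
Qed.
End Indep.

Definition qdot (x y : quad) : nat :=
  let: (a, b, c, e) := x in let: (a', b', c', e') := y in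
  (a * a' + b * b' + c * c' + e * e')%N.

Section Systems.
Variable K : fieldType.
Implicit Types (D : seq quad) (F : seq (quad -> K)) (L : seq (nat * 'rV[K]_4)).

Definition functional (p : 'rV[K]_4) (b : quad) : quad -> K :=
  fun a => hasse (mnm_of_quad a) (mnm_of_quad b) (fun l => p 0 l).

Definition functionals L : seq (quad -> K) :=
  [seq functional x.2 b | x <- L, b <- jet_indices x.1].

Local Notation at_ F j := (nth (fun=> 0) F j).

(** Surjectivity of the evaluation map on the span of [D], expressed dually as linear independence
    of the functionals. *)
Definition fsurj D F := forall u : nat -> K,
  (forall a, a \in D -> \sum_(j < size F) u j * at_ F j a = 0) ->
  forall j, (j < size F)%N -> u j = 0.

Definition finj D F := forall c : quad -> K,
  (forall j, (j < size F)%N -> \sum_(a <- D) c a * at_ F j a = 0) ->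
  forall a, a \in D -> c a = 0.

Let q0 : quad := (0, 0, 0, 0)%N.

Lemma fsurj_indep D F :
  fsurj D F <-> indep (size F) (size D) (fun j i => at_ F j (nth q0 D i)).
Proof.
split=> H u uE; apply: H.
  by move=> a aD; rewrite -(nth_index q0 aD); apply: uE; rewrite index_mem.
by move=> i iD; apply: uE; apply: mem_nth.
Qed.

Lemma finj_indep D F : uniq D ->
  finj D F <-> indep (size D) (size F) (fun i j => at_ F j (nth q0 D i)).
Proof.
move=> uD; split=> [H u uE i iD|H c cE a aD].
  rewrite -(index_uniq q0 iD uD); apply: (H (fun a => u (index a D))); last exact: mem_nth.
  move=> j jF; rewrite (big_nth q0) big_mkord -[RHS](uE j jF); apply: eq_bigr => l _.
  by rewrite index_uniq.
rewrite -(nth_index q0 aD); apply: (H (fun i => c (nth q0 D i))); last by rewrite index_mem.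
by move=> j jF; rewrite -[RHS](cE j jF) (big_nth q0) big_mkord.
Qed.

Lemma big_functionals_cat F1 F2 (G : nat -> (quad -> K) -> K) :
  \sum_(j < size (F1 ++ F2)) G j (at_ (F1 ++ F2) j) =
  \sum_(j < size F1) G j (at_ F1 j) + \sum_(j < size F2) G (size F1 + j)%N (at_ F2 j).
Proof.
rewrite size_cat big_split_ord; congr (_ + _); apply: eq_bigr => j _ /=.
  by rewrite nth_cat ltn_ord.
by rewrite nth_cat ltnNge leq_addr /= addKn.
Qed.

Lemma fsurj_cat0 D1 D2 D F1 F2 (H : nat -> quad -> K) :
  (forall a, (a \in D) = (a \in D1) || (a \in D2)) ->
  fsurj D1 F1 -> fsurj D2 F2 ->
  (forall a, a \in D1 -> forall j, (j < size F1 + size F2)%N ->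
     H j a = (j < size F1)%:R * at_ (F1 ++ F2) j a) ->
  (forall a, a \in D2 -> forall j, (j < size F1 + size F2)%N ->
     H j a = (size F1 <= j)%:R * at_ (F1 ++ F2) j a) ->
  forall u : nat -> K,
  (forall a, a \in D -> \sum_(j < size (F1 ++ F2)) u j * H j a = 0) ->
  forall j, (j < size (F1 ++ F2))%N -> u j = 0.
Proof.
move=> DE s1 s2 H1 H2 u uE j; rewrite size_cat => jF.
have u1 : forall j, (j < size F1)%N -> u j = 0.
  apply: s1 => a aD; have := uE a; rewrite DE aD => /(_ isT).
  rewrite size_cat big_split_ord /= [X in _ + X]big1 ?addr0 => [|i _]; last first.
    by rewrite H1 ?ltn_add2l // ltnNge leq_addr mul0r mulr0.
  move=> E; rewrite -[RHS]E; apply: eq_bigr => i _.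
  by rewrite H1 ?ltn_ord ?mul1r ?nth_cat ?ltn_ord // ltn_addr.
have u2 : forall j, (j < size F2)%N -> u (size F1 + j)%N = 0.
  apply: (s2 (fun j => u (size F1 + j)%N)) => a aD; have := uE a; rewrite DE aD orbT => /(_ isT).
  rewrite size_cat big_split_ord /= [X in X + _]big1 ?add0r => [|i _]; last first.
    by rewrite H2 ?ltn_addr // leqNgt ltn_ord mul0r mulr0.
  move=> E; rewrite -[RHS]E; apply: eq_bigr => i _.
  by rewrite H2 ?ltn_add2l // leq_addr mul1r nth_cat ltnNge leq_addr /= addKn.
case: (ltnP j (size F1)) => [/u1//|Fj]; rewrite -(subnKC Fj); apply: u2.
by rewrite -(ltn_add2l (size F1)) subnKC.
Qed.

Lemma finj_cat0 D1 D2 D F1 F2 (H : nat -> quad -> K) :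
  perm_eq D (D1 ++ D2) ->
  finj D1 F1 -> finj D2 F2 ->
  (forall a, a \in D1 -> forall j, (j < size F1 + size F2)%N ->
     H j a = (j < size F1)%:R * at_ (F1 ++ F2) j a) ->
  (forall a, a \in D2 -> forall j, (j < size F1 + size F2)%N ->
     H j a = (size F1 <= j)%:R * at_ (F1 ++ F2) j a) ->
  forall c : quad -> K,
  (forall j, (j < size (F1 ++ F2))%N -> \sum_(a <- D) c a * H j a = 0) ->
  forall a, a \in D -> c a = 0.
Proof.
move=> DE s1 s2 H1 H2 c cE a.
have c1 : forall a, a \in D1 -> c a = 0.
  apply: s1 => j jF; have jF' : (j < size F1 + size F2)%N by rewrite ltn_addr.
  have := cE j; rewrite size_cat => /(_ jF'); rewrite (perm_big _ DE) big_cat /= => E.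
  rewrite -[RHS]E [X in _ = _ + X]big_seq [X in _ = _ + X]big1 ?addr0 => [|b bD]; last first.
    by rewrite H2 // leqNgt jF mul0r mulr0.
  rewrite big_seq [RHS]big_seq; apply: eq_bigr => b bD.
  by rewrite H1 // jF mul1r nth_cat jF.
have c2 : forall a, a \in D2 -> c a = 0.
  apply: s2 => j jF; have jF' : (size F1 + j < size F1 + size F2)%N by rewrite ltn_add2l.
  have := cE (size F1 + j)%N; rewrite size_cat => /(_ jF'); rewrite (perm_big _ DE) big_cat /= => E.
  rewrite -[RHS]E [X in _ = X + _]big_seq [X in _ = X + _]big1 ?add0r => [|b bD]; last first.
    by rewrite H1 // ltnNge leq_addr mul0r mulr0.
  rewrite big_seq [RHS]big_seq; apply: eq_bigr => b bD.
  by rewrite H2 // leq_addr mul1r nth_cat ltnNge leq_addr /= addKn.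
by rewrite (perm_mem DE) mem_cat => /orP[/c1|/c2].
Qed.
End Systems.

Lemma mul_shuffle (R : comNzRingType) (x y z w : R) : x * (y * z * w) = y * (z * x * w).
Proof. ring. Qed.

Section Cut.
Variable K : fieldType.
Hypothesis charK : [pchar K] =i pred0.
Implicit Types (D : seq quad) (L : seq (nat * 'rV[K]_4)).
Local Notation at_ F j := (nth (fun=> 0) F j).

Definition on_torus L := forall x, x \in L -> forall j, x.2 0 j != 0.

(** A one-parameter subgroup with doubled weights: exponents have even weight, so the wall 2c - 1
    lies strictly between the two sides of a cut and [cut_weight] is always positive. *)
Definition scale_pt (t : K) (al : quad) (p : 'rV[K]_4) : 'rV[K]_4 :=
  \row_l (t ^+ (2 * mnm_of_quad al l) * p 0 l).

Definition scale_pts t al L := [seq (x.1, scale_pt t al x.2) | x <- L].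

Lemma qdotE al a : qdot al a = (\sum_l mnm_of_quad al l * mnm_of_quad a l)%N.
Proof.
case: al a => [[[a1 a2] a3] a4] [[[b1 b2] b3] b4].
by rewrite !big_ord_recl big_ord0 !multinomE !(tnth_nth 0%N) /= addn0 !addnA.
Qed.

Lemma functional_scale t al p b a :
  functional (scale_pt t al p) b a * t ^+ (2 * qdot al b) =
  t ^+ (2 * qdot al a) * functional p b a.
Proof.
rewrite !qdotE !big_distrr /= -!prodrXr /functional /hasse -!big_split.
apply: eq_bigr => l _ /=.
case: (leqP (mnm_of_quad b l) (mnm_of_quad a l)) => ba; last first.
  by rewrite bin_small // !mulr0n mul0r mulr0.
rewrite mxE exprMn -exprM mulrnAl mulrnAr; congr (_ *+ _).
rewrite mulrAC -exprD; congr (_ ^+ _ * _).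
by rewrite -!mulnA -!mulnDr subnK.
Qed.

Definition jet_pairs L : seq ((nat * 'rV[K]_4) * quad) :=
  [seq (x, b) | x <- L, b <- jet_indices x.1].

Lemma functionals_pairs L : functionals L = [seq functional y.1.2 y.2 | y <- jet_pairs L].
Proof. by rewrite map_allpairs. Qed.

Lemma jet_pairs_scale t al L :
  jet_pairs (scale_pts t al L) = [seq ((y.1.1, scale_pt t al y.1.2), y.2) | y <- jet_pairs L].
Proof. by rewrite map_allpairs /jet_pairs allpairs_mapl. Qed.

Lemma functionals_cat L1 L2 : functionals (L1 ++ L2) = functionals L1 ++ functionals L2.
Proof. exact: allpairs_cat. Qed.

Lemma size_functionals_scale t al L :
  size (functionals (scale_pts t al L)) = size (functionals L).
Proof. by rewrite !functionals_pairs jet_pairs_scale !size_map. Qed.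

Definition jet_weight al L (j : nat) : nat :=
  let y0 : (nat * 'rV[K]_4) * quad := ((0%N, 0), (0, 0, 0, 0)%N) in
  (2 * qdot al (nth y0 (jet_pairs L) j).2)%N.

Lemma at_functionals_scale t al L j a : (j < size (functionals L))%N ->
  at_ (functionals (scale_pts t al L)) j a * t ^+ jet_weight al L j =
  t ^+ (2 * qdot al a) * at_ (functionals L) j a.
Proof.
rewrite !functionals_pairs jet_pairs_scale size_map -map_comp => jL.
pose y0 : (nat * 'rV[K]_4) * quad := ((0%N, 0), (0, 0, 0, 0)%N).
by rewrite !(nth_map y0) //= functional_scale.
Qed.

Section Weights.
Variables (al : quad) (c n1 : nat).

Definition cut_weight a : nat :=
  if (c <= qdot al a)%N then ((2 * qdot al a).+1 - 2 * c)%N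
  else (2 * c - (2 * qdot al a).+1)%N.

Definition cut_exp j a : nat :=
  if (j < n1)%N == (c <= qdot al a)%N then 0%N else cut_weight a.

Lemma cut_exp0 j a : (cut_exp j a == 0%N) = ((j < n1)%N == (c <= qdot al a)%N).
Proof.
rewrite /cut_exp; case: ifP => // _; apply/negbTE.
by rewrite /cut_weight; case: leqP; lia.
Qed.
End Weights.

(** Put t = 1/s. Moving [L1] multiplies its entries at the exponent a by t^(2 al.a), up to a factor
    of the functional. After rescaling functionals and exponents so that the wall gets weight 0, a
    positive power of s remains exactly on the entries of [L1] below the wall and of [L2] above it;
    at s = 0 these vanish and two diagonal blocks are left. *)
Lemma cut_scaling al c L1 L2 s : s != 0 ->
  exists (q : nat -> K) (r : quad -> K), [/\ forall j, q j != 0, forall a, r a != 0 &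
    forall j a, (j < size (functionals (L1 ++ L2)))%N ->
      at_ (functionals (scale_pts s^-1 al L1 ++ L2)) j a =
      q j * r a * (s ^+ cut_exp al c (size (functionals L1)) j a
                   * at_ (functionals (L1 ++ L2)) j a)].
Proof.
move=> s0; set n1 := size (functionals L1); pose t := s^-1; have t0 : t != 0 by rewrite invr_eq0.
pose b := jet_weight al L1.
exists (fun j => if (j < n1)%N then t ^+ (2 * c) * s * s ^+ b j else 1),
  (fun a => if (c <= qdot al a)%N then t ^+ cut_weight al c a else 1); split.
- by move=> j; case: ifP; rewrite ?oner_neq0 ?mulf_neq0 ?expf_neq0.
- by move=> a; case: ifP; rewrite ?oner_neq0 ?expf_neq0.
move=> j a; rewrite !functionals_cat size_cat !nth_cat size_functionals_scale -/n1 => jF.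
rewrite /cut_exp; case: (ltnP j n1) => jn.
  apply: (mulIf (expf_neq0 (b j) t0)); rewrite at_functionals_scale // /cut_weight.
  have st k : s ^+ k * t ^+ k = 1 by rewrite -exprMn mulfV ?expr1n.
  case: (leqP c (qdot al a)) => ca /=.
    rewrite expr0 mul1r; set x := at_ _ j a.
    have -> : t ^+ (2 * c) * s * s ^+ b j * t ^+ ((2 * qdot al a).+1 - 2 * c) * x * t ^+ b j
      = (t ^+ (2 * c) * t ^+ ((2 * qdot al a).+1 - 2 * c)) * s * (s ^+ b j * t ^+ b j) * x by ring.
    rewrite -exprD subnKC; last by lia.
    by rewrite exprSr -(mulrA _ t) (mulrC t) mulfV // mulr1 st mulr1.
  rewrite mulr1; set x := at_ _ j a.
  have -> : t ^+ (2 * c) * s * s ^+ b j * (s ^+ (2 * c - (2 * qdot al a).+1) * x) * t ^+ b j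
    = t ^+ (2 * c) * (s ^+ 1 * s ^+ (2 * c - (2 * qdot al a).+1)) * (s ^+ b j * t ^+ b j) * x.
    by rewrite expr1; ring.
  rewrite st mulr1 -exprD.
  have -> : (1 + (2 * c - (2 * qdot al a).+1) = 2 * c - 2 * qdot al a)%N by lia.
  have -> : t ^+ (2 * c) = t ^+ (2 * qdot al a) * t ^+ (2 * c - 2 * qdot al a).
    by rewrite -exprD; congr (_ ^+ _); lia.
  by rewrite -(mulrA (t ^+ _)) (mulrC (t ^+ (2 * c - _))) st mulr1.
rewrite mul1r /cut_weight; case: (leqP c (qdot al a)) => ca /=; last by rewrite !mul1r.
by rewrite mulrA -exprMn mulVf // expr1n mul1r.
Qed.

Lemma fsurj_cut al c D L1 L2 :
  fsurj [seq a <- D | c <= qdot al a]%N (functionals L1) ->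
  fsurj [seq a <- D | ~~ (c <= qdot al a)]%N (functionals L2) ->
  exists2 s, s != 0 & fsurj D (functionals (scale_pts s al L1 ++ L2)).
Proof.
move=> s1 s2; set n1 := size (functionals L1).
pose H j a := (cut_exp al c n1 j a == 0%N)%:R * at_ (functionals (L1 ++ L2)) j a.
have : indep (size (functionals (L1 ++ L2))) (size D)
    (fun j i => H j (nth (0,0,0,0)%N D i)).
  move=> u uE; rewrite functionals_cat.
  apply: (fsurj_cat0 (D := D) (H := H) _ s1 s2).
  - by move=> a; rewrite !mem_filter; case: (_ <= _)%N => /=; rewrite ?orbF.
  - by move=> a; rewrite mem_filter => /andP[ca _] j _; rewrite /H cut_exp0 ca eqb_id functionals_cat.
  - move=> a; rewrite mem_filter => /andP[/negPf ca _] j _.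
    by rewrite /H cut_exp0 ca eqbF_neg -leqNgt functionals_cat.
  move=> a aD; rewrite -functionals_cat -(nth_index (0,0,0,0)%N aD).
  by apply: uE; rewrite index_mem.
case/(indep_deform charK) => s s0 ind; exists s^-1; first by rewrite invr_eq0.
have [q [r [q0 r0 E]]] := cut_scaling al c L1 L2 s0.
have sz : size (functionals (scale_pts s^-1 al L1 ++ L2)) = size (functionals (L1 ++ L2)).
  by rewrite !functionals_cat !size_cat size_functionals_scale.
move=> u; rewrite sz => uE j jF.
have : u j * q j = 0.
  apply: (ind (fun j => u j * q j)) jF => i iD; set a := nth _ D i.
  apply: (mulfI (r0 a)); rewrite mulr0 -[RHS](uE a) ?mem_nth // mulr_sumr.
  by apply: eq_bigr => l _; rewrite E //; apply: mul_shuffle.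
by move/eqP; rewrite mulf_eq0 (negPf (q0 j)) orbF => /eqP.
Qed.

Lemma finj_cut al c D L1 L2 : uniq D ->
  finj [seq a <- D | c <= qdot al a]%N (functionals L1) ->
  finj [seq a <- D | ~~ (c <= qdot al a)]%N (functionals L2) ->
  exists2 s, s != 0 & finj D (functionals (scale_pts s al L1 ++ L2)).
Proof.
move=> uD s1 s2; set n1 := size (functionals L1).
pose H j a := (cut_exp al c n1 j a == 0%N)%:R * at_ (functionals (L1 ++ L2)) j a.
have : indep (size D) (size (functionals (L1 ++ L2)))
    (fun i j => H j (nth (0,0,0,0)%N D i)).
  move=> u uE i iD; rewrite -(index_uniq (0,0,0,0)%N iD uD).
  apply: (finj_cat0 (D := D) (H := H) _ s1 s2 _ _ (c := fun a => u (index a D))) (mem_nth _ iD).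
  - by rewrite perm_sym perm_filterC.
  - by move=> a; rewrite mem_filter => /andP[ca _] j _; rewrite /H cut_exp0 ca eqb_id functionals_cat.
  - move=> a; rewrite mem_filter => /andP[/negPf ca _] j _.
    by rewrite /H cut_exp0 ca eqbF_neg -leqNgt functionals_cat.
  move=> j; rewrite -functionals_cat => jF.
  rewrite (big_nth (0,0,0,0)%N) big_mkord -[RHS](uE j jF); apply: eq_bigr => l _.
  by rewrite index_uniq.
case/(indep_deform charK) => s s0 ind; exists s^-1; first by rewrite invr_eq0.
have [q [r [q0 r0 E]]] := cut_scaling al c L1 L2 s0.
have sz : size (functionals (scale_pts s^-1 al L1 ++ L2)) = size (functionals (L1 ++ L2)).
  by rewrite !functionals_cat !size_cat size_functionals_scale.
move=> c'; rewrite sz => cE a aD.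
have : c' a * r a = 0.
  rewrite -(nth_index (0,0,0,0)%N aD).
  apply: (ind (fun i => c' (nth _ D i) * r (nth _ D i))); last by rewrite index_mem.
  move=> j jF; apply: (mulfI (q0 j)); rewrite mulr0 -[RHS](cE j) //.
  rewrite mulr_sumr [RHS](big_nth (0,0,0,0)%N) big_mkord.
  by apply: eq_bigr => l _; rewrite E // mul_shuffle (mulrC (r _)).
by move/eqP; rewrite mulf_eq0 (negPf (r0 a)) orbF => /eqP.
Qed.
End Cut.

(** * Cells with one point *)

Section Staircase.
Variable K : fieldType.
Hypothesis charK : [pchar K] =i pred0.
Variable d : nat.
Implicit Types (D : seq quad) (c : quad -> K).
Local Notation at_ F j := (nth (fun=> 0) F j).

Let one : 'rV[K]_4 := const_mx 1.

(* Up to invertible combinations, functional one b runs over the values at the exponent a of the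
   polynomials in a of degree < m. *)
Definition kills D m c := forall b, b \in jet_indices m ->
  \sum_(a <- D) c a * functional one b a = 0.

Definition staircase D m := forall c, kills D m c -> forall a, a \in D -> c a = 0.

Definition qcoord (l : 'I_4) (a : quad) : nat := mnm_of_quad a l.

Lemma functional_one b a : functional one b a =
  \prod_l ('C(mnm_of_quad a l, mnm_of_quad b l))%:R.
Proof. by apply: eq_bigr => l _; rewrite mxE expr1n. Qed.

Definition qincr (l : 'I_4) (b : quad) : quad :=
  let: (b0, b1, b2, b3) := b in
  ((l == 0%N :> nat) + b0, (l == 1%N :> nat) + b1, (l == 2%N :> nat) + b2,
   (l == 3%N :> nat) + b3)%N.

Lemma mnm_qincr l b i : mnm_of_quad (qincr l b) i = ((i == l) + mnm_of_quad b i)%N.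
Proof.
case: b => [[[b0 b1] b2] b3]; rewrite /= !multinomE !(tnth_nth 0%N) /=.
by case: i l => [[|[|[|[|//]]]] Hi] [[|[|[|[|//]]]] Hl].
Qed.

Lemma jet_indices_incr m l b : l != ord0 -> b \in jet_indices m ->
  qincr l b \in jet_indices m.+1.
Proof.
case: b => [[[b0 b1] b2] b3]; rewrite /= !mem_jet_indices => l0 /andP[/eqP-> H].
have -> : (l == 0%N :> nat) = false by apply/negbTE.
by case: l l0 => [[|[|[|[|//]]]] Hl] //= _; lia.
Qed.

Lemma jet_indicesS m b : b \in jet_indices m -> b \in jet_indices m.+1.
Proof.
case: b => [[[b0 b1] b2] b3]; rewrite !mem_jet_indices => /andP[-> H] /=; exact: ltnW.
Qed.

(** The identity x C(x,y) = (y+1) C(x,y+1) + y C(x,y): multiplying by a coordinate of the exponent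
    raises the order of a functional by at most one. *)
Lemma mulr_coord l b a : (qcoord l a)%:R * functional one b a =
  (mnm_of_quad b l).+1%:R * functional one (qincr l b) a
  + (mnm_of_quad b l)%:R * functional one b a.
Proof.
rewrite !functional_one (bigD1 l) //= [in RHS](bigD1 l) //=.
rewrite mnm_qincr eqxx add1n /qcoord.
set x := mnm_of_quad a l; set y := mnm_of_quad b l; set p := \prod_(i < 4 | i != l) _.
have -> : \prod_(i < 4 | i != l) ('C(mnm_of_quad a i, mnm_of_quad (qincr l b) i))%:R = p.
  by apply: eq_bigr => i il; rewrite mnm_qincr (negPf il).
rewrite !mulrA -!natrM -mulrDl -natrD; congr (_%:R * _).
case: (leqP y x) => yx; last by rewrite !bin_small ?muln0 // ltnW.
by rewrite mul_bin_left -mulnDl subnK.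
Qed.

(** For X_1, X_2, X_3 this is [mulr_coord]. The functionals never differentiate by X_0, but in
    degree d the exponent of X_0 is d minus the other three. *)
Lemma kills_coord D m l c : (forall a, a \in D -> a \in monomials d) ->
  kills D m.+1 c -> kills D m (fun a => (qcoord l a)%:R * c a).
Proof.
move=> Dd.
have H l' : l' != ord0 -> kills D m.+1 c -> kills D m (fun a => (qcoord l' a)%:R * c a).
  move=> l0 kc b bm; rewrite (eq_bigr (fun a => (mnm_of_quad b l').+1%:R * (c a * functional one (qincr l' b) a)
     + (mnm_of_quad b l')%:R * (c a * functional one b a))); last first.
    by move=> a _; rewrite -mulrA mulrCA mulr_coord mulrDr !(mulrCA (c a)).
  rewrite big_split /= -!mulr_sumr !kc ?mulr0 ?addr0 //.
    exact: jet_indicesS.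
  exact: jet_indices_incr.
case: (eqVneq l ord0) => [->|l0]; last exact: H.
move=> kc b bm; pose S := [:: inord 1; inord 2; inord 3] : seq 'I_4.
have E a : a \in D -> (qcoord ord0 a)%:R = d%:R - \sum_(l' <- S) (qcoord l' a)%:R :> K.
  move=> /Dd; case: a => [[[a0 a1] a2] a3]; rewrite mem_monomials => /eqP <-.
  rewrite /S !big_cons big_nil /qcoord !multinomE !(tnth_nth 0%N) /= !inordK //= !natrD.
  by ring.
rewrite big_seq (eq_bigr (fun a => d%:R * (c a * functional one b a) -
  \sum_(l' <- S) (qcoord l' a)%:R * c a * functional one b a)); last first.
  by move=> a aD; rewrite E // mulrBl mulrBl mulrA -mulr_suml -mulr_suml.
rewrite -big_seq sumrB -mulr_sumr kc ?mulr0 ?sub0r; last exact: jet_indicesS.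
rewrite exchange_big /= big_seq big1 ?oppr0 // => l' lS.
apply: H => //; move: lS; rewrite !inE => /or3P[] /eqP->; by rewrite -val_eqE /= inordK.
Qed.

Lemma kills_dot D m l t c : (forall a, a \in D -> a \in monomials d) ->
  kills D m.+1 c -> kills D m (fun a => ((qdot l a)%:R - t) * c a).
Proof.
move=> Dd kc b bm.
rewrite (eq_bigr (fun a => \sum_i (mnm_of_quad l i)%:R * ((qcoord i a)%:R * c a * functional one b a)
   - t * (c a * functional one b a))); last first.
  move=> a _; rewrite qdotE natr_sum !mulrBl mulrA; congr (_ - _).
  by rewrite !mulr_suml; apply: eq_bigr => i _; rewrite natrM !mulrA.
rewrite sumrB -mulr_sumr kc ?mulr0 ?subr0; last exact: jet_indicesS.
rewrite exchange_big big1 // => i _; rewrite -mulr_sumr.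
by rewrite (kills_coord i Dd kc) ?mulr0.
Qed.

Lemma staircase_nil m : staircase [::] m. Proof. by []. Qed.

Lemma staircase1 a m : staircase [:: a] m.+1.
Proof.
move=> c kc a'; rewrite inE => /eqP->; have := kc (0,0,0,0)%N.
rewrite mem_jet_indices /= => /(_ isT); rewrite big_seq1 functional_one big1 ?mulr1 // => l _.
by rewrite multinomE (tnth_nth 0%N) /=; case: l => [[|[|[|[|//]]]] Hl] /=; rewrite bin0.
Qed.

(** Multiply a relation by the affine function l.a - t. The product is zero on the slice and still
    killed to order m, so it vanishes off the slice; there l.a - t is non-zero in characteristic 0.
    Hence the relation lives on the slice, where the first hypothesis applies. *)
Lemma staircase_slice D m l t : (forall a, a \in D -> a \in monomials d) ->
  staircase [seq a <- D | qdot l a == t] m.+1 ->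
  staircase [seq a <- D | qdot l a != t] m -> staircase D m.+1.
Proof.
move=> Dd s1 s2 c kc.
have c2 a : a \in D -> qdot l a != t -> c a = 0.
  move=> aD at_; have : (((qdot l a)%:R - t%:R) * c a : K) = 0.
    apply: (s2 (fun a => ((qdot l a)%:R - t%:R) * c a)); last by rewrite mem_filter at_.
    move=> b bm; have := kills_dot l t%:R Dd kc bm; rewrite big_filter => E.
    rewrite -[RHS]E [RHS](bigID (fun a => qdot l a == t)) /= [X in _ = X + _]big1 ?add0r //.
    by move=> a' /eqP->; rewrite subrr !mul0r.
  move/eqP; rewrite mulf_eq0 subr_eq0 => /orP[/eqP/(natr_inj_pchar0 charK) E|/eqP//].
  by rewrite E eqxx in at_.
move=> a aD; case: (boolP (qdot l a == t)) => [al|]; last exact: c2.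
apply: s1; last by rewrite mem_filter al.
move=> b bm; rewrite big_filter -[RHS](kc b bm) [RHS](bigID (fun a => qdot l a == t)) /=.
rewrite [X in _ = _ + X]big_seq_cond [X in _ = _ + X]big1 ?addr0 //.
by move=> a' /andP[a'D a't]; rewrite c2 // mul0r.
Qed.

(* The most frequent value of l on D is sliced off first. *)
Definition best_value l D : nat :=
  let vs := [seq qdot l a | a <- D] in
  foldr (fun v w => if (count_mem w vs < count_mem v vs)%N then v else w) 0%N vs.

(** One list of candidate directions per dimension: planes, lines in a plane, points on a line.
    Successive slices are tested with orders m, m - 1, ..., and the test fails if the orders run out
    before the exponents. *)
Fixpoint stairs (ls : seq (seq quad)) D m {struct ls} : bool :=
  match ls with
  | [::] => if D is a :: D' then (D' == [::]) && (0 < m)%N else true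
  | dirs :: ls' => has (fun l =>
      (fix slices m' D' := if D' is [::] then true else
        if m' is m''.+1 then
          let t := best_value l D' in
          stairs ls' [seq a <- D' | qdot l a == t] m'
          && slices m'' [seq a <- D' | qdot l a != t]
        else false) m D) dirs
  end.

Lemma stairsP ls D m : (forall a, a \in D -> a \in monomials d) ->
  stairs ls D m -> staircase D m.
Proof.
elim: ls D m => [|dirs ls IHls] D m Dd /=.
  case: D Dd => [|a [|a' D]] Dd //; case: m => // m _; exact: staircase1.
case/hasP => l _; elim: m D Dd => [|m IHm] [|a D] Dd //;
  try (by move=> _; apply: staircase_nil).
move=> /andP[s1 s2]; apply: (staircase_slice (l := l) Dd).
  apply: IHls s1 => b; rewrite mem_filter => /andP[_]; exact: Dd.
by apply: IHm s2 => b; rewrite mem_filter => /andP[_]; exact: Dd.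
Qed.

Lemma finj_stairs D m : staircase D m -> finj D (functionals [:: (m, one)]).
Proof.
move=> sD c cE; apply: sD => b bm.
have fE : functionals [:: (m, one)] = [seq functional one b | b <- jet_indices m].
  by rewrite functionals_pairs /jet_pairs /= cats0 -map_comp.
have := cE (index b (jet_indices m)); rewrite fE size_map index_mem => /(_ bm) E.
rewrite -[RHS]E; apply: eq_bigr => a _.
by rewrite (nth_map (0,0,0,0)%N) ?index_mem // nth_index.
Qed.

Lemma fsurj_of_finj D (F : seq (quad -> K)) :
  uniq D -> size F = size D -> finj D F -> fsurj D F.
Proof.
move=> uD sz /(finj_indep _ uD); rewrite sz => /indep_row_free; set M := \matrix_(i, j) _.
rewrite row_free_unit -unitmx_tr -row_free_unit => Hf.
apply/fsurj_indep; rewrite sz; apply/indep_row_free.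
by congr (is_true (row_free _)): Hf; apply/matrixP => i j; rewrite !mxE.
Qed.
End Staircase.

(** * Certificates *)

(* Numbers of points of multiplicity 5, 4, 3, 2, 1. *)
Definition quint := (nat * nat * nat * nat * nat)%type.

Definition quint_add (s t : quint) : quint :=
  let: (a, b, c, e, f) := s in let: (a', b', c', e', f') := t in
  (a + a', b + b', c + c', e + e', f + f')%N.

Definition quint_unit (m : nat) : quint :=
  (m == 5 : nat, m == 4 : nat, m == 3 : nat, m == 2 : nat, m == 1 : nat)%N.

Definition quint_count (t : quint) (p : pred nat) : nat :=
  let: (a, b, c, e, f) := t in (a * p 5 + b * p 4 + c * p 3 + e * p 2 + f * p 1)%N.

Definition quint_mults (t : quint) : seq nat :=
  let: (a, b, c, e, f) := t in nseq a 5 ++ nseq b 4 ++ nseq c 3 ++ nseq e 2 ++ nseq f 1.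

Lemma count_quint_mults t p : count p (quint_mults t) = quint_count t p.
Proof.
case: t => [[[[a b] c] e] f]; rewrite /quint_mults !count_cat !count_nseq /=.
by rewrite !addnA !(mulnC (p _)).
Qed.

Lemma quint_countD s t p : quint_count (quint_add s t) p = (quint_count s p + quint_count t p)%N.
Proof.
by case: s t => [[[[a b] c] e] f] [[[[a' b'] c'] e'] f'] /=; rewrite !mulnDl; lia.
Qed.

Lemma quint_count_unit m p : (0 < m <= 5)%N -> quint_count (quint_unit m) p = p m.
Proof.
case: m => [|[|[|[|[|[|]]]]]] // _;
  by rewrite /quint_count /quint_unit /= ?mul0n ?mul1n ?addn0 ?add0n.
Qed.

(* Alternative ways to handle a set of exponents: leave it unused, put one point of
   multiplicity m on it, or cut it by the hyperplane al.a = c. *)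
Inductive cert :=
  | NoMore
  | Unused of cert
  | Cell of nat & seq (seq quad) & cert
  | Cut of quad & nat & cert & cert & cert.

Definition quint_sums (s t : seq quint) := [seq quint_add x y | x <- s, y <- t].

Fixpoint surj_results (D : seq quad) (w : cert) : seq quint :=
  match w with
  | NoMore => [::]
  | Unused w' => (0, 0, 0, 0, 0)%N :: surj_results D w'
  | Cell m ls w' =>
    if [&& (0 < m <= 5)%N, size D == size (jet_indices m) & stairs ls D m]
    then quint_unit m :: surj_results D w' else surj_results D w'
  | Cut al c w1 w2 w' =>
    quint_sums (surj_results [seq a <- D | c <= qdot al a]%N w1)
      (surj_results [seq a <- D | ~~ (c <= qdot al a)]%N w2) ++ surj_results D w'
  end.

Fixpoint inj_results (D : seq quad) (w : cert) : seq quint :=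
  match w with
  | NoMore => [::]
  | Unused w' => inj_results D w'
  | Cell m ls w' =>
    if (0 < m <= 5)%N && stairs ls D m
    then quint_unit m :: inj_results D w' else inj_results D w'
  | Cut al c w1 w2 w' =>
    quint_sums (inj_results [seq a <- D | c <= qdot al a]%N w1)
      (inj_results [seq a <- D | ~~ (c <= qdot al a)]%N w2) ++ inj_results D w'
  end.

Section Results.
Variable K : fieldType.
Hypothesis charK : [pchar K] =i pred0.
Variable d : nat.
Implicit Types (D : seq quad) (L : seq (nat * 'rV[K]_4)) (t : quint).

Definition has_counts L t := forall p : pred nat, count p [seq x.1 | x <- L] = quint_count t p.

Definition surj_at D t := exists L, [/\ has_counts L t, on_torus L & fsurj D (functionals L)].
Definition inj_at D t := exists L, [/\ has_counts L t, on_torus L & finj D (functionals L)].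

Lemma on_torus_scale s al L : s != 0 -> on_torus L -> on_torus (scale_pts s al L).
Proof.
move=> s0 tL x /mapP[y yL ->] j; rewrite mxE mulf_neq0 ?expf_neq0 //.
exact: tL.
Qed.

Lemma on_torus_cat L1 L2 : on_torus L1 -> on_torus L2 -> on_torus (L1 ++ L2).
Proof. by move=> t1 t2 x; rewrite mem_cat => /orP[/t1|/t2]. Qed.

Lemma has_counts_cat L1 L2 t1 t2 :
  has_counts L1 t1 -> has_counts L2 t2 -> has_counts (L1 ++ L2) (quint_add t1 t2).
Proof. by move=> h1 h2 p; rewrite map_cat count_cat h1 h2 quint_countD. Qed.

Lemma has_counts_scale s al L t : has_counts L t -> has_counts (scale_pts s al L) t.
Proof. by move=> hL p; rewrite -map_comp -hL. Qed.

Lemma has_counts1 m p : (0 < m <= 5)%N -> has_counts [:: (m, p)] (quint_unit m).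
Proof. by move=> m5 q; rewrite quint_count_unit //= addn0. Qed.

Lemma on_torus1 m : on_torus [:: (m, const_mx 1 : 'rV[K]_4)].
Proof. by move=> x; rewrite inE => /eqP-> j; rewrite mxE oner_neq0. Qed.

Lemma surj_resultsP w D t : uniq D -> {subset D <= monomials d} ->
  t \in surj_results D w -> surj_at D t.
Proof.
elim: w D t => [|w IHw|m ls w IHw|al c w1 IHw1 w2 IHw2 w IHw] D t uD Dd //=.
- rewrite inE => /orP[/eqP->|]; last exact: IHw.
  by exists [::]; split=> [p|x|u _ j].
- case: ifP => [/and3P[m5 /eqP sz st]|_]; last exact: IHw.
  rewrite inE => /orP[/eqP->|]; last exact: IHw.
  exists [:: (m, const_mx 1)]; split; [exact: has_counts1|exact: on_torus1|].
  apply: fsurj_of_finj => //; last by apply: finj_stairs; apply: (stairsP charK Dd st).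
  by rewrite functionals_pairs size_map /jet_pairs /= cats0 size_map.
rewrite mem_cat => /orP[|]; last exact: IHw.
case/allpairsP => [[t1 t2] /= [H1 H2 ->]].
have [|a|L1 [c1 o1 s1]] := IHw1 _ _ _ _ H1; first exact: filter_uniq.
  by rewrite mem_filter => /andP[_ /Dd].
have [|a|L2 [c2 o2 s2]] := IHw2 _ _ _ _ H2; first exact: filter_uniq.
  by rewrite mem_filter => /andP[_ /Dd].
have [s s0 ss] := fsurj_cut charK s1 s2.
exists (scale_pts s al L1 ++ L2); split=> //.
  by apply: has_counts_cat => //; apply: has_counts_scale.
by apply: on_torus_cat => //; apply: on_torus_scale.
Qed.

Lemma inj_resultsP w D t : uniq D -> {subset D <= monomials d} ->
  t \in inj_results D w -> inj_at D t.
Proof.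
elim: w D t => [|w IHw|m ls w IHw|al c w1 IHw1 w2 IHw2 w IHw] D t uD Dd //=.
- exact: IHw.
- case: ifP => [/andP[m5 st]|_]; last exact: IHw.
  rewrite inE => /orP[/eqP->|]; last exact: IHw.
  exists [:: (m, const_mx 1)]; split; [exact: has_counts1|exact: on_torus1|].
  by apply: finj_stairs; apply: (stairsP charK Dd st).
rewrite mem_cat => /orP[|]; last exact: IHw.
case/allpairsP => [[t1 t2] /= [H1 H2 ->]].
have [|a|L1 [c1 o1 s1]] := IHw1 _ _ _ _ H1; first exact: filter_uniq.
  by rewrite mem_filter => /andP[_ /Dd].
have [|a|L2 [c2 o2 s2]] := IHw2 _ _ _ _ H2; first exact: filter_uniq.
  by rewrite mem_filter => /andP[_ /Dd].
have [s s0 ss] := finj_cut charK uD s1 s2.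
exists (scale_pts s al L1 ++ L2); split=> //.
  by apply: has_counts_cat => //; apply: has_counts_scale.
by apply: on_torus_cat => //; apply: on_torus_scale.
Qed.

Lemma finj_sub D L L' : {subset L <= L'} ->
  finj D (functionals L) -> finj D (functionals L').
Proof.
move=> LL' iD c cE; apply: iD => j; rewrite !functionals_pairs size_map => jL.
pose y0 : (nat * 'rV[K]_4) * quad := ((0%N, 0), (0, 0, 0, 0)%N).
rewrite (nth_map y0) //; set y := nth y0 _ j.
have yL' : y \in jet_pairs L'.
  have /allpairsPdep[x [b [xL bx ->]]] : y \in jet_pairs L by apply: mem_nth.
  by apply/allpairsPdep; exists x, b; rewrite LL'.
have := cE (index y (jet_pairs L')); rewrite functionals_pairs size_map index_mem => /(_ yL').
by rewrite (nth_map y0) ?index_mem // nth_index.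
Qed.

Lemma fsurj_perm_map (T : eqType) (f : T -> quad -> K) D (s t : seq T) : perm_eq s t ->
  fsurj D [seq f y | y <- s] -> fsurj D [seq f y | y <- t].
Proof.
case: t => [|y0 t0]; first by move=> /perm_nilP->.
set t := y0 :: t0 => /(perm_iotaP y0)[Is pIs sE] fs u uE.
have szIs : size Is = size t by rewrite (perm_size pIs) size_iota.
have szs : size s = size t by rewrite sE size_map.
have nthIs j : (j < size t)%N -> (nth 0 Is j < size t)%N.
  move=> jt; have : nth 0%N Is j \in iota 0 (size t).
    by rewrite -(perm_mem pIs) mem_nth // szIs.
  by rewrite mem_iota.
have v0 : forall j, (j < size s)%N -> u (nth 0%N Is j) = 0.
  move=> j js; apply: (fs (fun j => u (nth 0%N Is j))); last by rewrite size_map.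
  move=> a aD; rewrite -[RHS](uE a aD) !size_map szs.
  transitivity (\sum_(i <- Is) u i * f (nth y0 t i) a).
    rewrite (big_nth 0%N) big_mkord szIs; apply: eq_bigr => l _; congr (_ * _).
    by rewrite (nth_map y0) ?szs // sE (nth_map 0%N) // szIs.
  rewrite (perm_big _ pIs) (_ : iota 0 (size t) = index_iota 0 (size t)); last first.
    by rewrite /index_iota subn0.
  rewrite big_mkord.
  by apply: eq_bigr => l _; rewrite (nth_map y0).
move=> i; rewrite size_map => it.
have iIs : i \in Is by rewrite (perm_mem pIs) mem_iota.
by rewrite -(nth_index 0%N iIs) v0 // szs -szIs index_mem.
Qed.

Lemma perm_map_inv (T : eqType) (s : seq (nat * T)) (ms : seq nat) :
  perm_eq [seq x.1 | x <- s] ms -> exists2 s', perm_eq s s' & [seq x.1 | x <- s'] = ms.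
Proof.
case: s => [|x0 s0]; first by rewrite perm_sym => /perm_nilP->; exists [::].
set s := x0 :: s0; rewrite perm_sym => /(perm_iotaP x0.1)[Is pIs msE].
rewrite size_map in pIs; exists [seq nth x0 s i | i <- Is].
  rewrite perm_sym -{2}[s](mkseq_nth x0); exact: perm_map.
rewrite msE -map_comp; apply/eq_in_map => i iI.
have is_ : (i < size s)%N by move: iI; rewrite (perm_mem pIs) mem_iota.
exact: (esym (nth_map x0 x0.1 (fun x => x.1) is_)).
Qed.

Definition surj_mults (ms : seq nat) :=
  exists2 A : 'M[K]_(size ms, 4), (forall i j, A i j != 0) & row_full (jet_mx d A).
Definition inj_mults (ms : seq nat) :=
  exists2 A : 'M[K]_(size ms, 4), (forall i j, A i j != 0) & row_free (jet_mx d A).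

Definition points_mx L (ms : seq nat) : 'M[K]_(size ms, 4) :=
  \matrix_i (nth (0%N, 0) L i).2.

Lemma functionals_mx L ms : [seq x.1 | x <- L] = ms ->
  functionals L = [seq functional (row ib.1 (points_mx L ms)) ib.2 | ib <- conditions ms].
Proof.
move=> <-; set ms' := [seq x.1 | x <- L].
have LE : L = [seq (nth 0%N ms' (i : 'I_(size ms')), row i (points_mx L ms')) | i <- enum 'I_(size ms')].
  apply: (@eq_from_nth _ (0%N, 0)); first by rewrite size_map size_enum_ord size_map.
  move=> i iL; have im : (i < size ms')%N by rewrite size_map.
  rewrite (nth_map (Ordinal im)) ?size_enum_ord // rowK nth_enum_ord //.
  by rewrite (nth_map (0%N, 0)) //; case: (nth _ L i).
by rewrite {1}LE /functionals /conditions map_allpairs allpairs_mapl.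
Qed.

Lemma jet_mx_at L ms r c : [seq x.1 | x <- L] = ms ->
  jet_mx d (points_mx L ms) r c =
  nth (fun=> 0) (functionals L) c (nth (0,0,0,0)%N (monomials d) r).
Proof.
move=> Lm; rewrite (functionals_mx Lm) mxE.
have c0 : 'I_(size ms) * quad := tnth (in_tuple (conditions ms)) c.
rewrite (nth_map c0) // !(tnth_nth c0) (tnth_nth (0,0,0,0)%N) /functional.
by apply: eq_bigr => l _; rewrite !mxE.
Qed.

Lemma size_functionals L ms : [seq x.1 | x <- L] = ms -> size (functionals L) = size (conditions ms).
Proof. by move/functionals_mx->; rewrite size_map. Qed.

Lemma on_torus_mx L ms : [seq x.1 | x <- L] = ms -> on_torus L ->
  forall i j, points_mx L ms i j != 0.
Proof.
move=> Lm oL i j; rewrite mxE; apply: oL; apply: mem_nth.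
by rewrite -(size_map fst L) Lm.
Qed.

Lemma fsurj_mults L ms : perm_eq [seq x.1 | x <- L] ms -> on_torus L ->
  fsurj (monomials d) (functionals L) -> surj_mults ms.
Proof.
move=> /perm_map_inv[L' pL Lm] oL sL.
have oL' : on_torus L' by move=> x; rewrite -(perm_mem pL); apply: oL.
exists (points_mx L' ms); first exact: on_torus_mx Lm oL'.
have sL' : fsurj (monomials d) (functionals L').
  move: sL; rewrite !functionals_pairs; apply: fsurj_perm_map.
  exact: perm_allpairs_dep.
rewrite -[jet_mx _ _]trmxK row_full_tr; apply/inj_row_free => v vE.
apply/rowP=> i; rewrite mxE.
have vi (l : 'I_(size (conditions ms))) : odflt 0 (omap (v 0) (insub (l : nat))) = v 0 l by rewrite valK.
rewrite -vi; apply: (sL' (fun l => odflt 0 (omap (v 0) (insub l)))); last by rewrite (size_functionals Lm).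
move=> a /(nthP (0,0,0,0)%N)[r rd <-].
have := congr1 (fun w : 'rV_(size (monomials d)) => w 0 (Ordinal rd)) vE; rewrite !mxE => E.
rewrite -[RHS]E (size_functionals Lm); apply: eq_bigr => l _.
by rewrite vi [in RHS]mxE (jet_mx_at _ _ Lm).
Qed.

Lemma finj_mults L ms : perm_eq [seq x.1 | x <- L] ms -> on_torus L ->
  finj (monomials d) (functionals L) -> inj_mults ms.
Proof.
move=> /perm_map_inv[L' pL Lm] oL iL.
have oL' : on_torus L' by move=> x; rewrite -(perm_mem pL); apply: oL.
exists (points_mx L' ms); first exact: on_torus_mx Lm oL'.
have iL' : finj (monomials d) (functionals L').
  by apply: finj_sub iL => x; rewrite (perm_mem pL).
move: iL' => /(finj_indep _ (uniq_monomials d)) iL'.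
apply/inj_row_free => v vE; apply/rowP=> i; rewrite mxE.
have vi (l : 'I_(size (monomials d))) : odflt 0 (omap (v 0) (insub (l : nat))) = v 0 l by rewrite valK.
rewrite -vi; apply: (iL' (fun l => odflt 0 (omap (v 0) (insub l)))) => // j.
rewrite (size_functionals Lm) => jc.
have := congr1 (fun w : 'rV_(size (conditions ms)) => w 0 (Ordinal jc)) vE; rewrite !mxE => E.
by rewrite -[RHS]E; apply: eq_bigr => l _; rewrite vi (jet_mx_at _ _ Lm).
Qed.
Lemma has_counts_perm L t ms : perm_eq (quint_mults t) ms -> has_counts L t ->
  perm_eq [seq x.1 | x <- L] ms.
Proof.
move=> tm cL; rewrite -(permPl (_ : perm_eq (quint_mults t) _)) //.
by apply/seq.permP => p; rewrite count_quint_mults cL.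
Qed.

Lemma surj_at_mults t ms : perm_eq (quint_mults t) ms ->
  surj_at (monomials d) t -> surj_mults ms.
Proof. by move=> tm [L [/(has_counts_perm tm) pL oL]]; apply: fsurj_mults. Qed.

Lemma inj_at_mults t ms : perm_eq (quint_mults t) ms ->
  inj_at (monomials d) t -> inj_mults ms.
Proof. by move=> tm [L [/(has_counts_perm tm) pL oL]]; apply: finj_mults. Qed.
End Results.

(** * General position *)

Section Nonvanishing.
Variable K : fieldType.
Hypothesis charK : [pchar K] =i pred0.

Lemma horner_prod_X n (N : nat) (a : 'X_{1..n}) (s : K) :
  \prod_(i < n) (s ^+ (N ^ i)) ^+ a i = s ^+ (\sum_(i < n) N ^ i * a i)%N.
Proof. by rewrite -prodrXr; apply: eq_bigr => i _; rewrite exprM. Qed.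

Lemma kronecker_inj n N (a b : 'X_{1..n}) : (forall i, a i < N)%N -> (forall i, b i < N)%N ->
  (\sum_(i < n) N ^ i * a i = \sum_(i < n) N ^ i * b i)%N -> a = b.
Proof.
move=> aN bN E; apply/mnmP; elim: n a b aN bN E => [|n IHn] a b aN bN E; first by case.
have N0 : (0 < N)%N by apply: leq_ltn_trans (aN ord0).
have S (c : 'X_{1..n.+1}) : (\sum_(i < n.+1) N ^ i * c i =
    c ord0 + N * \sum_(i < n) N ^ i * [multinom c (lift ord0 i) | i < n] i)%N.
  rewrite big_ord_recl expn0 mul1n big_distrr /=; congr (_ + _)%N.
  by apply: eq_bigr => i _; rewrite mnmE expnS mulnA.
move: E; rewrite !S => E.
have E0 : a ord0 = b ord0.
  have := congr1 (modn^~ N) E; rewrite /= ![(_ + N * _)%N]addnC ![(N * _)%N]mulnC !modnMDl.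
  by rewrite !modn_small.
move: E; rewrite E0 => /addnI/eqP; rewrite eqn_pmul2l // => /eqP E.
have H := IHn _ _ _ _ E; move=> i; case: (unliftP ord0 i) => [j ->|->//].
have := H _ _ j; rewrite !mnmE; apply => l; rewrite mnmE; [exact: aN|exact: bN].
Qed.

(* Kronecker substitution X_i := s^(N^i). *)
Lemma mpoly_nonvanishing n (F : {mpoly K[n]}) : F != 0 ->
  exists v : 'I_n -> K, F.@[v] != 0.
Proof.
move=> F0; pose N := msize F.
have aN (a : 'X_{1..n}) i : a \in msupp F -> (a i < N)%N.
  by move=> /msize_mdeg_lt; apply: leq_ltn_trans; rewrite mdegE (bigD1 i) //= leq_addr.
pose e (a : 'X_{1..n}) := (\sum_(i < n) N ^ i * a i)%N.
pose p : {poly K} := \sum_(a <- msupp F) F@_a *: 'X^(e a).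
have pE s : p.[s] = F.@[fun i : 'I_n => s ^+ (N ^ i)].
  rewrite mevalE horner_sum; apply: eq_bigr => a _.
  by rewrite hornerZ hornerXn horner_prod_X.
have p0 : p != 0.
  have lF : mlead F \in msupp F by rewrite mlead_supp.
  apply/eqP => /(congr1 (fun q : {poly K} => q`_(e (mlead F)))) /eqP.
  rewrite coef0 coef_sum (bigD1_seq (mlead F)) //= ?msupp_uniq // coefZ coefXn eqxx mulr1.
  rewrite big_seq_cond big1 ?addr0; last first.
    move=> a /andP[aF an]; rewrite coefZ coefXn; case: eqP => [E|_]; last by rewrite mulr0.
    by case/eqP: an; apply/esym; apply: kronecker_inj E => i; apply: aN.
  by rewrite mleadc_eq0 (negPf F0).
have [s _ ps] := exists_nonroot charK p0.
by exists (fun i : 'I_n => s ^+ (N ^ i)); rewrite -pE.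
Qed.

Section Closed.
Variables (ms : seq nat) (d : nat).
Local Notation k := (size ms).
Implicit Types (F G : {mpoly K[k * 4]}).

Lemma eval_mx_nonvanishing F : F != 0 -> exists A, eval_mx A F != 0.
Proof.
move=> /mpoly_nonvanishing[v Fv].
exists (\matrix_(i, j) v (mxvec_index i j)); rewrite /eval_mx.
rewrite (meval_eq (v2 := v)) // => a; case/mxvec_indexP: a => i j.
by rewrite mxvecE mxE.
Qed.

Lemma torus_poly_neq0 : torus_poly K k != 0.
Proof.
apply: contraTneq isT => T0; have := eval_torus (const_mx 1 : 'M[K]_(k, 4)).
rewrite T0 /eval_mx meval0 eqxx; move/esym/'forall_forallP; case.
by move=> i j; rewrite mxE oner_neq0.
Qed.

(** The generic minor and [G] are non-zero polynomials, so their product has a non-zero value over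
    the infinite field [K]: a good configuration can be moved to satisfy any further open
    condition. *)
Lemma minor_exists n f g (A : 'M[K]_(k, 4)) G : minor (d := d) (n := n) f g A != 0 -> G != 0 ->
  exists B, minor (d := d) (n := n) f g B != 0 /\ eval_mx B G != 0.
Proof.
move=> mA G0; have M0 : minor (d := d) (n := n) f g (gen_mx K k) != 0.
  by apply: contraNneq mA => M0; rewrite -eval_minor M0 /eval_mx meval0.
have [B] := eval_mx_nonvanishing (mulf_neq0 M0 G0).
rewrite /eval_mx rmorphM mulf_eq0 negb_or /= -!/(eval_mx _ _) eval_minor => /andP[? ?].
by exists B.
Qed.

Lemma row_full_exists (A : 'M[K]_(k, 4)) G : row_full (jet_mx d A) -> G != 0 ->
  exists B, row_full (jet_mx d B) /\ eval_mx B G != 0.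
Proof.
move=> Af G0.
have [|B [mB GB]] := minor_exists (f := fullrankfun Af) (g := id) (A := A) _ G0.
  by have := fullrowsub_unit Af; rewrite unitmxE unitfE.
exists B; split=> //; rewrite -sub1mx; apply: submx_trans (rowsub_sub (fullrankfun Af) _).
by rewrite sub1mx row_full_unit unitmxE unitfE.
Qed.

Lemma row_free_exists (A : 'M[K]_(k, 4)) G : row_free (jet_mx d A) -> G != 0 ->
  exists B, row_free (jet_mx d B) /\ eval_mx B G != 0.
Proof.
rewrite -row_full_tr => Af G0.
have [|B [mB GB]] := minor_exists (f := id) (g := fullrankfun Af) (A := A) _ G0.
  have := fullrowsub_unit Af; rewrite unitmxE unitfE -det_tr.
  by rewrite trmx_mxsub trmxK.
exists B; split=> //; rewrite -row_full_tr -sub1mx.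
apply: submx_trans (rowsub_sub (fullrankfun Af) _).
rewrite sub1mx row_full_unit unitmxE unitfE -det_tr.
by rewrite trmx_mxsub trmxK.
Qed.
End Closed.
End Nonvanishing.

(** * Cremona transformations *)

Section Composition.
Variables (R : comNzRingType) (n p q : nat).

Lemma comp_comp (f : {mpoly R[n]}) (s : n.-tuple {mpoly R[p]}) (t : p.-tuple {mpoly R[q]}) :
  (f \mPo s) \mPo t = f \mPo [tuple (tnth s i) \mPo t | i < n].
Proof.
rewrite !(comp_mpolyEX f) raddf_sum; apply: eq_bigr => a _ /=.
rewrite linearZ /= !comp_mpolyX rmorph_prod; congr (_ *: _); apply: eq_bigr => i _.
by rewrite rmorphXn tnth_mktuple.
Qed.

Lemma eq_comp (f : {mpoly R[n]}) (s t : n.-tuple {mpoly R[p]}) :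
  (forall i, tnth s i = tnth t i) -> f \mPo s = f \mPo t.
Proof. by move=> /eq_from_tnth->. Qed.
End Composition.

Section LowSubst.
Variables (K : fieldType) (n p : nat).
Implicit Types (f : {mpoly K[n.+1]}).

Definition mval (s : n.+1.-tuple {mpoly K[p]}) (v : 'I_p -> K) (i : 'I_n.+1) : K :=
  (tnth s i).@[v].

(** Around [v] the components of the substitution minus their values have order at least 1, so
    substituting them cannot lower the order of vanishing. *)
Lemma low_shift_comp m f (s : n.+1.-tuple {mpoly K[p]}) v :
  low m (shift (mval s v) f) -> low m (shift v (f \mPo s)).
Proof.
move=> lf; pose t := [tuple shift v (tnth s i) - (mval s v i)%:MP | i < n.+1].
have -> : shift v (f \mPo s) = shift (mval s v) f \mPo t.
  rewrite /shift !comp_comp; apply: eq_comp => i; rewrite !tnth_mktuple raddfD /=.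
  by rewrite comp_mpolyXU -tnth_nth tnth_mktuple comp_mpolyC subrK.
apply: low_comp lf => i; rewrite tnth_mktuple; apply/low1P.
by rewrite mcoeffB shift_coef0 mcoeffC eqxx mulr1 subrr.
Qed.

Lemma hasse_scale d (a b : 'X_{1..n.+1}) (c : K) (v : 'I_n.+1 -> K) : mdeg a = d ->
  hasse a b (fun i => c * v i) = c ^+ (d - mdeg b) * hasse a b v.
Proof.
move=> ad; case: (boolP [forall j, b j <= a j]%N) => [/forallP ba|].
  have -> : (d - mdeg b = \sum_j (a j - b j))%N by rewrite -ad !mdegE sumnB.
  rewrite -prodrXr /hasse -big_split; apply: eq_bigr => j _ /=.
  by rewrite exprMn mulrnAr.
rewrite negb_forall => /existsP[j]; rewrite -ltnNge => ab.
by rewrite /hasse (bigD1 j) //= [in RHS](bigD1 j) //= bin_small // !mulr0n !mul0r mulr0.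
Qed.

Lemma low_scale m d f (c : K) (v : 'I_n.+1 -> K) : f \is d.-homog ->
  low m (shift v f) -> low m (shift (fun i => c * v i) f).
Proof.
move=> /dhomogP fh lf b bm; rewrite mcoeff_shift.
rewrite big_seq (eq_bigr (fun a => c ^+ (d - mdeg b) * (f@_a * hasse a b v))); last first.
  by move=> a af; rewrite (hasse_scale _ _ _ (fh _ af)) mulrCA.
by rewrite -big_seq -mulr_sumr -mcoeff_shift lf ?mulr0.
Qed.
End LowSubst.

Section Linear.
Variable K : fieldType.
Hypothesis charK : [pchar K] =i pred0.
Implicit Types (f g : {mpoly K[4]}) (B : 'M[K]_4) (v w c : 'rV[K]_4).

Definition lin_subst B : 4.-tuple {mpoly K[4]} :=
  [tuple \sum_k B k j *: 'X_k | j < 4].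

Lemma mval_lin B c : mval (lin_subst B) (fun i => c 0 i) =1 (fun i => (c *m B) 0 i).
Proof.
move=> j; rewrite /mval tnth_mktuple raddf_sum mxE; apply: eq_bigr => k _ /=.
by rewrite mevalZ mevalXU mulrC.
Qed.

Lemma eq_shift (u v : 'I_4 -> K) f : u =1 v -> shift u f = shift v f.
Proof. by move=> uv; apply: eq_comp => i; rewrite !tnth_mktuple uv. Qed.

Lemma low_lin m f B c : low m (vshift (c *m B) f) -> low m (vshift c (f \mPo lin_subst B)).
Proof.
move=> lf; apply: low_shift_comp.
by rewrite (eq_shift _ (mval_lin B c)).
Qed.

Lemma homog_lin d f B : f \is d.-homog -> f \mPo lin_subst B \is d.-homog.
Proof.
move=> /dhomogP fh; rewrite comp_mpolyEX big_seq; apply: rpred_sum => a af.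
have ad : mdeg a = d := fh _ af.
apply: rpredZ; rewrite comp_mpolyX -ad mdegE; apply: dhomog_prodX => j.
by rewrite tnth_mktuple; apply: rpred_sum => k _; apply: rpredZ; apply: dhomogXi.
Qed.

Lemma lin_neq0 f B : B \in unitmx -> f != 0 -> f \mPo lin_subst B != 0.
Proof.
move=> uB /(mpoly_nonvanishing charK)[v fv]; apply: contraNneq fv => f0.
have : (f \mPo lin_subst B).@[fun i => ((\row_i v i) *m invmx B) 0 i] = 0 by rewrite f0 meval0.
rewrite comp_mpoly_meval => E; apply/eqP; rewrite -[RHS]E; apply: meval_eq => i.
by rewrite -/(mval _ _ _) mval_lin mulmxKV // mxE.
Qed.
End Linear.

Section Cremona.
Variable K : fieldType.
Hypothesis charK : [pchar K] =i pred0.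
Implicit Types (f g : {mpoly K[4]}) (mu : 'I_4 -> nat).

Let e (k : 'I_4) : 'rV[K]_4 := delta_mx 0 k.

(** At a coordinate point the jets are coefficients: dropping the exponent of X_k from a monomial of
    degree n gives a jet of order n - a_k, and the degree restores the dropped exponent, so no other
    monomial contributes to it. *)
Lemma low_vertex g n m k (a : 'X_{1..4}) : g \is n.-homog -> low m (vshift (e k) g) ->
  a \in msupp g -> (a k + m <= n)%N.
Proof.
move=> /dhomogP gh lg ag; rewrite leqNgt; apply/negP => am.
have an : mdeg a = n := gh _ ag.
pose b : 'X_{1..4} := [multinom (if j == k then 0%N else a j) | j < 4].
have bE : (mdeg b + a k = n)%N.
  rewrite -an !mdegE (bigD1 k) //= [in RHS](bigD1 k) //= mnmE eqxx add0n addnC; congr (_ + _)%N.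
  by apply: eq_bigr => j jk; rewrite mnmE (negPf jk).
have : (vshift (e k) g)@_b = g@_a.
  rewrite /vshift mcoeff_shift (bigD1_seq a) ?msupp_uniq //= [X in _ * X](_ : _ = 1).
    rewrite mulr1 big_seq_cond big1 ?addr0 // => a' /andP[a'g a'a].
    have [j jk aj] : exists2 j, j != k & a' j != a j.
      case: (boolP [forall j, (j == k) || (a' j == a j)]) => [/forallP H|].
        case/eqP: a'a; apply/mnmP => j; case/orP: (H j) => [/eqP->|/eqP//].
        have := gh _ a'g; rewrite /= -an !mdegE (bigD1 k) //= [in RHS](bigD1 k) //=.
        rewrite (eq_bigr (fun i => a i)) => [/addIn//|i ik].
        by have := H i; rewrite (negPf ik) => /eqP.
      by rewrite negb_forall => /existsP[j]; rewrite negb_or => /andP[]; exists j.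
    rewrite /hasse (bigD1 j) //= mnmE (negPf jk) mxE eqxx (negPf jk) /=.
    case: (ltngtP (a' j) (a j)) aj => // aj _; first by rewrite bin_small // mulr0n mul0r mulr0.
    by rewrite expr0n subn_eq0 leqNgt aj mul0rn mul0r mulr0.
  rewrite /hasse big1 // => j _; rewrite mnmE mxE eqxx; case: eqP => [->|jk] /=.
    by rewrite ?eqxx bin0 subn0 expr1n mulr1n.
  by rewrite subnn expr0 binn mulr1n.
rewrite lg; last by move: bE am; lia.
by move/esym/eqP; rewrite mcoeff_eq0 ag.
Qed.

(** Replacing each X_k by the product of the other variables turns X^a into the product of the
    X_k^(n - a_k); then X_k^(mu_k) is divided out. By [low_vertex] no subtraction is truncated on
    the monomials concerned. *)
Definition cremona_mnm n mu (a : 'X_{1..4}) : 'X_{1..4} := [multinom (n - mu k - a k)%N | k < 4].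

Definition cremona n mu g : {mpoly K[4]} := \sum_(a <- msupp g) g@_a *: 'X_[cremona_mnm n mu a].

Section Form.
Variables (n : nat) (mu : 'I_4 -> nat) (g : {mpoly K[4]}).
Hypothesis gh : g \is n.-homog.
Hypothesis gmu : forall k, low (mu k) (vshift (e k) g).

Let amu a k : a \in msupp g -> (a k + mu k <= n)%N.
Proof. exact: low_vertex. Qed.

Let sum4 (F : 'I_4 -> nat) k : (\sum_j F j = F k + \sum_(j < 4 | j != k) F j)%N.
Proof. by rewrite (bigD1 k). Qed.

Lemma cremona_homog : cremona n mu g \is (3 * n - \sum_k mu k)%N.-homog.
Proof.
rewrite /cremona big_seq; apply: rpred_sum => a ag; apply: rpredZ; rewrite dhomogX /=.
apply/eqP; have an : (\sum_k a k = n)%N by rewrite -mdegE; have /dhomogP := gh; apply.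
rewrite mdegE; under eq_bigr => k _ do rewrite mnmE.
rewrite sumnB => [|k _]; last by have := amu k ag; lia.
rewrite sumnB => [|k _]; last by have := amu k ag; lia.
rewrite sum_nat_const card_ord an subnAC; congr (_ - _)%N; lia.
Qed.

Lemma cremona_neq0 : g != 0 -> cremona n mu g != 0.
Proof.
move=> g0; have mg : mlead g \in msupp g by rewrite mlead_supp.
apply/eqP => /(congr1 (fun p : {mpoly K[4]} => p@_(cremona_mnm n mu (mlead g)))) /eqP.
rewrite mcoeff0 /cremona raddf_sum (bigD1_seq (mlead g)) ?msupp_uniq //= mcoeffZ mcoeffX eqxx mulr1.
rewrite big_seq_cond big1 ?addr0; first by rewrite mleadc_eq0 (negPf g0).
move=> a /andP[ag an]; rewrite mcoeffZ mcoeffX; case: eqP => [E|_]; last by rewrite mulr0.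
case/eqP: an; apply/mnmP => k; have := congr1 (fun b : 'X_{1..4} => b k) E.
by rewrite !mnmE; have := amu k ag; have := amu k mg; lia.
Qed.

(** The degree of a transformed monomial in the variables other than X_k is the sum of n - mu_j -
    a_j over j != k, which exceeds 2n minus the sum of these mu_j by a_k. *)
Lemma cremona_vertex k : low (2 * n - \sum_(j < 4 | j != k) mu j)%N (vshift (e k) (cremona n mu g)).
Proof.
rewrite /cremona /vshift shift_sum big_seq; apply: low_sum => a ag.
rewrite shiftZ -mul_mpolyC; apply: low_mull.
have an : (a k + \sum_(j < 4 | j != k) a j = n)%N.
  by rewrite -sum4 -mdegE; have /dhomogP := gh; apply.
rewrite mpolyXE_id shift_prod [X in low _ X](bigD1 k) //=; apply: low_mull.
apply: (low_leq (m := (\sum_(j < 4 | j != k) cremona_mnm n mu a j)%N)).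
  have -> : (\sum_(j < 4 | j != k) cremona_mnm n mu a j =
      \sum_(j < 4 | j != k) (n - mu j - a j))%N by apply: eq_bigr => j _; rewrite mnmE.
  rewrite sumnB => [|j _]; last by have := amu j ag; lia.
  rewrite sumnB => [|j _]; last by have := amu j ag; lia.
  have := sum4 (fun=> n) k; rewrite sum_nat_const card_ord => S.
  have -> : (\sum_(i < 4 | i != k) n = 3 * n)%N by lia.
  move: an; set X := (\sum_(j < 4 | j != k) a j)%N; set M := (\sum_(j < 4 | j != k) mu j)%N.
  lia.
elim: (index_enum _) => [|j r IHr]; first by rewrite !big_nil; apply: low0.
rewrite !big_cons; case: ifP => // jk; apply: lowM => //.
rewrite shiftXn -[X in low X _]mul1n; apply: lowX; apply/low1P.
by rewrite shift_coef0 mevalXU mxE eqxx (negPf jk).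
Qed.

Definition std_cremona : 4.-tuple {mpoly K[4]} := [tuple \prod_(l < 4 | l != k) 'X_l | k < 4].

Lemma cremona_comp : g \mPo std_cremona = cremona n mu g * \prod_k 'X_k ^+ mu k.
Proof.
rewrite comp_mpolyEX /cremona mulr_suml big_seq [RHS]big_seq; apply: eq_bigr => a ag.
rewrite -scalerAl; congr (_ *: _); rewrite comp_mpolyX mpolyXE_id -big_split /=.
have an : (\sum_k a k = n)%N by rewrite -mdegE; have /dhomogP := gh; apply.
under eq_bigr => k _ do rewrite tnth_mktuple -prodrXl big_mkcond.
rewrite exchange_big; apply: eq_bigr => l _ /=.
rewrite mnmE -exprD subnAC subnK; last by have := amu l ag; lia.
rewrite -[in RHS]an (sum4 _ l) addKn -big_mkcond /= prodrXr; congr (_ ^+ _).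
by apply: eq_bigl => k; rewrite eq_sym.
Qed.

(** The standard Cremona map sends c' to a multiple of c, and the powers of X_k that were divided
    out are units at c'. *)
Lemma cremona_general m (c c' : 'rV[K]_4) lam : lam != 0 -> (forall k, c 0 k * c' 0 k = lam) ->
  low m (vshift c g) -> low m (vshift c' (cremona n mu g)).
Proof.
move=> lam0 cc lg.
have c'0 k : c' 0 k != 0 by apply: contraNneq lam0 => E; rewrite -(cc k) E mulr0.
apply: (low_cancel (g := vshift c' (\prod_k 'X_k ^+ mu k))).
  rewrite /vshift shift_coef0 rmorph_prod; apply/prodf_neq0 => k _.
  by rewrite rmorphXn /= mevalXU expf_neq0.
rewrite /vshift -shiftM -cremona_comp; apply: low_shift_comp.
pose kap := (\prod_k c' 0 k) / lam.
rewrite (eq_shift (v := fun i => kap * c 0 i)); first exact: low_scale gh lg.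
move=> k; have ck : c 0 k != 0 by apply: contraNneq lam0 => E; rewrite -(cc k) E mul0r.
have -> : kap = \prod_(l < 4 | l != k) c' 0 l / c 0 k.
  by rewrite /kap (bigD1 k) //= -(cc k); field; rewrite ck c'0.
rewrite /mval tnth_mktuple rmorph_prod divfK //.
by apply: eq_bigr => l _; rewrite /= mevalXU.
Qed.
End Form.

(* c k * c' k = lam: the points with coordinates c and c' in the basis B correspond
   to each other under the standard Cremona transformation. *)
Lemma cremona_transport n mu f (B : 'M[K]_4) : B \in unitmx -> f \is n.-homog -> f != 0 ->
  (forall k, low (mu k) (vshift (row k B) f)) ->
  exists f', [/\ f' \is (3 * n - \sum_k mu k)%N.-homog, f' != 0,
    forall k, low (2 * n - \sum_(j < 4 | j != k) mu j)%N (vshift (row k B) f') &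
    forall m (c c' : 'rV[K]_4) lam, lam != 0 -> (forall k, c 0 k * c' 0 k = lam) ->
      low m (vshift (c *m B) f) -> low m (vshift (c' *m B) f')].
Proof.
move=> uB fh f0 fmu; pose g := f \mPo lin_subst B.
have gh : g \is n.-homog by apply: homog_lin.
have gmu k : low (mu k) (vshift (e k) g) by apply: low_lin; rewrite -rowE.
exists (cremona n mu g \mPo lin_subst (invmx B)); split.
- by apply/homog_lin/cremona_homog.
- apply: (lin_neq0 charK); first by rewrite unitmx_inv.
  by apply: cremona_neq0 => //; apply: lin_neq0.
- by move=> k; rewrite rowE; apply: low_lin; rewrite mulmxK //; apply: cremona_vertex.
move=> m c c' lam lam0 cc lf; apply: low_lin; rewrite mulmxK //.
by apply: (cremona_general gh gmu lam0 cc); apply: low_lin.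
Qed.
End Cremona.

Section Psi.
Variables (R : comNzRingType) (r : nat).
Implicit Types A : 'M[R]_(4 + r, 4).

(** With the adjugate in place of the inverse, the coordinates in the basis of the first four points
    are multiplied by the determinant, but the formula is polynomial and applies to the matrix of
    variables. *)
Definition basis_coords A : 'M[R]_(r, 4) := dsubmx A *m \adj (usubmx A).

(* The last r points are moved by the Cremona transformation based at the first four. *)
Definition psi A : 'M[R]_(4 + r, 4) :=
  col_mx (usubmx A)
    ((\matrix_(j < r, k < 4) \prod_(l < 4 | l != k) basis_coords A j l) *m usubmx A).
End Psi.

Section MapPsi.
Variables (R S : comNzRingType) (phi : {rmorphism R -> S}) (r : nat).
Implicit Types A : 'M[R]_(4 + r, 4).

Lemma map_basis_coords A : map_mx phi (basis_coords A) = basis_coords (map_mx phi A).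
Proof. by rewrite /basis_coords map_mxM map_mx_adj map_dsubmx map_usubmx. Qed.

Lemma map_psi A : map_mx phi (psi A) = psi (map_mx phi A).
Proof.
rewrite /psi map_col_mx map_mxM map_usubmx; congr (col_mx _ (_ *m _)).
apply/matrixP=> j k; rewrite [LHS]mxE [X in phi X]mxE [RHS]mxE rmorph_prod -map_basis_coords.
by apply: eq_bigr => l _; rewrite [RHS]mxE.
Qed.
End MapPsi.

Section Transfer.
Variable K : fieldType.
Hypothesis charK : [pchar K] =i pred0.

Lemma proj3_of_vector (v : 'rV[K]_4) : v != 0 -> exists P : proj3 K, sval P = <[v]>%VS.
Proof.
move=> v0; have vP : \dim <[v]>%VS == 1%N by rewrite dim_vline v0.
by exists (exist (fun L : {vspace 'rV[K]_4} => is_true (\dim L == 1%N)) _ vP).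
Qed.

Lemma evalP_neq0 k (F : {mpoly K[k * 4]}) A : eval_mx A F != 0 -> F != 0.
Proof. by apply: contraNneq => ->; rewrite /eval_mx meval0. Qed.

(** Each requirement is the non-vanishing of a polynomial that is non-zero at some special matrix;
    [G] is the product of these polynomials. *)
Lemma psi_generic r : exists2 G : {mpoly K[(4 + r) * 4]}, G != 0 &
  forall A : 'M[K]_(4 + r, 4), eval_mx A G != 0 ->
  [/\ usubmx A \in unitmx, forall j k, basis_coords A j k != 0 & forall i j, psi A i j != 0].
Proof.
pose X := gen_mx K (4 + r).
have evalX A (H : forall R : comNzRingType, 'M[R]_(4 + r, 4) -> 'M[R]_(r, 4)) :
  (forall (R S : comNzRingType) (phi : {rmorphism R -> S}) B, map_mx phi (H R B) = H S (map_mx phi B)) ->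
  forall j k, eval_mx A (H _ X j k) = H _ A j k.
  move=> HE j k; have := congr1 (fun M : 'M_(r, 4) => M j k) (HE _ _ (meval (fun a => mxvec A 0 a)) X).
  by rewrite mxE => E; apply: etrans E _; congr (H _ _ j k); apply: map_gen.
have evalC A j k : eval_mx A (basis_coords X j k) = basis_coords A j k.
  by apply: (evalX A (fun R => @basis_coords R r)) => R S phi B; apply: map_basis_coords.
have evalP A i j : eval_mx A (psi X i j) = psi A i j.
  have := congr1 (fun M : 'M_(4 + r, 4) => M i j) (map_psi (meval (fun a => mxvec A 0 a)) X).
  by rewrite mxE => E; apply: etrans E _; congr (psi _ i j); apply: map_gen.
have evalD A : eval_mx A (\det (usubmx X)) = \det (usubmx A).
  by rewrite /eval_mx -det_map_mx map_usubmx; congr (\det (usubmx _)); apply: map_gen.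
pose A1 : 'M[K]_(4 + r, 4) := col_mx 1%:M (const_mx 1).
have C1 j k : basis_coords A1 j k = 1.
  by rewrite /basis_coords col_mxKu col_mxKd adj1 mulmx1 mxE.
have P1 i j : psi X i j != 0.
  case: (splitP i) => [i' ii'|j' ij'].
    (* The four base points must themselves lie off the coordinate planes, which fails for the unit
       vectors in [A1]; hence another matrix. *)
    apply: (@evalP_neq0 _ _ (const_mx 1)); rewrite evalP /psi.
    have -> : i = lshift r i' by apply: val_inj.
    by rewrite col_mxEu !mxE oner_neq0.
  apply: (@evalP_neq0 _ _ A1); rewrite evalP /psi.
  have -> : i = rshift 4 j' by apply: val_inj.
  rewrite col_mxEd col_mxKu mulmx1 mxE big1 ?oner_neq0 //.
exists (\det (usubmx X) * (\prod_j \prod_k basis_coords X j k) * (\prod_i \prod_j psi X i j)).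
  rewrite !mulf_neq0 //.
  - by apply: (@evalP_neq0 _ _ A1); rewrite evalD col_mxKu det1 oner_neq0.
  - apply/prodf_neq0 => j _; apply/prodf_neq0 => k _.
    by apply: (@evalP_neq0 _ _ A1); rewrite evalC C1 oner_neq0.
  - by apply/prodf_neq0 => i _; apply/prodf_neq0 => j _; apply: P1.
move=> A; rewrite /eval_mx !rmorphM !mulf_eq0 !negb_or /= -!/(eval_mx _ _) evalD => /andP[/andP[dA]].
rewrite /eval_mx !rmorph_prod => /prodf_neq0 cA /prodf_neq0 pA; split.
- by rewrite unitmxE unitfE.
- move=> j k; have := cA j isT; rewrite rmorph_prod => /prodf_neq0/(_ k isT).
  by rewrite -[_ (basis_coords _ _ _)]/(eval_mx _ _) evalC.
- move=> i j; have := pA i isT; rewrite rmorph_prod => /prodf_neq0/(_ j isT).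
  by rewrite -[_ (psi _ _ _)]/(eval_mx _ _) evalP.
Qed.

(** A non-zero form of degree n through the points of [psi A] would be carried to a non-zero form of
    degree 3n - s through the points of [A], which was excluded. Depending on the multiplicities the
    lemma raises or lowers the degree, and both uses occur. *)
Lemma inj_mults_cremona n m0 m1 m2 m3 (rest : seq nat) :
  let s := (m0 + m1 + m2 + m3)%N in
  inj_mults K (3 * n - s) [:: 2 * n - (s - m0), 2 * n - (s - m1), 2 * n - (s - m2),
                             2 * n - (s - m3) & rest]%N ->
  inj_mults K n [:: m0, m1, m2, m3 & rest].
Proof.
move=> s; set ms' := (X in inj_mults _ _ X -> _); set ms := (X in _ -> inj_mults _ _ X).
case=> A0 A0n A0f; pose r := size rest.
have [G G0 GE] := psi_generic r.
have [A [Af AG]] := row_free_exists charK A0f (mulf_neq0 (torus_poly_neq0 K ms') G0).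
move: AG; rewrite /eval_mx rmorphM mulf_eq0 negb_or /= -!/(eval_mx _ _) eval_torus.
case/andP=> /'forall_forallP At /GE[uA cA pA].
pose B := @usubmx _ 4 r _ A; pose W := @dsubmx _ 4 r _ A.
pose mu (i : 'I_4) := nth 0%N [:: m0; m1; m2; m3] i.
have sE : (\sum_k mu k = s)%N by rewrite !big_ord_recl big_ord0 /mu /= addn0 !addnA.
exists (@psi _ r A); first exact: pA.
apply/jets_inj_row_free => f fh jf; apply/eqP/negPn/negP => f0.
have lf (i : 'I_(size ms)) : low (nth 0%N ms i) (vshift (row i (@psi _ r A)) f).
  have vA0 : row i (@psi _ r A) 0 ord0 != 0 by rewrite mxE pA.
  have [|P PE] := proj3_of_vector (v := row i (@psi _ r A)); last exact: jets_vanish_low PE vA0 fh (jf i).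
  by apply: contraNneq vA0 => ->; rewrite mxE.
have rowu k : row (lshift r k) (@psi _ r A) = row k B by rewrite -row_usubmx col_mxKu.
have fmu k : low (mu k) (vshift (row k B) f).
  have -> : mu k = nth 0%N ms (@lshift 4 r k) by case: k => [[|[|[|[|//]]]] Hk].
  rewrite -rowu; exact: (lf (@lshift 4 r k)).
have [f' [f'h f'0 f'v f'w]] := cremona_transport charK uA fh f0 fmu.
case/negP: f'0; apply/eqP.
have /jets_inj_row_free inj := Af; apply: inj; first by rewrite -sE.
move=> i b _; move: b; rewrite -/(low _ _).
case: (splitP (i : 'I_(4 + r))) => [k ik|j ij].
  have -> : row i A = row k B by rewrite row_usubmx; congr (row _ A); apply: val_inj.
  have -> : nth 0%N ms' i = (2 * n - \sum_(j < 4 | j != k) mu j)%N.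
    have -> : (\sum_(j < 4 | j != k) mu j = s - mu k)%N by rewrite -sE [in RHS](bigD1 k) //= addKn.
    by rewrite ik; case: (k) => [[|[|[|[|//]]]] Hk].
  exact: f'v.
(* Coordinates of the point in the basis [B]; dividing by the determinant undoes the adjugate. *)
have wE : row i A = (\row_k ((\det B)^-1 * basis_coords A j k)) *m B.
  have -> : row i A = row j W by rewrite row_dsubmx; congr (row _ A); apply: val_inj.
  have -> : \row_k ((\det B)^-1 * basis_coords A j k) = (\det B)^-1 *: row j (W *m \adj B).
    by apply/rowP=> k; rewrite !mxE; congr (_ * _); rewrite mxE.
  rewrite -scalemxAl row_mul -mulmxA mul_adj_mx mul_mx_scalar scalerA mulVf ?scale1r //.
  by rewrite -unitfE -unitmxE.
have -> : nth 0%N ms' i = nth 0%N ms i.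
  by rewrite ij.
rewrite wE; apply: (f'w _ (\row_k \prod_(l < 4 | l != k) basis_coords A j l) _
   ((\prod_l basis_coords A j l) / \det B)).
- rewrite mulf_neq0 ?invr_eq0 //; last by rewrite -unitfE -unitmxE.
  by apply/prodf_neq0.
- by move=> k; rewrite [X in X * _]mxE [X in _ * X]mxE [in RHS](bigD1 k) //=; ring.
have ->: (\row_k \prod_(l < 4 | l != k) basis_coords A j l) *m B = row i (@psi _ r A).
  have -> : i = @rshift 4 r j by apply: val_inj.
  transitivity (row j (dsubmx (@psi _ r A))); last by rewrite row_dsubmx.
  rewrite col_mxKd row_mul; congr (_ *m _); apply/rowP=> k.
  by rewrite mxE [RHS]mxE mxE.
exact: lf.
Qed.
End Transfer.

(** * Domination of multiplicities *)

Section Dominance.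
Variables (K : fieldType) (d : nat).

Section Embedding.
Variables (ms1 ms2 : seq nat) (sg : 'I_(size ms1) -> 'I_(size ms2)).
Hypothesis sg_inj : injective sg.
Hypothesis sg_le : forall i : 'I_(size ms1), (nth 0 ms1 i <= nth 0 ms2 (sg i))%N.

Lemma pick_sg i : [pick l | sg l == sg i] = Some i.
Proof.
case: pickP => [l /eqP/sg_inj->//|/(_ i)]; by rewrite eqxx.
Qed.

Lemma surj_mults_embed : surj_mults K d ms2 -> surj_mults K d ms1.
Proof.
case=> A A0 /jets_surj_row_full sA; exists (rowsub sg A); first by move=> i j; rewrite mxE.
apply/jets_surj_row_full => tau.
have [h hh hE] := sA (fun l b => if [pick i | sg i == l] is Some i then tau i b else 0).
exists h => // i b b0 bm; rewrite row_rowsub hE ?pick_sg //.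
exact: leq_trans bm (sg_le i).
Qed.

Lemma inj_mults_embed : inj_mults K d ms1 -> inj_mults K d ms2.
Proof.
case=> A A0 /jets_inj_row_free iA.
pose B : 'M[K]_(size ms2, 4) :=
  \matrix_(l, j) (if [pick i | sg i == l] is Some i then A i j else 1).
exists B; first by move=> l j; rewrite mxE; case: pickP => // *; apply: oner_neq0.
apply/jets_inj_row_free => f fh fj; apply: iA => // i b b0 bm.
have -> : row i A = row (sg i) B by apply/rowP=> j; rewrite !mxE pick_sg.
by apply: fj => //; apply: leq_trans bm (sg_le i).
Qed.
End Embedding.

Variables ms1 ms2 : seq nat.

Lemma widen_inj n m (le_nm : (n <= m)%N) : injective (widen_ord le_nm).
Proof. by move=> i j /(congr1 val) /= ij; apply: val_inj. Qed.

Lemma surj_mults_le : (size ms1 <= size ms2)%N -> (forall i, nth 0 ms1 i <= nth 0 ms2 i)%N ->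
  surj_mults K d ms2 -> surj_mults K d ms1.
Proof. by move=> sz le; apply: (surj_mults_embed (@widen_inj _ _ sz)) => i; apply: le. Qed.

Lemma inj_mults_le : (size ms1 <= size ms2)%N -> (forall i, nth 0 ms1 i <= nth 0 ms2 i)%N ->
  inj_mults K d ms1 -> inj_mults K d ms2.
Proof. by move=> sz le; apply: (inj_mults_embed (@widen_inj _ _ sz)) => i; apply: le. Qed.

Lemma perm_embedding : perm_eq ms1 ms2 ->
  exists2 sg : 'I_(size ms1) -> 'I_(size ms2), injective sg &
    forall i : 'I_(size ms1), nth 0%N ms1 i = nth 0%N ms2 (sg i).
Proof.
move=> /[dup] /perm_size sz /(perm_iotaP 0%N)[Is pIs E].
have szI : size Is = size ms2 by rewrite (perm_size pIs) size_iota.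
have lt_sg (i : 'I_(size ms1)) : (nth 0 Is i < size ms2)%N.
  have : nth 0%N Is i \in iota 0 (size ms2).
    by rewrite -(perm_mem pIs) mem_nth // szI -sz.
  by rewrite mem_iota.
exists (fun i => Ordinal (lt_sg i)) => [i j /(congr1 val) /= /eqP|i /=].
  rewrite nth_uniq ?szI -?sz ?(perm_uniq pIs) ?iota_uniq // => /eqP; exact: val_inj.
have -> j : nth 0%N ms1 j = nth 0%N [seq nth 0%N ms2 i | i <- Is] j by rewrite -E.
by rewrite (nth_map 0%N) // szI -sz.
Qed.

Lemma surj_mults_perm : perm_eq ms1 ms2 -> surj_mults K d ms2 -> surj_mults K d ms1.
Proof. by case/perm_embedding => sg sgi E; apply: surj_mults_embed sgi _ => i; rewrite E. Qed.

Lemma inj_mults_perm : perm_eq ms1 ms2 -> inj_mults K d ms1 -> inj_mults K d ms2.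
Proof. by case/perm_embedding => sg sgi E; apply: inj_mults_embed sgi _ => i; rewrite E. Qed.
End Dominance.

Section LinearRank.
Variables (K : fieldType) (ms : seq nat) (d : nat).
Hypothesis charK : [pchar K] =i pred0.
Local Notation k := (size ms).
Implicit Types (A : 'M[K]_(k, 4)) (C : 'M[K]_4).

Lemma jets_vanish_lowP m (v : 'rV[K]_4) f : v 0 ord0 != 0 -> f \is d.-homog ->
  jets_vanish m v f <-> low m (vshift v f).
Proof.
move=> v0 fh; split=> [|lf b _]; last exact: lf.
have [|P PE] := proj3_of_vector (v := v); last exact: jets_vanish_low PE v0 fh.
by apply: contraNneq v0 => ->; rewrite mxE.
Qed.

Lemma kernel_jet_mx A (u : 'rV_(size (monomials d))) :
  (u <= kermx (jet_mx d A))%MS <->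
  forall i : 'I_k, jets_vanish (nth 0%N ms i) (row i A) (form_of u).
Proof.
split=> [/sub_kermxP uA i b b0 bm|H].
  have [c [<- <-]] := condition_tnth b0 bm.
  by rewrite -(jet_mxE _ _ (form_of_homog u)) form_ofK uA mxE.
apply/sub_kermxP/rowP=> c; rewrite -{1}(form_ofK u) jet_mxE ?form_of_homog // mxE.
by have [? ?] := conditionsP c; apply: H.
Qed.

Lemma linear_subst_coef C : linear (fun u : 'rV[K]_(size (monomials d)) => coef_of d (form_of u \mPo lin_subst C)).
Proof.
move=> a u v; apply/rowP=> r; rewrite !mxE -mcoeffZ -mcoeffD; congr (_@__).
rewrite -linearZ -raddfD /=; congr (_ \mPo _).
rewrite /form_of scaler_sumr -big_split; apply: eq_bigr => r' _ /=.
by rewrite !mxE scalerDl scalerA.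
Qed.

(** Composition with the inverse substitution embeds the forms through [A] into those through
    [A *m C], so the rank cannot grow. The first coordinates enter because the conditions are
    written in the chart X_0 != 0. *)
Lemma rank_jet_mx_lin A C : C \in unitmx ->
  (forall i, A i ord0 != 0) -> (forall i, (A *m C) i ord0 != 0) ->
  (\rank (jet_mx d (A *m C)) <= \rank (jet_mx d A))%N.
Proof.
move=> uC A0 AC0; set J := jet_mx d A; set J' := jet_mx d (A *m C).
have le (N1 r r' : nat) : (r <= N1 -> r' <= N1 -> N1 - r <= N1 - r' -> r' <= r)%N by lia.
apply: (le (size (monomials d))); rewrite ?rank_leq_row // -!mxrank_ker -/J.
pose g (u : 'rV[K]_(size (monomials d))) := coef_of d (form_of u \mPo lin_subst (invmx C)).
pose glin := GRing.isLinear.Build K _ _ *:%R g (linear_subst_coef (invmx C)).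
pose gL : {linear _ -> _} := HB.pack g glin.
pose T := lin1_mx gL.
have gE (u : 'rV_(size (monomials d))) : form_of (u *m T) = form_of u \mPo lin_subst (invmx C).
  by rewrite mul_rV_lin1 /= /g coef_ofK // homog_lin // form_of_homog.
have fT : row_free T.
  apply/inj_row_free => u uT; apply/eqP; apply: contraT => u0.
  have : form_of u \mPo lin_subst (invmx C) != 0.
    apply: lin_neq0; rewrite ?unitmx_inv //; apply: contraNneq u0 => E.
    by rewrite -(form_ofK u) E; apply/eqP/rowP=> r; rewrite !mxE mcoeff0.
  rewrite -gE uT => /eqP[]; rewrite /form_of big1 // => r _; by rewrite mxE scale0r.
rewrite -(mxrankMfree (kermx J) fT); apply: mxrankS; apply/row_subP => r.
rewrite row_mul; apply/kernel_jet_mx => i; rewrite gE.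
have := row_sub r (kermx J) => /kernel_jet_mx/(_ i).
have h0 : (row i A) 0 ord0 != 0 by rewrite mxE.
have h1 : (row i (A *m C)) 0 ord0 != 0 by rewrite mxE.
move=> /(jets_vanish_lowP _ h0 (form_of_homog _)) lf.
apply/(jets_vanish_lowP _ h1); first by rewrite homog_lin // form_of_homog.
by apply: low_lin; rewrite row_mul -mulmxA mulmxV // mulmx1.
Qed.
End LinearRank.

(** * Splitting a 4-point into 2-points *)

Section Vertex.
Variable K : fieldType.
Hypothesis charK : [pchar K] =i pred0.
Variable d : nat.
Local Notation at_ F j := (nth (fun=> 0) F j).

Let vertex : 'rV[K]_4 := delta_mx 0 ord0.

Definition rows_of ms (A : 'M[K]_(size ms, 4)) : seq (nat * 'rV[K]_4) :=
  [seq (nth 0%N ms (i : 'I_(size ms)), row i A) | i <- enum 'I_(size ms)].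

Lemma rows_of_mults ms A : [seq x.1 | x <- rows_of (ms := ms) A] = ms.
Proof.
rewrite -map_comp; apply: (@eq_from_nth _ 0%N); first by rewrite size_map size_enum_ord.
move=> i; rewrite size_map size_enum_ord => im.
by rewrite (nth_map (Ordinal im)) ?size_enum_ord //= nth_enum_ord.
Qed.

Lemma points_mx_rows_of ms A : points_mx (rows_of (ms := ms) A) ms = A.
Proof.
apply/row_matrixP => i; rewrite rowK (nth_map i) ?size_enum_ord //=.
by rewrite nth_ord_enum.
Qed.

Lemma row_full_fsurj ms (A : 'M[K]_(size ms, 4)) : row_full (jet_mx d A) ->
  fsurj (monomials d) (functionals (rows_of A)).
Proof.
rewrite -[jet_mx d A]trmxK row_full_tr => Af u uE j.
have Lm := rows_of_mults A; rewrite (size_functionals Lm) => jc.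
have : (\row_(l < size (conditions ms)) u l) *m (jet_mx d A)^T == 0.
  apply/eqP/rowP=> r; rewrite !mxE -[RHS](uE (nth (0,0,0,0)%N (monomials d) r)) ?mem_nth //.
  rewrite (size_functionals Lm); apply: eq_bigr => l _.
  by rewrite mxE -(jet_mx_at _ _ Lm) points_mx_rows_of [X in _ * X]mxE.
by rewrite mulmx_free_eq0 // => /eqP/rowP/(_ (Ordinal jc)); rewrite !mxE.
Qed.

Lemma row_free_finj ms (A : 'M[K]_(size ms, 4)) : row_free (jet_mx d A) ->
  finj (monomials d) (functionals (rows_of A)).
Proof.
move=> Af; apply/(finj_indep _ (uniq_monomials d)) => u uE i id.
have Lm := rows_of_mults A.
have : (\row_(l < size (monomials d)) u l) *m jet_mx d A == 0.
  apply/eqP/rowP=> r; rewrite mxE [RHS]mxE -[RHS](uE r) ?(size_functionals Lm) //.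
  apply: eq_bigr => l _.
  by rewrite mxE -(jet_mx_at _ _ Lm) points_mx_rows_of.
by rewrite mulmx_free_eq0 // => /eqP/rowP/(_ (Ordinal id)); rewrite !mxE.
Qed.

(* The jets at the first coordinate point are the coefficients of the monomials with a large
   exponent of X_0. *)
Definition vertex_monomial (b : quad) : quad :=
  let: (_, b1, b2, b3) := b in (d - (b1 + b2 + b3), b1, b2, b3)%N.

Lemma functional_vertex m b a : (m <= d.+1)%N -> b \in jet_indices m -> a \in monomials d ->
  functional vertex b a = (a == vertex_monomial b)%:R.
Proof.
move=> md; case: b a => [[[b0 b1] b2] b3] [[[a0 a1] a2] a3].
rewrite mem_jet_indices mem_monomials => /andP[/eqP-> bm] /eqP ad.
rewrite /functional /hasse !big_ord_recl big_ord0 !mxE !multinomE !(tnth_nth 0%N) /=.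
rewrite bin0 subn0 expr1n !mulr1 mul1r.
have zero x y : (0 : K) ^+ (x - y) *+ 'C(x, y) = (x == y)%:R.
  rewrite expr0n subn_eq0; case: (ltngtP x y) => [xy|xy|->]; rewrite ?mul0rn ?binn //.
  by rewrite bin_small.
rewrite !zero /= -!natrM !mulnb; congr (nat_of_bool _)%:R.
apply/and3P/eqP => [[/eqP E1 /eqP E2 /eqP E3]|[_ -> -> ->]]; last by rewrite !eqxx.
by congr (_, _, _, _); lia.
Qed.

Section Drop.
Variables (m : nat) (L : seq (nat * 'rV[K]_4)).
Hypothesis md : (m <= d.+1)%N.
Local Notation far := [seq a <- monomials d | ~~ (d.+1 - m <= qdot (1, 0, 0, 0) a)]%N.

Lemma far_vertex b a : b \in jet_indices m -> a \in far -> (a == vertex_monomial b) = false.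
Proof.
case: b a => [[[b0 b1] b2] b3] [[[a0 a1] a2] a3].
rewrite mem_filter mem_jet_indices mem_monomials /= => /andP[_ bm] /andP[aa /eqP ad].
apply/negbTE; apply: contra aa => /eqP[]; lia.
Qed.

Lemma near_vertex a : a \in monomials d -> a \notin far ->
  exists2 b, b \in jet_indices m & a = vertex_monomial b.
Proof.
case: a => [[[a0 a1] a2] a3]; rewrite mem_filter mem_monomials => /eqP ad.
rewrite ad eqxx andbT negbK /= => aa.
exists (0%N, a1, a2, a3); first by rewrite mem_jet_indices /=; lia.
by rewrite /=; congr (_, _, _, _); lia.
Qed.

Lemma vertex_functionals : functionals ((m, vertex) :: L) =
  [seq functional vertex b | b <- jet_indices m] ++ functionals L.
Proof. by []. Qed.

(** The functionals of the vertex are dual to the monomials with X_0-exponent at least d + 1 - m. A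
    relation among the functionals of [L] on [far] extends to all monomials: on each remaining one
    it is cancelled by the vertex functional dual to it. *)
Lemma fsurj_drop_vertex : fsurj (monomials d) (functionals ((m, vertex) :: L)) ->
  fsurj far (functionals L).
Proof.
rewrite vertex_functionals; set F1 := map _ _; set F2 := functionals L => sF u uE.
have szF : size F1 = size (jet_indices m) by rewrite size_map.
pose g a := \sum_(j < size F2) u j * at_ F2 j a.
pose b_ j := nth (0, 0, 0, 0)%N (jet_indices m) j.
pose v j := if (j < size F1)%N then - g (vertex_monomial (b_ j)) else u (j - size F1)%N.
suff vE a : a \in monomials d -> \sum_(j < size (F1 ++ F2)) v j * at_ (F1 ++ F2) j a = 0.
  move=> j jF; have := sF v vE (size F1 + j)%N; rewrite size_cat ltn_add2l => /(_ jF).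
  by rewrite /v ltnNge leq_addr addKn.
move=> ad; rewrite (big_functionals_cat _ _ (fun j f => v j * f a)).
have -> : \sum_(j < size F2) v (size F1 + j)%N * at_ F2 j a = g a.
  by apply: eq_bigr => j _; rewrite /v ltnNge leq_addr addKn.
rewrite (eq_bigr (fun j : 'I_(size F1) => - ((a == vertex_monomial (b_ j))%:R * g a))); last first.
  move=> j _; have jF : (j < size (jet_indices m))%N by rewrite -szF.
  rewrite /v ltn_ord (nth_map (0, 0, 0, 0)%N) // (functional_vertex md) ?mem_nth //.
  by rewrite -/(b_ j); case: eqP => [->|_]; rewrite ?mulr1 ?mul1r // mulr0 mul0r oppr0.
rewrite sumrN -mulr_suml; case: (boolP (a \in far)) => af.
  rewrite big1 ?mul0r ?oppr0 ?add0r; first exact: uE.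
  by move=> j _; rewrite far_vertex // mem_nth // -szF.
have [b bm aE] := near_vertex ad af.
have bi : (index b (jet_indices m) < size F1)%N by rewrite szF index_mem.
rewrite (bigD1 (Ordinal bi)) //= /b_ nth_index // -aE eqxx big1 ?addr0 ?mul1r ?addNr //.
move=> j /eqP jb; case: eqP => // E; case: jb; apply: val_inj => /=.
have jF : (j < size (jet_indices m))%N by rewrite -szF.
rewrite -[LHS](index_uniq (0, 0, 0, 0)%N jF (uniq_jet_indices m)) -/(b_ j); congr (index _ _).
have : b_ j \in jet_indices m by rewrite mem_nth // -szF.
move: E bm; rewrite aE /b_; case: (nth _ _ _) => [[[? ?] ?] ?]; case: (b) => [[[? ?] ?] ?].
by rewrite !mem_jet_indices => -[_ -> -> ->] /andP[/eqP-> _] /andP[/eqP-> _].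
Qed.

(** Extended by zero, a form supported on [far] satisfies the conditions at the vertex
    automatically. *)
Lemma finj_drop_vertex : finj (monomials d) (functionals ((m, vertex) :: L)) ->
  finj far (functionals L).
Proof.
rewrite vertex_functionals; set F1 := map _ _; set F2 := functionals L => iF c cE.
have szF : size F1 = size (jet_indices m) by rewrite size_map.
have E (H : quad -> K) : \sum_(a <- monomials d) (a \in far)%:R * c a * H a = \sum_(a <- far) c a * H a.
  rewrite big_filter [RHS]big_mkcond big_seq [RHS]big_seq; apply: eq_bigr => a ad.
  by rewrite mem_filter ad andbT; case: ifP; rewrite ?mul1r ?mul0r.
suff H : forall a, a \in monomials d -> (a \in far)%:R * c a = 0.
  move=> a af; rewrite -[RHS](H a); first by rewrite af mul1r.
  by move: af; rewrite mem_filter => /andP[].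
apply: (iF (fun a => (a \in far)%:R * c a)) => j; rewrite size_cat E => jF; case: (ltnP j (size F1)) => jF1.
  rewrite big_seq big1 // => a af.
  have ad : a \in monomials d by move: af; rewrite mem_filter => /andP[].
  rewrite nth_cat jF1 (nth_map (0, 0, 0, 0)%N) -?szF // (functional_vertex md) ?mem_nth -?szF //.
  by rewrite far_vertex ?mulr0 // mem_nth -?szF.
rewrite -[RHS](cE (j - size F1)%N); last by rewrite ltn_subLR.
by rewrite nth_cat ltnNge jF1.
Qed.
End Drop.
End Vertex.

Section Split.
Variable K : fieldType.
Hypothesis charK : [pchar K] =i pred0.
Variables (d m : nat) (ms : seq nat).
Hypothesis md : (m <= d.+1)%N.
Local Notation r := (size ms).
Local Notation vertex := (delta_mx 0 ord0 : 'rV[K]_4).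
Local Notation near := [seq a <- monomials d | d.+1 - m <= qdot (1, 0, 0, 0) a]%N.
Local Notation far := [seq a <- monomials d | ~~ (d.+1 - m <= qdot (1, 0, 0, 0) a)]%N.

(* It is non-zero at the matrices for which the coordinate change of vertex_position makes all
   coordinates of the points but the first non-zero. *)
Definition vertex_poly : {mpoly K[r.+1 * 4]} :=
  let X := gen_mx K r.+1 in
  \prod_(i < r) \prod_(j < 3)
    (X (lift ord0 i) (lift ord0 j) * X ord0 ord0 - X ord0 (lift ord0 j) * X (lift ord0 i) ord0).

Lemma eval_vertex_poly A : eval_mx A vertex_poly = \prod_(i < r) \prod_(j < 3)
  (A (lift ord0 i) (lift ord0 j) * A ord0 ord0 - A ord0 (lift ord0 j) * A (lift ord0 i) ord0).
Proof.
rewrite /eval_mx rmorph_prod; apply: eq_bigr => i _; rewrite rmorph_prod; apply: eq_bigr => j _.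
by rewrite /= rmorphB !rmorphM /= -!/(eval_mx _ _) !eval_gen.
Qed.

Lemma vertex_poly_neq0 : vertex_poly != 0.
Proof.
apply: (@evalP_neq0 _ _ _ (\matrix_(i, j) ((i == ord0) || (j != ord0))%:R)).
rewrite eval_vertex_poly; apply/prodf_neq0 => i _; apply/prodf_neq0 => j _.
by rewrite !mxE /= mulr1 mulr0 subr0 oner_neq0.
Qed.

Lemma vertex_position (A : 'M[K]_(r.+1, 4)) : (forall i j, A i j != 0) ->
  eval_mx A vertex_poly != 0 ->
  exists B : 'M[K]_(r, 4), (forall i j, B i j != 0) /\
    (\rank (@jet_mx K (m :: ms) d A) <= \rank (@jet_mx K (m :: ms) d (col_mx vertex B)))%N.
Proof.
move=> A0; rewrite eval_vertex_poly => /prodf_neq0 G; set v0 := A ord0 ord0.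
have v00 : v0 != 0 by apply: A0.
(* Coordinates in the basis of the first point and the last three unit vectors, the rows of [C]. The
   first point becomes the vertex, and [vertex_poly] keeps the others off the coordinate planes. *)
pose A' : 'M[K]_(r.+1, 4) :=
  \matrix_(i, j) (if j == ord0 then A i ord0 / v0 else A i j - A i ord0 * A ord0 j / v0).
pose C : 'M[K]_4 := \matrix_(i, j) (if i == ord0 then A ord0 j else (i == j)%:R).
have AC : A' *m C = A.
  apply/matrixP=> i j; rewrite !mxE (bigD1 ord0) //= !mxE /=.
  case: (eqVneq j ord0) => [->|j0].
    rewrite big1 ?addr0 ?divfK // => l l0; by rewrite !mxE (negPf l0) mulr0.
  rewrite (bigD1 j) //= !mxE (negPf j0) eqxx mulr1 big1 ?addr0.
    by rewrite addrC mulrAC subrK.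
  by move=> l /andP[l0 lj]; rewrite !mxE (negPf l0) (negPf lj) mulr0.
have uC : C \in unitmx.
  rewrite unitmxE unitfE -det_tr det_trig; last first.
    apply/is_trig_mxP => i j ij; rewrite !mxE; case: eqP => [j0|_].
      by rewrite j0 in ij.
    by case: eqP => // E; rewrite E ltnn in ij.
  apply/prodf_neq0 => i _; rewrite !mxE eqxx; case: ifP => _; [exact: A0|exact: oner_neq0].
have A'E : A' = col_mx vertex (\matrix_(i, j) A' (rshift 1 i) j).
  have -> : (\matrix_(i, j) A' (rshift 1 i) j) = @dsubmx _ 1 r _ A'.
    by apply/matrixP=> i j; rewrite mxE [RHS]mxE.
  have -> : vertex = @usubmx _ 1 r _ A'; last by rewrite vsubmxK.
  apply/rowP=> j; rewrite [RHS]mxE (_ : lshift r 0 = ord0); last exact: val_inj.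
  rewrite mxE [RHS]mxE eqxx -/v0; case: (j == ord0) => /=; first by rewrite mulfV.
  by rewrite mulrAC mulfV // mul1r subrr.
exists (\matrix_(i, j) A' (rshift 1 i) j); split.
  move=> i j; rewrite !mxE; case: ifPn => [_|j0]; first by rewrite mulf_neq0 ?invr_eq0.
  have [j' ->] : exists j' : 'I_3, j = lift ord0 j' by case: (unliftP ord0 j) j0 => [j' ->|->] //; exists j'.
  have /prodf_neq0/(_ j' isT) := G i isT; have -> : rshift 1 i = lift ord0 i by apply: val_inj.
  apply: contra => /eqP/(congr1 (fun x => x * v0)); rewrite mulrBl divfK // mul0r => E.
  by apply/eqP; rewrite -[RHS]E (mulrC (A ord0 _)).
rewrite -A'E; have := @rank_jet_mx_lin K (m :: ms) d charK A' C uC; rewrite AC; apply=> // i.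
by rewrite mxE eqxx mulf_neq0 ?invr_eq0.
Qed.

Lemma rows_of_vertex (B : 'M[K]_(r, 4)) :
  rows_of (ms := m :: ms) (col_mx vertex B) = (m, vertex) :: rows_of B.
Proof.
rewrite /rows_of enum_ordSl /= -map_comp; congr (_ :: _).
  by congr (_, _); rewrite -(row_id 0 vertex); apply/rowP=> j; rewrite !mxE; case: splitP => // k; rewrite ord1 !mxE.
apply: eq_map => i /=; congr (_, _); apply/rowP=> j; rewrite !mxE.
case: splitP => [k|k /eqP]; first by rewrite ord1.
by rewrite eqSS => /eqP/val_inj->.
Qed.

(** With the m-point at the vertex, the other points solve the problem for [far]. The vertex
    accounts exactly for [near], so any configuration that solves [near] can take its place, by the
    cut in direction (1, 0, 0, 0). *)
Lemma surj_mults_split ms' : (exists L, [/\ perm_eq [seq x.1 | x <- L] ms', on_torus L &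
    @fsurj K near (functionals L)]) ->
  surj_mults K d (m :: ms) -> surj_mults K d (ms' ++ ms).
Proof.
case=> L' [pL' oL' sL'] [A0 A00 A0f].
have [A [Af]] := row_full_exists charK A0f (mulf_neq0 (torus_poly_neq0 K (m :: ms)) vertex_poly_neq0).
rewrite /eval_mx rmorphM mulf_eq0 negb_or /= -!/(eval_mx _ _) eval_torus.
case/andP=> /'forall_forallP At /(vertex_position At)[B [B0 rB]].
have : row_full (@jet_mx K (m :: ms) d (col_mx vertex B)).
  by rewrite /row_full eqn_leq rank_leq_col -{1}(eqP Af).
move=> /row_full_fsurj; rewrite rows_of_vertex => /(fsurj_drop_vertex md) sB.
have [s s0 sc] := fsurj_cut charK sL' sB.
apply: (fsurj_mults _ _ sc).
  rewrite map_cat rows_of_mults perm_cat2r -map_comp.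
  exact: pL'.
apply: on_torus_cat; first exact: on_torus_scale.
by move=> x /mapP[i _ ->] j; rewrite mxE.
Qed.

Lemma inj_mults_split ms' : (exists L, [/\ perm_eq [seq x.1 | x <- L] ms', on_torus L &
    @finj K near (functionals L)]) ->
  inj_mults K d (m :: ms) -> inj_mults K d (ms' ++ ms).
Proof.
case=> L' [pL' oL' sL'] [A0 A00 A0f].
have [A [Af]] := row_free_exists charK A0f (mulf_neq0 (torus_poly_neq0 K (m :: ms)) vertex_poly_neq0).
rewrite /eval_mx rmorphM mulf_eq0 negb_or /= -!/(eval_mx _ _) eval_torus.
case/andP=> /'forall_forallP At /(vertex_position At)[B [B0 rB]].
have : row_free (@jet_mx K (m :: ms) d (col_mx vertex B)).
  by rewrite /row_free eqn_leq rank_leq_row -{1}(eqP Af).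
move=> /row_free_finj; rewrite rows_of_vertex => /(finj_drop_vertex md) sB.
have [s s0 sc] := finj_cut charK (uniq_monomials d) sL' sB.
apply: (finj_mults _ _ sc).
  rewrite map_cat rows_of_mults perm_cat2r -map_comp.
  exact: pL'.
apply: on_torus_cat; first exact: on_torus_scale.
by move=> x /mapP[i _ ->] j; rewrite mxE.
Qed.
End Split.

(** * Conclusions from one configuration *)

Section Conclusions.
Variables (K : fieldType) (d : nat) (ms : seq nat).
Hypothesis charK : [pchar K] =i pred0.
Local Notation k := (size ms).

Lemma size_monomials : size (monomials 9) = 220%N.
Proof. by []. Qed.

Lemma size_conditions : all (fun m => m <= 5)%N ms -> size (conditions ms) = fat_deg ms.
Proof.
move=> /all_nthP m5; rewrite size_allpairs_dep sumnE big_map big_enum /= /fat_deg.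
rewrite [RHS](big_nth 0%N) big_mkord; apply: eq_bigr => i _.
by case: (nth _ _ _) (m5 0%N i (ltn_ord i)) => [|[|[|[|[|[|]]]]]].
Qed.

Lemma good_of_surj : size (monomials d) = 'C(d + 3, 3) -> size (conditions ms) = fat_deg ms ->
  (fat_deg ms <= 'C(d + 3, 3))%N ->
  surj_mults K d ms -> for_general (fun P : 'I_k -> proj3 K => good_postulation d P).
Proof.
move=> dE cE le [A A0 Af]; have [U [oU neU UP]] := general_H1_zero A0 Af.
exists U; split=> // P /UP[H1 H0]; split=> // ge; apply: H0.
by rewrite cE dE; apply/eqP; rewrite eqn_leq le.
Qed.

Lemma good_of_inj : size (monomials d) = 'C(d + 3, 3) -> size (conditions ms) = fat_deg ms ->
  ('C(d + 3, 3) <= fat_deg ms)%N ->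
  inj_mults K d ms -> for_general (fun P : 'I_k -> proj3 K => good_postulation d P).
Proof.
move=> dE cE ge; case: (leqP (fat_deg ms) 'C(d + 3, 3)) => [le|gt] [A A0 Af].
  apply: good_of_surj => //; exists A => //.
  move: Af; rewrite /row_free /row_full => /eqP->; apply/eqP.
  by rewrite dE cE; apply/eqP; rewrite eqn_leq le ge.
have [U [oU neU UP]] := general_H0_zero A0 Af.
exists U; split=> // P /UP H0; split=> // le.
by rewrite leqNgt gt in le.
Qed.

(* On this open set the points lie in all standard charts and are separated by X_1 / X_0. *)
Definition distinct_poly : {mpoly K[k * 4]} :=
  \prod_(p : 'I_k * 'I_k | p.1 != p.2)
    (gen_mx K k p.2 ord0 * gen_mx K k p.1 (inord 1) - gen_mx K k p.2 (inord 1) * gen_mx K k p.1 ord0).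

Lemma distinct_multideg : exists e, has_multideg e distinct_poly.
Proof.
exists (fun l => \sum_(p <- [seq p <- index_enum _ | p.1 != p.2] : seq ('I_k * 'I_k)) ((l == p.2) + (l == p.1)))%N.
rewrite /distinct_poly -big_filter; apply: has_multideg_prod => p.
apply: has_multidegD; last apply: has_multidegN; apply: has_multidegM; exact: has_multideg_gen.
Qed.

Lemma eval_distinct A : eval_mx A distinct_poly = \prod_(p : 'I_k * 'I_k | p.1 != p.2)
  (A p.2 ord0 * A p.1 (inord 1) - A p.2 (inord 1) * A p.1 ord0).
Proof.
rewrite /eval_mx rmorph_prod; apply: eq_bigr => p _.
by rewrite rmorphB !rmorphM /= -!/(eval_mx _ _) !eval_gen.
Qed.

Lemma for_general_distinct (Q : ('I_k -> proj3 K) -> Prop) :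
  (forall P (V : 'M[K]_(k, 4)), (forall i, sval (P i) = <[row i V]>%VS) -> (forall i j, V i j != 0) ->
    (forall a b, a != b -> V b ord0 * V a (inord 1) != V b (inord 1) * V a ord0) -> Q P) ->
  for_general Q.
Proof.
move=> H; have [e1 h1] := torus_multideg K ms; have [e2 h2] := distinct_multideg.
(* The values 1, 2, 3, ... of X_1 / X_0 are distinct and non-zero in characteristic 0. *)
pose A0 : 'M[K]_(k, 4) := \matrix_(i, j) (if j == inord 1 then i.+1%:R else 1).
have natr0 n : n.+1%:R != 0 :> K by rewrite ((pcharf0P K).1 charK).
have neq1 : ord0 == inord 1 :> 'I_4 = false by rewrite -val_eqE /= inordK.
apply: (for_general_intro (A0 := A0) (has_multidegM h1 h2)).
- rewrite /eval_mx rmorphM mulf_neq0 //= -/(eval_mx _ _).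
    rewrite eval_torus; apply/'forall_forallP => i j; rewrite mxE.
    by case: ifP => _; rewrite ?oner_neq0.
  rewrite eval_distinct; apply/prodf_neq0 => -[a b] /= ab; rewrite !mxE eqxx neq1 mul1r mulr1 subr_eq0.
  apply: contra ab => /eqP/(natr_inj_pchar0 charK)[E]; apply/eqP; exact: val_inj.
- by move=> i; apply/eqP => /rowP/(_ ord0); rewrite !mxE neq1; apply/eqP; rewrite oner_neq0.
move=> P V PV; rewrite /eval_mx rmorphM mulf_eq0 negb_or /= -!/(eval_mx _ _).
rewrite eval_torus eval_distinct => /andP[/'forall_forallP Vn /prodf_neq0 Vd]; apply: (H P V) => // a b ab.
by rewrite -subr_eq0; apply: (Vd (a, b)).
Qed.

(** Since [inj_mults] asks for a single configuration, its negation excludes every configuration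
    with non-zero coordinates, in particular the general ones. *)
Lemma bad_of_inj : ('C(d + 3, 3) <= fat_deg ms)%N -> ~ inj_mults K d ms ->
  for_general (fun P : 'I_k -> proj3 K => ~ good_postulation d P).
Proof.
move=> ge nI; apply: for_general_distinct => P V PV V0 _ [_ /(_ ge) H0]; apply: nI.
exists V => //; apply/jets_inj_row_free.
by apply: (inj_of_H0_zero PV _ H0) => i j; rewrite mxE.
Qed.

Lemma bad_of_surj : (fat_deg ms <= 'C(d + 3, 3))%N -> {in ms, forall m, m <= d.+1}%N ->
  ~ surj_mults K d ms ->
  for_general (fun P : 'I_k -> proj3 K => ~ good_postulation d P).
Proof.
move=> le msd nS; apply: for_general_distinct => P V PV V0 Vd [/(_ le) H1 _]; apply: nS.
exists V => //; apply/jets_surj_row_full.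
apply: (surj_of_H1_zero PV _ _ msd H1) => [i j|a b ab]; first by rewrite mxE.
by rewrite !mxE; apply: Vd.
Qed.
End Conclusions.

Section Existence.
Variables (K : fieldType) (d : nat) (ms : seq nat).
Implicit Types A : 'M[K]_(size ms, 4).

Lemma form_exists A : (size (conditions ms) < size (monomials d))%N -> (forall i, A i ord0 != 0) ->
  exists f, [/\ f \is d.-homog, f != 0 & forall i : 'I_(size ms), low (nth 0%N ms i) (vshift (row i A) f)].
Proof.
move=> lt A0; pose u := nz_row (kermx (jet_mx d A)).
have u0 : u != 0.
  rewrite nz_row_eq0 -mxrank_eq0 mxrank_ker subn_eq0 -ltnNge.
  by apply: leq_ltn_trans lt; apply: rank_leq_col.
have /kernel_jet_mx uE : (u <= kermx (jet_mx d A))%MS by apply: nz_row_sub.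
exists (form_of u); split; first exact: form_of_homog.
  by apply: contraNneq u0 => E; rewrite -(form_ofK u) E; apply/eqP/rowP=> r; rewrite !mxE mcoeff0.
by move=> i; apply/(@jets_vanish_lowP _ d) => //; rewrite ?mxE ?form_of_homog.
Qed.

Lemma not_inj_mults A f : (forall i j, A i j != 0) -> f \is d.-homog -> f != 0 ->
  (forall i : 'I_(size ms), low (nth 0%N ms i) (vshift (row i A) f)) -> row_free (jet_mx d A) = false.
Proof.
move=> A0 fh f0 lf; apply/negP => /jets_inj_row_free inj; case/eqP: f0; apply: inj => // i b _.
exact: lf.
Qed.
End Existence.

(** * Exceptional cases *)

Lemma fat_degE ms : fat_deg ms = sumn [seq 'C(m + 2, 3) | m <- ms]%N.
Proof. by rewrite /fat_deg sumnE big_map. Qed.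

Section Product.
Variables (K : fieldType) (d e : nat) (ms ms' : seq nat) (mu : nat -> nat).
Variables (A : 'M[K]_(size ms, 4)) (A' : 'M[K]_(size ms', 4)) (q : {mpoly K[4]}).
Hypothesis A0 : forall i, A i ord0 != 0.
Hypothesis A'0 : forall i, A' i ord0 != 0.
Hypothesis AA' : forall i : 'I_(size ms), exists2 i' : 'I_(size ms'), row i' A' = row i A &
  (nth 0 ms i <= nth 0 ms' i' + mu i)%N.
Hypotheses (qh : q \is e.-homog) (q0 : q != 0).
Hypothesis ql : forall i : 'I_(size ms), low (mu i) (vshift (row i A) q).

Lemma linear_product_coef :
  linear (fun u : 'rV[K]_(size (monomials d)) => coef_of (d + e) (form_of u * q)).
Proof.
move=> a u v; apply/rowP=> r; rewrite !mxE -mcoeffZ -mcoeffD; congr (_@__).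
rewrite scalerAl -mulrDl; congr (_ * _).
rewrite /form_of scaler_sumr -big_split; apply: eq_bigr => r' _ /=.
by rewrite !mxE scalerDl scalerA.
Qed.

(** Multiplication by [q] embeds the forms of degree d with the residual multiplicities into the
    forms of degree d + e with the full ones. *)
Lemma rank_ker_product :
  (\rank (kermx (jet_mx d A')) <= \rank (kermx (jet_mx (d + e) A)))%N.
Proof.
pose g (u : 'rV[K]_(size (monomials d))) := coef_of (d + e) (form_of u * q).
pose glin := GRing.isLinear.Build K _ _ *:%R g linear_product_coef.
pose gL : {linear _ -> _} := HB.pack g glin.
pose T := lin1_mx gL.
have gh (u : 'rV[K]_(size (monomials d))) : form_of u * q \is (d + e).-homog.
  by apply: dhomogM => //; apply: form_of_homog.
have gE (u : 'rV_(size (monomials d))) : form_of (u *m T) = form_of u * q.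
  by rewrite mul_rV_lin1 /= /g coef_ofK.
have form0 (u : 'rV[K]_(size (monomials d))) : form_of u = 0 -> u = 0.
  by move=> E; rewrite -(form_ofK u) E; apply/rowP=> r; rewrite !mxE mcoeff0.
have fT : row_free T.
  apply/inj_row_free => u uT; apply: form0; apply/eqP.
  have /eqP : form_of u * q = 0.
    by rewrite -gE uT /form_of big1 // => r _; rewrite mxE scale0r.
  by rewrite mulf_eq0 (negPf q0) orbF.
rewrite -(mxrankMfree (kermx (jet_mx d A')) fT); apply: mxrankS; apply/row_subP => r.
rewrite row_mul; apply/kernel_jet_mx => i; rewrite gE.
have [i' ii' le] := AA' i.
have := row_sub r (kermx (jet_mx d A')) => /kernel_jet_mx/(_ i').
have h0 : (row i' A') 0 ord0 != 0 by rewrite mxE.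
have h1 : (row i A) 0 ord0 != 0 by rewrite mxE.
move=> /(jets_vanish_lowP _ h0 (form_of_homog _)); rewrite ii' => lf.
apply/(jets_vanish_lowP _ h1 (gh _)).
apply: low_leq le _; rewrite /vshift shiftM; exact: lowM lf (@ql i).
Qed.
End Product.

(** * Exceptions caused by a quadric through nine points *)

Section QuadricExceptions.
Variable K : fieldType.

(** At most nine linear conditions on ten coefficients. Entries 0 of [ms] stand for points that need
    not lie on the quadric. *)
Lemma quadric_exists (ms : seq nat) (A : 'M[K]_(size ms, 4)) : (forall i j, A i j != 0) ->
  (size [seq m <- ms | m > 0] <= 9)%N -> all (fun m => m <= 1)%N ms ->
  exists q, [/\ q \is 2.-homog, q != 0 &
    forall i : 'I_(size ms), low (nth 0%N ms i) (vshift (row i A) q)].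
Proof.
move=> A0 m9 m1; apply: form_exists => //.
rewrite size_conditions; last by apply: sub_all m1 => m /leq_trans->.
apply: (leq_ltn_trans _ (m9 : (_ < size (monomials 2))%N)); rewrite fat_degE size_filter.
elim: ms m1 {A A0 m9} => //= m ms IHms /andP[m1 /IHms le]; apply: leq_add le.
by case: m m1 => [|[|]].
Qed.

(** Let [q] be a quadric through all nine points and [s] a cubic singular at the 5-points and
    passing through the 4-points (19 conditions, 20 coefficients). Then q^3 s has degree 9 and
    multiplicities 3 + 2, 3 + 1 and 3. *)
Lemma not_inj_4320 : ~ inj_mults K 9 (mults 4 3 2 0).
Proof.
case=> A A0 Af; have A00 i : A i ord0 != 0 by [].
have [q [qh q0 ql]] := @quadric_exists (nseq 9 1%N) A A0 isT isT.
have [|s [sh s0 sl]] := @form_exists K 3 [:: 2; 2; 2; 2; 1; 1; 1; 0; 0]%N A _ A00.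
  by rewrite size_conditions // fat_degE.
move: Af; rewrite (not_inj_mults (f := q ^+ 3 * s) A0) //.
- exact: dhomogM_eq (dhomogMn 3 qh) sh _.
- by rewrite mulf_neq0 // expf_neq0.
move=> i; rewrite /vshift shiftM shiftXn.
have le : (nth 0 (mults 4 3 2 0) i <= 1 * 3 + nth 0 [:: 2; 2; 2; 2; 1; 1; 1; 0; 0] i)%N.
  by case: i => [[|[|[|[|[|[|[|[|[|]]]]]]]]]].
apply: low_leq le _; apply: lowM (sl i); apply: lowX.
by have := ql i; rewrite nth_nseq ltn_ord.
Qed.

(** The fourth power of the quadric, times a plane through the three 5-points. *)
Lemma not_inj_3600 : ~ inj_mults K 9 (mults 3 6 0 0).
Proof.
case=> A A0 Af; have A00 i : A i ord0 != 0 by [].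
have [q [qh q0 ql]] := @quadric_exists (nseq 9 1%N) A A0 isT isT.
have [|s [sh s0 sl]] := @form_exists K 1 [:: 1; 1; 1; 0; 0; 0; 0; 0; 0]%N A _ A00.
  by rewrite size_conditions // fat_degE.
move: Af; rewrite (not_inj_mults (f := q ^+ 4 * s) A0) //.
- exact: dhomogM_eq (dhomogMn 4 qh) sh _.
- by rewrite mulf_neq0 // expf_neq0.
move=> i; rewrite /vshift shiftM shiftXn.
have le : (nth 0 (mults 3 6 0 0) i <= 1 * 4 + nth 0 [:: 1; 1; 1; 0; 0; 0; 0; 0; 0] i)%N.
  by case: i => [[|[|[|[|[|[|[|[|[|]]]]]]]]]].
apply: low_leq le _; apply: lowM (sl i); apply: lowX.
by have := ql i; rewrite nth_nseq ltn_ord.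
Qed.

(* Multiples of a quadric through the points make the kernel too large. *)
Lemma not_row_full_quadric (ms ms1 ms' : seq nat) (A : 'M[K]_(size ms, 4))
    (A1 : 'M[K]_(size ms1, 4)) (A' : 'M[K]_(size ms', 4)) :
  (forall i j, A i j != 0) -> (forall i j, A1 i j != 0) -> (forall i j, A' i j != 0) ->
  (size [seq m <- ms1 | m > 0] <= 9)%N -> all (fun m => m <= 1)%N ms1 ->
  (forall i : 'I_(size ms), exists i1 : 'I_(size ms1), exists i' : 'I_(size ms'),
    [/\ i1 = i :> nat, row i1 A1 = row i A, row i' A' = row i A &
      (nth 0 ms i <= nth 0 ms' i' + nth 0 ms1 i1)%N]) ->
  (220 + size (conditions ms') < 120 + size (conditions ms))%N -> row_full (jet_mx 9 A) = false.
Proof.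
move=> A0 A10 A'0 m9 m1 E lt; apply/negP => Af.
have [q [qh q0 ql]] := quadric_exists A10 m9 m1.
have := @rank_ker_product K 7 2 ms ms' (nth 0%N ms1) A A' q (fun i => A0 i _) (fun i => A'0 i _) _ qh q0 _.
have := rank_leq_col (jet_mx 7 A').
rewrite !mxrank_ker (eqP Af); move: (\rank (jet_mx 7 A')) => r7 r7c H.
have {}H : (120 - r7 <= 220 - size (conditions ms))%N.
  apply: H => i; have [i1 [i' [E1 E2 E3 E4]]] := E i; first by rewrite E1 in E4; exists i'.
  by rewrite -E1 -E2; apply: ql.
move: (rank_leq_row (jet_mx 9 A)); rewrite (eqP Af) => le.
have {}le : (size (conditions ms) <= 220)%N by [].
lia.
Qed.

(** For z = 0 the residual multiplicities in degree 7 impose at most 114 conditions on 120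
    coefficients, so at least 6 independent multiples of the quadric exist, while independent
    conditions in degree 9 would leave 220 - 215 = 5 forms. For z = 1 the 2-point need not lie on
    the quadric, and the numbers are 2 against 1. *)
Lemma not_surj_351 z : (z <= 1)%N -> ~ surj_mults K 9 (mults 3 5 1 z).
Proof.
case: z => [|[|//]] _ [A A0 Af]; move: Af.
  rewrite (@not_row_full_quadric _ (nseq 9 1%N) [:: 4; 4; 4; 3; 3; 3; 3; 3; 2]%N A A A) //.
    by move=> i; exists i, i; split=> //; case: i => [[|[|[|[|[|[|[|[|[|]]]]]]]]]].
  by rewrite !size_conditions // !fat_degE.
rewrite (@not_row_full_quadric _ (rcons (nseq 9 1%N) 0%N) [:: 4; 4; 4; 3; 3; 3; 3; 3; 2; 2]%N A A A) //.
  by move=> i; exists i, i; split=> //; case: i => [[|[|[|[|[|[|[|[|[|[|]]]]]]]]]]].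
by rewrite !size_conditions // !fat_degE.
Qed.
End QuadricExceptions.

(** * Exceptions with six 5-points *)

Section CremonaExceptions.
Variable K : fieldType.
Hypothesis charK : [pchar K] =i pred0.

Lemma inj_mults_count d ms : inj_mults K d ms -> (size (monomials d) <= size (conditions ms))%N.
Proof. by case=> A _ /eqP<-; apply: rank_leq_col. Qed.

(** Three transformations: (9; 5^6) to (7; 3^4, 5^2), then based at 3, 3, 5, 5 to (5; 1^2, 3^4),
    then to (3; 1^6). The other points keep their multiplicities. *)
Lemma inj_mults_six_5 rest : inj_mults K 9 ([:: 5; 5; 5; 5; 5; 5]%N ++ rest) ->
  inj_mults K 3 ([:: 1; 1; 1; 1; 1; 1]%N ++ rest).
Proof.
move=> I9.
have I7 := inj_mults_cremona charK (n := 7) (m0 := 3) (m1 := 3) (m2 := 3) (m3 := 3)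
  (rest := [:: 5, 5 & rest]%N) I9.
have {}I7 : inj_mults K 7 ([:: 3; 3; 5; 5; 3; 3]%N ++ rest).
  by apply: inj_mults_perm I7; rewrite -[X in perm_eq X _]/([:: 3; 3; 3; 3; 5; 5]%N ++ rest) perm_cat2r.
have I5 := inj_mults_cremona charK (n := 5) (m0 := 1) (m1 := 1) (m2 := 3) (m3 := 3)
  (rest := [:: 3, 3 & rest]%N) I7.
have {}I5 : inj_mults K 5 ([:: 3; 3; 3; 3; 1; 1]%N ++ rest).
  by apply: inj_mults_perm I5; rewrite -[X in perm_eq X _]/([:: 1; 1; 3; 3; 3; 3]%N ++ rest) perm_cat2r.
exact: (inj_mults_cremona charK (n := 3) (m0 := 1) (m1 := 1) (m2 := 1) (m3 := 1)
  (rest := [:: 1, 1 & rest]%N) I5).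
Qed.

(** In degree 3 only 6 + 12 = 18 conditions are imposed on 20 coefficients. *)
Lemma not_inj_6003 : ~ inj_mults K 9 (mults 6 0 0 3).
Proof. by move=> /(inj_mults_six_5 (rest := [:: 2; 2; 2]%N))/inj_mults_count; rewrite size_conditions // fat_degE. Qed.

(** In degree 3 there are 20 conditions on 20 coefficients, so counting does not decide yet. One
    more transformation, based at the 3-point, the 2-point and two simple points, leads to quadrics
    with one 2-point and five simple points: 9 conditions on 10 coefficients. *)
Lemma not_inj_6011 : ~ inj_mults K 9 (mults 6 0 1 1).
Proof.
move=> /(inj_mults_six_5 (rest := [:: 3; 2]%N)) I3.
have {}I3 : inj_mults K 3 [:: 3; 2; 1; 1; 1; 1; 1; 1]%N by apply: inj_mults_perm I3.
have /inj_mults_count := inj_mults_cremona charK (n := 2) (m0 := 2) (m1 := 1) (m2 := 0) (m3 := 0)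
  (rest := [:: 1; 1; 1; 1]%N) I3.
by rewrite size_conditions // fat_degE.
Qed.
End CremonaExceptions.

(** * Exceptions caused by the twisted cubic *)

Section CurveEvaluation.
Variables (K : fieldType) (c : 'I_4 -> {poly K}).
Implicit Types (f : {mpoly K[4]}) (v : 'rV[K]_4).
Local Notation ev := (mmap (@polyC K) c).

Lemma size_on_curve f d n : f \is d.-homog -> (forall j, size (c j) <= n.+1)%N ->
  (size (ev f) <= (d * n).+1)%N.
Proof.
move=> /dhomogP fh cn; rewrite /mmap big_seq; apply: (big_ind (fun p : {poly K} => size p <= (d * n).+1)%N).
- by rewrite size_poly0.
- by move=> p q sp sq; apply: leq_trans (size_polyD _ _) _; rewrite geq_max sp.
move=> a af; rewrite mul_polyC; apply: leq_trans (size_scale_leq _ _) _.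
have ad : mdeg a = d := fh _ af.
rewrite -ad mdegE big_distrl /= /mmap1.
apply: (big_ind2 (fun (p : {poly K}) e => size p <= e.+1)%N) => [|p e q e' sp sq|i _].
- by rewrite size_poly1.
- apply: leq_trans (size_polyMleq _ _) _; rewrite -ltnS (leq_trans (leqSpred _)) //; lia.
apply: leq_trans (size_poly_exp_leq _ _) _; rewrite ltnS mulnC leq_mul2l.
by apply/orP; right; have := cn i; case: (size (c i)).
Qed.

Definition curve_var v j : {poly K} := c j - (v 0 j / v 0 ord0) *: c ord0.

Lemma on_curve_taylor f d v : f \is d.-homog -> v 0 ord0 != 0 ->
  ev f = \sum_(p : {ffun 'I_4 -> 'I_d.+1} | p ord0 == ord0)
    (vshift v f)@_(mnm_of_ffun p) *: (((v 0 ord0)^-1 *: c ord0) ^+ (d - mdeg (mnm_of_ffun p))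
      * \prod_j curve_var v j ^+ p j).
Proof.
move=> fh v0; rewrite [in LHS](homog_taylor fh (v := fun j => v 0 j) v0) raddf_sum.
apply: eq_bigr => p _ /=; rewrite mmapZ mul_polyC; congr (_ *: _).
rewrite rmorphM rmorphXn rmorph_prod /= mmapZ mmapX mmap1U mul_polyC.
congr (_ * _); apply: eq_bigr => j _.
by rewrite rmorphXn /= mmapB mmapZ !mmapX !mmap1U mul_polyC.
Qed.

Lemma root_curve_var v j t l : (forall j, (c j).[t] = l * v 0 j) -> v 0 ord0 != 0 ->
  ('X - t%:P) %| curve_var v j.
Proof.
move=> ct v0; rewrite dvdp_XsubCl /root /curve_var hornerD hornerN hornerZ !ct.
by rewrite mulrCA divfK // subrr.
Qed.

Lemma on_curve_order f d m v t l : f \is d.-homog -> v 0 ord0 != 0 ->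
  (forall j, (c j).[t] = l * v 0 j) -> jets_vanish m v f -> ('X - t%:P) ^+ m %| ev f.
Proof.
move=> fh v0 ct jf; rewrite (on_curve_taylor fh v0).
apply: (big_ind (fun q => ('X - t%:P) ^+ m %| q)); [exact: dvdp0 | by move=> *; apply: dvdp_add | move=> p /eqP p0].
case: (ltnP (mdeg (mnm_of_ffun p)) m) => [pm|mp].
  by rewrite jf ?scale0r ?dvdp0 // mnmE p0.
rewrite -mul_polyC; apply/dvdp_mull/dvdp_mull.
apply: dvdp_trans (dvdp_exp2l _ mp) _; rewrite mdegE -prodrXr.
apply: (big_ind2 (fun p q : {poly K} => p %| q)) => [||j _]; first exact: dvdpp.
  by move=> *; apply: dvdp_mul.
by rewrite mnmE; apply: dvdp_exp2r; apply: root_curve_var ct v0.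
Qed.

(** If the 4-jet of [f] at [v] is the cube of the first local coordinate, then on the curve [f]
    agrees modulo t^4 with the cube of that coordinate times a function that is non-zero at t = 0.
    The coordinate has a simple zero there, so [f] does not vanish identically on the curve. *)
Lemma on_curve_leading f v l : f \is 9.-homog -> v 0 ord0 != 0 -> l != 0 ->
  (forall j, (c j).[0] = l * v 0 j) -> (curve_var v (inord 1))^`().[0] != 0 ->
  (forall b : 'X_{1..4}, b ord0 = 0%N -> (mdeg b < 4)%N ->
     (vshift v f)@_b = (b == [multinom (if j == inord 1 :> 'I_4 then 3 else 0)%N | j < 4])%:R) ->
  ev f != 0.
Proof.
move=> fh v0 l0 c0 d0 jf; apply/eqP => f0.
pose p1 : {ffun 'I_4 -> 'I_10} := [ffun j => if j == inord 1 then inord 3 else ord0].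
have neq1 : ord0 == inord 1 :> 'I_4 = false by rewrite -val_eqE /= inordK.
have E p : mnm_of_ffun p = [multinom (if j == inord 1 :> 'I_4 then 3 else 0)%N | j < 4] -> p = p1.
  move=> /mnmP E; apply/ffunP => j; apply: val_inj; have := E j; rewrite !mnmE ffunE /= => ->.
  by case: ifP => _; rewrite ?inordK.
have p1E : mnm_of_ffun p1 = [multinom (if j == inord 1 :> 'I_4 then 3 else 0)%N | j < 4].
  by apply/mnmP => j; rewrite !mnmE ffunE; case: ifP => _; rewrite ?inordK.
have m1 : mdeg (mnm_of_ffun p1) = 3%N.
  by rewrite p1E mdegE (bigD1 (inord 1)) //= mnmE eqxx big1 ?addn0 // => j /negPf j1; rewrite mnmE j1.
have yX j : 'X %| curve_var v j by have := root_curve_var j c0 v0; rewrite subr0.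
pose t (p : {ffun 'I_4 -> 'I_10}) := (vshift v f)@_(mnm_of_ffun p) *: (((v 0 ord0)^-1 *: c ord0) ^+ (9 - mdeg (mnm_of_ffun p))
      * \prod_j curve_var v j ^+ p j).
have t1 : t p1 = ((v 0 ord0)^-1 *: c ord0) ^+ 6 * curve_var v (inord 1) ^+ 3.
  rewrite /t jf ?m1 ?p1E ?eqxx ?scale1r ?mnmE ?neq1 //; congr (_ * _).
  rewrite (bigD1 (inord 1)) //= ffunE eqxx inordK // big1 ?mulr1 // => j /negPf j1.
  by rewrite ffunE j1 expr0.
have : 'X ^+ 4 %| ev f - t p1.
  rewrite (on_curve_taylor fh v0) (bigD1 p1) /=; last by rewrite ffunE neq1.
  rewrite -/(t p1) addrAC subrr add0r; apply: (big_ind (fun q : {poly K} => 'X ^+ 4 %| q)); [exact: dvdp0 | by move=> *; apply: dvdp_add | move=> p /andP[/eqP p0 pp1]].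
  case: (ltnP (mdeg (mnm_of_ffun p)) 4) => [p4|p4].
    rewrite jf //; last by rewrite mnmE p0.
    by rewrite (_ : _ == _ = false) ?scale0r ?dvdp0 //; apply: contraNF pp1 => /eqP/E->.
  rewrite -mul_polyC; apply/dvdp_mull/dvdp_mull.
  apply: dvdp_trans (dvdp_exp2l _ p4) _; rewrite mdegE -prodrXr.
  apply: (big_ind2 (fun p q : {poly K} => p %| q)) => [||j _]; first exact: dvdpp.
    by move=> *; apply: dvdp_mul.
  by rewrite mnmE; apply: dvdp_exp2r.
rewrite f0 sub0r dvdpNr t1.
have /dvdpP[y yE] := yX (inord 1).
rewrite yE exprMn mulrA exprS dvdp_mul2r ?expf_neq0 ?polyX_eq0 //.
rewrite -['X]subr0 dvdp_XsubCl /root hornerM !horner_exp hornerZ c0.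
move: d0; rewrite yE derivM derivX mulr1 hornerD hornerM hornerX mulr0 add0r => y0.
by apply/negP; rewrite mulf_neq0 ?expf_neq0 // mulf_neq0 ?mulf_neq0 ?invr_eq0.
Qed.
End CurveEvaluation.

(* The twisted cubic through six points; the parameters of the fifth and the sixth are 1 and 0. *)
Section TwistedCubic.
Variable R : comNzRingType.
Implicit Types A : 'M[R]_(4 + 2, 4).

Local Notation a A k := (basis_coords A ord0 k).
Local Notation b A k := (basis_coords A ord_max k).

Definition cubic_factor A k : {poly R} := (a A k)%:P + (b A k - a A k) *: 'X.

(** Up to a common factor its coordinates in the basis are a_k b_k / ((1 - t) a_k + t b_k): the
    image under the standard Cremona transformation of the line joining the images of the sixth and
    the fifth point. *)
Definition twisted_cubic A j : {poly R} :=
  \sum_(k < 4) (usubmx A k j * a A k * b A k) *: \prod_(l < 4 | l != k) cubic_factor A l.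

(** Up to a non-zero factor, the derivative of X_1 / X_0 along the curve at the sixth point, as
    needed for [on_curve_leading]. *)
Definition cubic_tangent A : R :=
  A ord_max ord0 * (twisted_cubic A (inord 1))^`().[0]
  - A ord_max (inord 1) * (twisted_cubic A ord0)^`().[0].

(** The factors say that the first four points form a basis, that the parameters a_k / (a_k - b_k)
    of these points exist and differ from 0, 1 and each other, and that X_1 / X_0 is a local
    parameter at the sixth point. *)
Definition cubic_generic A : R :=
  \det (usubmx A) * \prod_(k < 4) (a A k * b A k * (a A k - b A k))
  * \prod_(p : 'I_4 * 'I_4 | p.1 != p.2) (a A p.1 * b A p.2 - a A p.2 * b A p.1)
  * cubic_tangent A.
End TwistedCubic.

Section MapTwistedCubic.
Variables (R S : comNzRingType) (phi : {rmorphism R -> S}).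

Lemma map_coords (A : 'M[R]_(4 + 2, 4)) i k :
  phi (basis_coords A i k) = basis_coords (map_mx phi A) i k.
Proof. by rewrite -map_basis_coords [RHS]mxE. Qed.

Lemma map_twisted_cubic A j : map_poly phi (twisted_cubic A j) = twisted_cubic (map_mx phi A) j.
Proof.
rewrite rmorph_sum; apply: eq_bigr => k _ /=.
rewrite map_polyZ !rmorphM !map_coords rmorph_prod; congr (_ * _ * _ *: _); first by rewrite !mxE.
apply: eq_bigr => l _ /=; rewrite /cubic_factor rmorphD /= map_polyC map_polyZ map_polyX.
by rewrite rmorphB /= !map_coords.
Qed.

Lemma map_cubic_generic A : phi (cubic_generic A) = cubic_generic (map_mx phi A).
Proof.
rewrite !rmorphM !rmorph_prod /= -det_map_mx map_usubmx; congr (_ * _ * _ * _).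
- by apply: eq_bigr => k _; rewrite !rmorphM rmorphB !map_coords.
- by apply: eq_bigr => p _; rewrite rmorphB !rmorphM !map_coords.
rewrite rmorphB !rmorphM /= -!horner_map /= rmorph0 -!deriv_map !map_twisted_cubic.
by rewrite /cubic_tangent; congr (_ * _ - _ * _); rewrite [RHS]mxE.
Qed.
End MapTwistedCubic.

Section Exception51.
Variable K : fieldType.
Hypothesis charK : [pchar K] =i pred0.
Implicit Types A : 'M[K]_(4 + 2, 4).

Lemma cubic_generic_poly : exists2 G : {mpoly K[(4 + 2) * 4]}, G != 0 &
  forall A, eval_mx A G = cubic_generic A.
Proof.
exists (cubic_generic (gen_mx K (4 + 2))); last first.
  by move=> A; rewrite /eval_mx map_cubic_generic; congr cubic_generic; apply: map_gen.
(* The unit vectors, (1, 1, 1, 1) and (2, 3, 4, 5); the tangent number will be -6. *)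
pose A1 : 'M[K]_(4 + 2, 4) := col_mx 1%:M (\matrix_(i, j) (if i == ord0 then 1 else j.+2%:R)).
apply: (evalP_neq0 (A := A1)).
have -> : eval_mx A1 (cubic_generic (gen_mx K (4 + 2))) = cubic_generic A1.
  by rewrite /eval_mx map_cubic_generic; congr cubic_generic; apply: map_gen.
have uA : usubmx A1 = 1%:M by apply: col_mxKu.
have aE k : basis_coords A1 ord0 k = 1.
  by rewrite /basis_coords uA adj1 mulmx1 col_mxKd mxE.
have bE k : basis_coords A1 ord_max k = k.+2%:R.
  by rewrite /basis_coords uA adj1 mulmx1 col_mxKd mxE.
have natr0 n : (n.+1)%:R != 0 :> K by rewrite ((pcharf0P K).1 charK).
rewrite /cubic_generic uA det1 mul1r !mulf_neq0 //.
- apply/prodf_neq0 => k _; rewrite aE bE mul1r mulf_neq0 // subr_eq0.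
  by rewrite (inj_eq (natr_inj_pchar0 charK) 1%N k.+2).
- apply/prodf_neq0 => -[k l] /= kl; rewrite !aE !bE !mul1r subr_eq0.
  apply: contra kl => /eqP/(natr_inj_pchar0 charK)[E]; apply/eqP; exact: esym (val_inj E).
have tE j : twisted_cubic A1 j = j.+2%:R *: \prod_(l < 4 | l != j) (1 + l.+1%:R *: 'X).
  rewrite /twisted_cubic uA (bigD1 j) //= [X in _ + X]big1 ?addr0 => [|k kj]; last first.
    by rewrite mxE (negPf kj) !mul0r scale0r.
  rewrite mxE eqxx !mul1r aE mul1r bE; congr (_ *: _); apply: eq_bigr => l _.
  by rewrite /cubic_factor aE bE -[1 in LHS]/(1%:R) -natrB.
have AE j : A1 ord_max j = j.+2%:R.
  by have := bE j; rewrite /basis_coords uA adj1 mulmx1 mxE => <-; congr (A1 _ _); apply: val_inj.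
have i1 : inord 1 = lift ord0 ord0 :> 'I_4 by apply: val_inj; rewrite /= inordK.
have dE j : (twisted_cubic A1 j)^`().[0] = j.+2%:R * \sum_(l < 4 | l != j) l.+1%:R.
  rewrite tE derivZ hornerZ; congr (_ * _).
  (* For factors with constant term 1 the derivatives at 0 simply add up in a product. *)
  pose jet (p : {poly K}) s := p.[0] = 1 /\ p^`().[0] = s.
  suff [] : jet (\prod_(l < 4 | l != j) (1 + l.+1%:R *: 'X)) (\sum_(l < 4 | l != j) l.+1%:R) by [].
  apply: (big_ind2 jet) => [|p s q t [p0 p1] [q0 q1]|l _]; rewrite /jet.
  - by rewrite derivC !hornerC.
  - by rewrite derivM hornerD !hornerM p0 p1 q0 q1 !mulr1 mul1r.
  by rewrite derivD derivZ derivX derivC !hornerD !hornerZ hornerX !hornerC mulr0 addr0 add0r mulr1.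
rewrite /cubic_tangent !AE !dE i1 /=.
have -> : \sum_(l < 4 | l != ord0) l.+1%:R = 9%:R :> K.
  by rewrite big_mkcond !big_ord_recl big_ord0 /= /bump /=; ring.
have -> : \sum_(l < 4 | l != lift ord0 ord0) l.+1%:R = 8%:R :> K.
  by rewrite big_mkcond !big_ord_recl big_ord0 /= /bump /=; ring.
have -> : 2 * ((bump 0 0).+2%:R * 8%:R) - (bump 0 0).+2%:R * (2 * 9%:R) = - 6%:R :> K.
  by rewrite /bump /=; ring.
by rewrite oppr_eq0.
Qed.

Lemma root_count (s : seq (K * nat)) (h : {poly K}) : h != 0 -> uniq [seq x.1 | x <- s] ->
  (forall x, x \in s -> ('X - x.1%:P) ^+ x.2 %| h) -> (\sum_(x <- s) x.2 < size h)%N.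
Proof.
move=> h0 us sh.
have P0 (s' : seq (K * nat)) : \prod_(x <- s') ('X - x.1%:P) ^+ x.2 != 0.
  by rewrite prodf_seq_neq0; apply/allP => y _; rewrite expf_neq0 // polyXsubC_eq0.
have -> : (\sum_(x <- s) x.2)%N = (size (\prod_(x <- s) ('X - x.1%:P) ^+ x.2)).-1.
  elim: s {us sh} => [|x s IHs]; first by rewrite !big_nil size_poly1.
  rewrite !big_cons IHs size_mul ?size_exp_XsubC ?P0 ?expf_neq0 ?polyXsubC_eq0 //.
  by have := P0 s; rewrite -size_poly_eq0; case: (size _) => // n _; lia.
have : \prod_(x <- s) ('X - x.1%:P) ^+ x.2 %| h.
  elim: s us sh => [|x s IHs] /=; first by rewrite big_nil dvd1p.
  move=> /andP[xs us] sh; rewrite big_cons Gauss_dvdp; last first.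
    apply: coprimep_expl; rewrite coprimep_sym coprimep_XsubC /root horner_prod.
    rewrite prodf_seq_neq0; apply/allP => y ys /=.
    rewrite horner_exp hornerXsubC expf_neq0 // subr_eq0.
    by apply: contraNneq xs => ->; apply: map_f.
  rewrite sh ?mem_head //= IHs // => y ys.
  by apply: sh; rewrite inE ys orbT.
move/(dvdp_leq h0); apply: leq_trans.
by rewrite prednK // size_poly_gt0.
Qed.

Lemma coords_spec A i j :
  \sum_k usubmx A k j * basis_coords A i k = \det (usubmx A) * A (rshift 4 i) j.
Proof.
transitivity ((basis_coords A *m usubmx A) i j).
  by rewrite mxE; apply: eq_bigr => k _; rewrite mulrC.
by rewrite /basis_coords -mulmxA mul_adj_mx mul_mx_scalar mxE [X in _ * X]mxE.
Qed.

Lemma twisted_cubic_0 A j : (twisted_cubic A j).[0] =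
  (\det (usubmx A) * \prod_k basis_coords A ord0 k) * A (rshift 4 ord_max) j.
Proof.
rewrite mulrAC -coords_spec horner_sum mulr_suml; apply: eq_bigr => k _.
rewrite hornerZ horner_prod [in RHS](bigD1 k) //=.
rewrite (eq_bigr (fun l => basis_coords A ord0 l)); first by ring.
by move=> l _; rewrite hornerD hornerZ hornerX hornerC mulr0 addr0.
Qed.

Lemma twisted_cubic_1 A j : (twisted_cubic A j).[1] =
  (\det (usubmx A) * \prod_k basis_coords A ord_max k) * A (rshift 4 ord0) j.
Proof.
rewrite mulrAC -coords_spec horner_sum mulr_suml; apply: eq_bigr => k _.
rewrite hornerZ horner_prod [in RHS](bigD1 k) //=.
rewrite (eq_bigr (fun l => basis_coords A ord_max l)); first by ring.
by move=> l _; rewrite hornerD hornerZ hornerX hornerC mulr1 addrC subrK.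
Qed.

Lemma twisted_cubic_root A k t : (cubic_factor A k).[t] = 0 ->
  exists s, forall j, (twisted_cubic A j).[t] = s * A (lshift 2 k) j.
Proof.
move=> t0; exists (basis_coords A ord0 k * basis_coords A ord_max k *
  (\prod_(l < 4 | l != k) cubic_factor A l).[t]) => j.
rewrite horner_sum (bigD1 k) //= [X in _ + X]big1 ?addr0 => [|l lk].
  rewrite hornerZ (_ : usubmx A k j = A (lshift 2 k) j); last by rewrite mxE.
  by ring.
by rewrite hornerZ horner_prod (bigD1 k) 1?eq_sym //= t0 mul0r mulr0.
Qed.

Lemma size_twisted_cubic A j : (size (twisted_cubic A j) <= 4)%N.
Proof.
apply: leq_trans (size_sum _ _ _) _; apply/bigmax_leqP => k _.
apply: leq_trans (size_scale_leq _ _) _.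
have : (size (\prod_(l < 4 | l != k) cubic_factor A l)%R <= (\sum_(l < 4 | l != k) 1).+1)%N.
  apply: (big_rec2 (fun (p : {poly K}) e => size p <= e.+1)%N) => [|l p e _ sp].
    by rewrite size_poly1.
  have s2 : (size (cubic_factor A l) <= 2)%N.
    apply: leq_trans (size_polyD _ _) _; rewrite geq_max (leq_trans (size_polyC_leq1 _)) //=.
    by apply: leq_trans (size_scale_leq _ _) _; rewrite size_polyX.
  by apply: leq_trans (size_polyMleq _ _) _; rewrite -subn1 leq_subLR (leq_trans (leq_add s2 sp)) //; lia.
by rewrite sum1_card cardC1 card_ord.
Qed.
(** Surjectivity would give a form of degree 9 with five 5-fold points whose 4-jet at the sixth
    point is the cube of a local coordinate. Restricted to the cubic it is non-zero of degree at
    most 27, but has five zeros of order 5 and one of order 3, which makes 28. *)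
Lemma not_surj_51 : ~ surj_mults K 9 [:: 5; 5; 5; 5; 5; 4]%N.
Proof.
set ms := [:: 5; 5; 5; 5; 5; 4]%N; case=> A0 A00 A0f.
have [G G0 GE] := cubic_generic_poly.
have [A [Af AG]] := row_full_exists charK A0f (mulf_neq0 (torus_poly_neq0 K ms) G0).
move: AG; rewrite /eval_mx rmorphM mulf_eq0 negb_or /= -!/(eval_mx _ _) eval_torus GE.
case/andP=> /'forall_forallP At; rewrite /cubic_generic.
rewrite 3!mulf_eq0 !negb_or => /andP[/andP[/andP[d0 /prodf_neq0 ab0] /prodf_neq0 ratio] tan].
pose a k := @basis_coords _ 2 A ord0 k; pose b k := @basis_coords _ 2 A ord_max k.
have {}ab0 k : [/\ a k != 0, b k != 0 & a k != b k].
  by have := ab0 k isT; rewrite !mulf_eq0 !negb_or subr_eq0 => /andP[/andP[]].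
have {}ratio k l : k != l -> a k * b l != a l * b k.
  by move=> kl; have := ratio (k, l) kl; rewrite subr_eq0.
pose e1 : 'X_{1..4} := [multinom (if j == inord 1 :> 'I_4 then 3 else 0)%N | j < 4].
have me1 : mdeg e1 = 3%N.
  by rewrite mdegE (bigD1 (inord 1)) //= mnmE eqxx big1 ?addn0 // => j /negPf j1; rewrite mnmE j1.
have /jets_surj_row_full/(_ (fun i x => ((i == ord_max) && (x == e1))%:R))[f fh fj] := Af.
have c0 := @twisted_cubic_0 A; have c1 := @twisted_cubic_1 A.
pose h := mmap (@polyC K) (@twisted_cubic K A) f.
have r0 (i : 'I_6) : (row i A) 0 ord0 != 0 by rewrite mxE At.
have i5E : @rshift 4 2 ord_max = ord_max by apply: val_inj.
have h0 : h != 0.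
  apply: (@on_curve_leading K (@twisted_cubic K A) f (row (@rshift 4 2 ord_max) A) (\det (@usubmx _ 4 2 _ A) * \prod_k a k) fh (r0 (@rshift 4 2 ord_max))).
  - by rewrite mulf_neq0 //; apply/prodf_neq0 => k _; case: (ab0 k).
  - by move=> j; rewrite c0 [in RHS]mxE.
  - rewrite /curve_var derivB derivZ hornerD hornerN hornerZ subr_eq0.
    have v0 := At (@rshift 4 2 ord_max) ord0; rewrite i5E.
    apply: contra tan => /eqP E; rewrite /cubic_tangent E !mxE.
    rewrite mulrCA mulrA divfK ?subrr //; exact: At.
  by move=> x x0 x4; rewrite i5E (fj ord_max) // eqxx.
have jv (i : 'I_6) : i != ord_max -> jets_vanish 5 (row i A) f.
  move=> i5 x x0 xm; rewrite fj // ?(negPf i5) //.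
  by case: i i5 xm => [[|[|[|[|[|[|]]]]]] Hi].
have jv5 : jets_vanish 3 (row ord_max A) f.
  move=> x x0 xm; rewrite fj //; last by apply: leq_trans xm _.
  by rewrite eqxx /=; case: eqP => // E; rewrite E me1 in xm.
have tauE k : (cubic_factor A k).[a k / (a k - b k)] = 0.
  have [_ _] := ab0 k; rewrite -subr_eq0 => abk.
  rewrite /cubic_factor hornerD hornerZ hornerX hornerC -opprB mulNr -/(a k) -/(b k).
  by rewrite mulrCA divff // mulr1 subrr.
pose s := [:: (0, 3%N); (1, 5%N)] ++ [seq (a k / (a k - b k), 5%N) | k <- enum 'I_4].
have us : uniq [seq x.1 | x <- s].
  rewrite map_cat -map_comp /= inE; apply/and3P; split.
  - rewrite negb_or eq_sym oner_eq0 /=; apply/mapP => -[k _ /esym/eqP].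
    by have [a0 _ ab] := ab0 k; rewrite mulf_eq0 invr_eq0 subr_eq0 (negPf a0) (negPf ab).
  - apply/mapP => -[k _ /esym/eqP]; have [_ b0] := ab0 k; rewrite -subr_eq0 => ab.
    by rewrite -(inj_eq (mulIf ab)) divfK // mul1r -subr_eq0 opprB addrC subrK (negPf b0).
  rewrite map_inj_uniq ?enum_uniq // => k l /eqP.
  have [_ _] := ab0 k; have [_ _] := ab0 l; rewrite -!(subr_eq0 (a _)) => abl abk.
  rewrite eqr_div // !mulrBr (mulrC (a l) (a k)) (inj_eq (addrI _)) eqr_opp => /eqP E.
  by apply/eqP; apply: contraT => /ratio; rewrite E eqxx.
have sh x : x \in s -> ('X - x.1%:P) ^+ x.2 %| h.
  rewrite mem_cat !inE -orbA => /or3P[/eqP->|/eqP->|/mapP[k _ ->]].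
  - apply: (on_curve_order fh (r0 ord_max) _ jv5) => j.
    by rewrite c0 mxE i5E.
  - apply: (on_curve_order fh (r0 (@rshift 4 2 ord0)) _ (jv (@rshift 4 2 ord0) isT)) => j.
    by rewrite c1 mxE.
  have [t tE] := twisted_cubic_root (tauE k).
  have k5 : @lshift 4 2 k != ord_max by case: (k) => [[|[|[|[|]]]]].
  by apply: (on_curve_order fh (r0 (@lshift 4 2 k)) _ (jv _ k5)) => j; rewrite tE mxE.
have := root_count h0 us sh; have := size_on_curve fh (size_twisted_cubic A).
rewrite -/h !big_cons big_map big_enum sum_nat_const card_ord => sz.
by rewrite ltnNge sz.
Qed.
End Exception51.

(** * The certificates in degrees 5, 7 and 9 *)

Definition directions : seq quad :=
  [:: (0, 0, 1, 0); (0, 1, 0, 0); (1, 0, 0, 0); (1, 0, 1, 0); (0, 1, 1, 0); (1, 2, 0, 1); (1, 1,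
  0, 0); (2, 0, 1, 1); (2, 1, 0, 1); (1, 1, 1, 0); (2, 0, 2, 1); (2, 2, 0, 1); (2, 0, 3, 1); (2,
  0, 0, 1); (1, 0, 2, 0); (3, 2, 0, 1); (2, 1, 0, 0); (1, 1, 2, 0); (3, 1, 0, 2); (1, 2, 1, 0)]%N.

Definition axes : seq quad := [:: (1, 0, 0, 0); (0, 1, 0, 0); (0, 0, 1, 0)]%N.

(** Planes are cut out by one fixed direction, lines by one of a few, points on a line by a
    coordinate axis. Positions in [directions] keep the certificates short. *)
Definition cell m (l : nat) (ls : seq nat) : cert -> cert :=
  let dir := nth (0, 0, 0, 0)%N directions in
  Cell m [:: [:: dir l]; [seq dir l' | l' <- ls]; axes].

Definition cert5 : cert := (
  Cut (0, 1, 2, 1) 10 (cell 1 0 [:: 0] NoMore) (Cut (2, 2, 0, 3) 15 (cell 1 0 [:: 0] NoMore) (Cut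
  (1, 3, 4, 0) 18 (cell 2 0 [:: 0] NoMore) (Cut (3, 0, 0, 0) 12 (cell 2 0 [:: 1] NoMore) (Cut (2,
  0, 0, 1) 7 (cell 2 0 [:: 1] NoMore) (Cut (12, 11, 0, 6) 18 (Cut (0, 1, 0, 0) 3 (cell 3 0 [:: 1]
  NoMore) (Cut (4, 0, 1, 2) 11 (cell 3 1 [:: 2] NoMore) (Cut (3, 3, 0, 5) 15 (cell 3 2 [:: 0]
  NoMore) (cell 3 4 [:: 0] NoMore) NoMore) NoMore) NoMore) (cell 2 1 [:: 0] NoMore) NoMore) (Cut
  (4, 2, 0, 0) 12 (cell 3 0 [:: 2] NoMore) (Cut (2, 3, 0, 1) 10 (cell 3 0 [:: 2] NoMore) (Cut (2,
  1, 4, 0) 12 (cell 3 1 [:: 0] NoMore) (Cut (2, 0, 7, 4) 18 (cell 3 1 [:: 0] NoMore) (cell 3 5 [::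
  0] NoMore) NoMore) NoMore) NoMore) NoMore)) NoMore) (Cut (13, 10, 0, 5) 46 (Cut (0, 2, 3, 2) 6
  (cell 3 0 [:: 2] NoMore) (cell 3 0 [:: 1] NoMore) NoMore) (Cut (2, 0, 6, 1) 18 (cell 3 0 [:: 1]
  NoMore) (Cut (3, 1, 0, 2) 9 (cell 3 1 [:: 0] NoMore) (Cut (2, 3, 1, 0) 8 (cell 3 2 [:: 1]
  NoMore) (cell 3 2 [:: 0] NoMore) NoMore) NoMore) NoMore) (Cut (2, 2, 0, 1) 7 (Cut (4, 0, 8, 7)
  21 (cell 3 0 [:: 1] NoMore) (Cut (1, 0, 1, 1) 3 (cell 3 0 [:: 1] NoMore) (cell 3 0 [:: 1]
  NoMore) NoMore) NoMore) (Cut (4, 5, 0, 8) 13 (cell 4 2 [:: 0] NoMore) (cell 3 0 [:: 1] NoMore)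
  NoMore) NoMore))) NoMore) NoMore)%N.

Definition cert7 : cert := (
  Cut (1, 5, 0, 2) 35 (cell 1 0 [:: 0] (cell 2 0 [:: 0] NoMore)) (Cut (2, 0, 0, 0) 12 (cell 2 0
  [:: 1] NoMore) (Cut (0, 0, 0, 1) 3 (cell 5 0 [:: 1] NoMore) (Cut (0, 0, 1, 0) 5 (cell 3 0 [:: 1]
  NoMore) (Cut (3, 0, 4, 2) 17 (Cut (1, 0, 2, 0) 9 (cell 3 0 [:: 1] NoMore) (Cut (3, 0, 13, 6) 44
  (cell 3 14 [:: 0] (Cut (2, 2, 0, 1) 5 (Cut (4, 4, 0, 2) 18 (cell 1 0 [:: 0] NoMore) (Cut (3, 4,
  0, 2) 13 (cell 2 5 [:: 0] NoMore) (cell 2 0 [:: 1] NoMore) NoMore) NoMore) (cell 1 0 [:: 0]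
  NoMore) NoMore)) (cell 3 1 [:: 0] NoMore) (Cut (0, 0, 2, 2) 10 (cell 2 3 [:: 0] NoMore) (Cut (0,
  1, 1, 0) 4 (cell 2 0 [:: 1] NoMore) (Cut (4, 0, 5, 2) 26 (cell 2 0 [:: 1] NoMore) (Cut (0, 0, 4,
  2) 8 (cell 2 1 [:: 0] NoMore) (cell 2 1 [:: 0] NoMore) NoMore) NoMore) NoMore) NoMore)) (Cut
  (12, 3, 0, 7) 34 (Cut (0, 0, 3, 1) 10 (cell 2 0 [:: 1] NoMore) (Cut (0, 10, 1, 5) 17 (cell 2 0
  [:: 1] NoMore) (Cut (0, 10, 6, 6) 22 (cell 2 1 [:: 2] NoMore) (Cut (1, 2, 2, 0) 8 (cell 2 1 [::
  0] NoMore) (cell 2 1 [:: 0] NoMore) NoMore) NoMore) NoMore) NoMore) (Cut (0, 3, 3, 2) 20 (cell 1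
  0 [:: 0] NoMore) (Cut (6, 5, 0, 1) 22 (cell 1 0 [:: 0] NoMore) (Cut (9, 5, 0, 1) 19 (cell 2 0
  [:: 2] NoMore) (cell 2 0 [:: 1] NoMore) NoMore) NoMore) NoMore) NoMore)) (Cut (0, 12, 3, 5) 60
  (cell 3 1 [:: 0] NoMore) (Cut (3, 6, 0, 1) 27 (cell 3 0 [:: 1] NoMore) (Cut (2, 0, 1, 0) 5 (cell
  3 3 [:: 1] NoMore) (cell 3 2 [:: 0] NoMore) (Cut (3, 0, 0, 1) 11 (cell 2 0 [:: 1] NoMore) (Cut
  (2, 1, 0, 1) 8 (cell 2 0 [:: 1] NoMore) (Cut (4, 5, 0, 3) 20 (Cut (10, 0, 3, 6) 25 (cell 2 0 [::
  1] NoMore) (cell 2 0 [:: 1] NoMore) NoMore) (cell 2 0 [:: 1] NoMore) NoMore) NoMore) NoMore))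
  NoMore) NoMore) NoMore) NoMore) NoMore) NoMore) (Cut (2, 1, 0, 1) 13 (cell 2 0 [:: 1] NoMore)
  (Cut (0, 0, 0, 1) 6 (cell 2 0 [:: 1] NoMore) (Cut (0, 1, 0, 0) 5 (cell 3 0 [:: 1] NoMore) (Cut
  (1, 2, 0, 0) 9 (cell 3 0 [:: 1] NoMore) (Cut (0, 0, 2, 0) 6 (cell 5 0 [:: 1] NoMore) (Cut (4, 3,
  0, 2) 24 (cell 2 0 [:: 2] NoMore) (Cut (0, 11, 10, 3) 48 (cell 3 0 [:: 1] NoMore) (Cut (0, 3, 1,
  2) 5 (Cut (6, 4, 0, 2) 28 (cell 3 2 [:: 0] NoMore) (Cut (2, 0, 2, 1) 10 (cell 3 0 [:: 1] NoMore)
  (Cut (0, 0, 1, 1) 5 (cell 3 6 [:: 0] NoMore) (cell 3 2 [:: 0] NoMore) NoMore) NoMore) NoMore)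
  (cell 2 1 [:: 0] NoMore) NoMore) NoMore) (Cut (3, 0, 0, 2) 8 (Cut (0, 4, 5, 7) 24 (Cut (0, 2,
  10, 8) 36 (cell 4 4 [:: 0] NoMore) (cell 3 0 [:: 2] NoMore) NoMore) (Cut (0, 6, 7, 2) 15 (cell 3
  6 [:: 0] NoMore) (cell 3 1 [:: 0] NoMore) NoMore) (Cut (0, 1, 4, 3) 14 (cell 4 4 [:: 0] NoMore)
  (Cut (3, 0, 4, 8) 23 (cell 4 0 [:: 1] NoMore) (cell 3 19 [:: 1] NoMore) NoMore) NoMore)) (cell 3
  0 [:: 1] NoMore) NoMore)) NoMore) NoMore) NoMore) NoMore) (Cut (0, 1, 2, 1) 12 (cell 3 1 [:: 0]
  NoMore) (Cut (1, 0, 0, 0) 3 (cell 5 0 [:: 1] NoMore) (Cut (4, 2, 0, 1) 13 (Cut (2, 1, 0, 0) 7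
  (cell 3 0 [:: 2] NoMore) (cell 3 0 [:: 2] NoMore) NoMore) (Cut (0, 1, 4, 2) 20 (cell 3 0 [:: 1]
  NoMore) (Cut (1, 0, 0, 2) 10 (cell 3 1 [:: 0] NoMore) (Cut (0, 0, 3, 5) 12 (Cut (3, 2, 0, 3) 15
  (cell 3 8 [:: 0] NoMore) (Cut (4, 0, 8, 5) 36 (cell 3 1 [:: 0] NoMore) (cell 3 2 [:: 1] NoMore)
  NoMore) NoMore) (cell 3 2 [:: 1] NoMore) NoMore) NoMore) (Cut (1, 0, 10, 4) 38 (cell 4 0 [:: 1]
  NoMore) (Cut (6, 6, 5, 0) 34 (cell 3 2 [:: 0] NoMore) (Cut (0, 3, 4, 0) 13 (cell 3 2 [:: 4]
  NoMore) (Cut (9, 2, 0, 6) 35 (cell 3 1 [:: 0] NoMore) (cell 3 2 [:: 0] NoMore) NoMore) NoMore)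
  NoMore) NoMore)) NoMore) NoMore) (Cut (0, 0, 0, 2) 8 (cell 4 0 [:: 1] NoMore) (Cut (0, 0, 1, 2)
  6 (cell 5 1 [:: 2] NoMore) (Cut (0, 4, 2, 2) 20 (Cut (0, 3, 1, 1) 18 (cell 2 0 [:: 1] NoMore)
  (Cut (1, 7, 4, 0) 35 (cell 3 1 [:: 0] NoMore) (cell 2 1 [:: 0] NoMore) NoMore) NoMore) (Cut (0,
  4, 2, 2) 12 (Cut (0, 3, 4, 2) 15 (Cut (3, 0, 2, 3) 13 (cell 2 1 [:: 2] NoMore) (cell 3 9 [:: 1]
  NoMore) NoMore) (cell 3 0 [:: 1] NoMore) NoMore) (Cut (6, 0, 1, 0) 36 (cell 2 0 [:: 1] NoMore)
  (Cut (0, 5, 3, 5) 13 (cell 3 7 [:: 1] NoMore) (cell 3 1 [:: 2] NoMore) NoMore) NoMore) NoMore)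
  (Cut (0, 6, 7, 2) 31 (Cut (2, 2, 0, 0) 12 (cell 3 2 [:: 0] NoMore) (Cut (0, 3, 6, 7) 30 (cell 3
  2 [:: 1] NoMore) (cell 3 4 [:: 2] NoMore) NoMore) NoMore) (Cut (1, 0, 0, 0) 4 (cell 4 0 [:: 1]
  NoMore) (Cut (3, 5, 2, 0) 21 (cell 3 0 [:: 1] NoMore) (cell 3 2 [:: 1] NoMore) NoMore) NoMore)
  NoMore)) NoMore) NoMore))))%N.

Definition cert9 : cert := (
  Cut (0, 1, 0, 0) 6 (cell 4 0 [:: 1] NoMore) (Cut (0, 0, 1, 0) 6 (cell 4 0 [:: 1] NoMore) (Cut
  (6, 0, 9, 3) 45 (Cut (2, 3, 0, 1) 14 (cell 4 5 [:: 0] (Cut (0, 11, 1, 5) 24 (cell 2 1 [:: 0]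
  NoMore) (Cut (1, 0, 0, 0) 8 (cell 2 0 [:: 1] NoMore) (Cut (0, 3, 1, 2) 4 (cell 3 1 [:: 0]
  NoMore) (cell 2 0 [:: 0] (Unused NoMore)) NoMore) (Cut (0, 2, 1, 2) 4 (cell 3 1 [:: 0] NoMore)
  (cell 3 0 [:: 1] NoMore) NoMore)) NoMore)) (Cut (2, 1, 1, 0) 11 (cell 4 1 [:: 2] NoMore) (cell 5
  1 [:: 3] (Cut (2, 0, 0, 1) 11 (cell 2 0 [:: 0] (Unused NoMore)) (Cut (0, 0, 2, 1) 11 (cell 4 0
  [:: 1] NoMore) (cell 4 3 [:: 0] NoMore) (Cut (3, 0, 2, 0) 15 (Cut (2, 3, 0, 1) 8 (cell 2 2 [::
  0] NoMore) (Unused NoMore) NoMore) (Cut (0, 2, 0, 1) 5 (cell 4 3 [:: 0] NoMore) (Cut (0, 1, 6,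
  2) 32 (cell 2 0 [:: 1] NoMore) (cell 2 1 [:: 2] NoMore) NoMore) (Cut (0, 1, 0, 0) 3 (cell 2 0
  [:: 1] NoMore) (Cut (2, 2, 0, 1) 6 (Cut (2, 15, 0, 7) 40 (cell 3 10 [:: 0; 1] NoMore) (cell 3 1
  [:: 2] NoMore) NoMore) (cell 2 0 [:: 1] NoMore) NoMore) NoMore)) (Cut (2, 3, 0, 2) 14 (cell 2 0
  [:: 1] NoMore) (Cut (0, 0, 2, 1) 12 (cell 3 0 [:: 1] NoMore) (Cut (0, 5, 2, 2) 19 (cell 3 2 [::
  0] NoMore) (cell 3 0 [:: 1] NoMore) NoMore) NoMore) NoMore))) (Cut (3, 1, 0, 1) 13 (cell 2 0 [::
  1] NoMore) (Cut (4, 2, 0, 2) 12 (cell 4 1 [:: 0] (Cut (2, 1, 5, 0) 26 (cell 2 2 [:: 0] NoMore)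
  (Cut (0, 0, 2, 1) 11 (Cut (0, 5, 3, 2) 19 (cell 2 1 [:: 0] NoMore) (Unused NoMore) NoMore) (cell
  3 0 [:: 1; 2] NoMore) NoMore) (Cut (0, 0, 9, 3) 42 (cell 3 1 [:: 0] NoMore) (cell 3 0 [:: 1]
  NoMore) NoMore))) (Cut (6, 9, 0, 4) 30 (cell 2 0 [:: 1] NoMore) (Cut (0, 0, 4, 2) 26 (cell 2 0
  [:: 1] NoMore) (cell 2 0 [:: 1] NoMore) NoMore) NoMore) (Cut (2, 1, 2, 0) 14 (cell 3 0 [:: 2]
  NoMore) (Cut (2, 0, 7, 4) 38 (cell 4 1 [:: 0] NoMore) (cell 2 0 [:: 1] NoMore) NoMore) (Cut (0,
  0, 2, 1) 12 (cell 3 0 [:: 1] NoMore) (Cut (14, 0, 9, 6) 70 (Cut (0, 5, 6, 0) 18 (cell 3 2 [:: 0]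
  NoMore) (Unused NoMore) NoMore) (cell 3 2 [:: 0] NoMore) NoMore) NoMore))) (Cut (0, 1, 8, 4) 48
  (cell 3 0 [:: 1] NoMore) (Cut (0, 4, 3, 2) 22 (cell 3 2 [:: 0] NoMore) (cell 4 1 [:: 0; 2] (Cut
  (8, 6, 0, 4) 34 (cell 3 1 [:: 0] NoMore) (cell 3 0 [:: 1] NoMore) NoMore)) NoMore) NoMore))))
  (Cut (0, 5, 1, 2) 17 (Cut (1, 1, 1, 0) 6 (cell 3 3 [:: 0] NoMore) (cell 2 0 [:: 0] (Unused
  NoMore)) (Cut (0, 6, 7, 2) 53 (cell 2 0 [:: 1] NoMore) (Cut (0, 1, 2, 1) 13 (cell 2 1 [:: 0]
  NoMore) (cell 2 0 [:: 1] NoMore) NoMore) NoMore)) (Cut (0, 4, 13, 6) 82 (cell 2 0 [:: 1] NoMore)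
  (Cut (8, 8, 0, 3) 43 (cell 3 1 [:: 2] NoMore) (Cut (11, 12, 0, 8) 56 (cell 3 5 [:: 0] NoMore)
  (Cut (5, 4, 0, 3) 20 (cell 3 0 [:: 1] NoMore) (cell 3 0 [:: 1] NoMore) NoMore) NoMore) NoMore)
  NoMore) (Cut (7, 0, 3, 1) 43 (cell 3 1 [:: 2] NoMore) (Cut (4, 2, 0, 2) 16 (Cut (3, 0, 3, 1) 21
  (cell 3 1 [:: 2] NoMore) (cell 3 3 [:: 0] NoMore) NoMore) (Cut (1, 2, 0, 1) 7 (cell 3 0 [:: 1]
  NoMore) (Cut (2, 2, 0, 1) 7 (cell 3 0 [:: 1] NoMore) (cell 3 0 [:: 1] NoMore) NoMore) NoMore)
  NoMore) NoMore))) (Cut (0, 1, 1, 2) 8 (cell 5 1 [:: 3] (Cut (2, 0, 0, 1) 11 (cell 2 0 [:: 0]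
  (Unused NoMore)) (Cut (0, 0, 2, 1) 11 (cell 4 0 [:: 1] NoMore) (cell 4 3 [:: 0] NoMore) (Cut (3,
  0, 2, 0) 15 (Cut (2, 3, 0, 1) 8 (cell 2 2 [:: 0] NoMore) (Unused NoMore) NoMore) (Cut (0, 2, 0,
  1) 5 (cell 4 3 [:: 0] NoMore) (Cut (0, 1, 6, 2) 32 (cell 2 0 [:: 1] NoMore) (cell 2 1 [:: 2]
  NoMore) NoMore) (Cut (0, 1, 0, 0) 3 (cell 2 0 [:: 1] NoMore) (Cut (2, 2, 0, 1) 6 (Cut (2, 15, 0,
  7) 40 (cell 3 10 [:: 0; 1] NoMore) (cell 3 1 [:: 2] NoMore) NoMore) (cell 2 0 [:: 1] NoMore)
  NoMore) NoMore)) (Cut (2, 3, 0, 2) 14 (cell 2 0 [:: 1] NoMore) (Cut (0, 0, 2, 1) 12 (cell 3 0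
  [:: 1] NoMore) (Cut (0, 5, 2, 2) 19 (cell 3 2 [:: 0] NoMore) (cell 3 0 [:: 1] NoMore) NoMore)
  NoMore) NoMore))) (Cut (3, 1, 0, 1) 13 (cell 2 0 [:: 1] NoMore) (Cut (4, 2, 0, 2) 12 (cell 4 1
  [:: 0] (Cut (2, 1, 5, 0) 26 (cell 2 2 [:: 0] NoMore) (Cut (0, 0, 2, 1) 11 (Cut (0, 5, 3, 2) 19
  (cell 2 1 [:: 0] NoMore) (Unused NoMore) NoMore) (cell 3 0 [:: 1; 2] NoMore) NoMore) (Cut (0, 0,
  9, 3) 42 (cell 3 1 [:: 0] NoMore) (cell 3 0 [:: 1] NoMore) NoMore))) (Cut (6, 9, 0, 4) 30 (cell
  2 0 [:: 1] NoMore) (Cut (0, 0, 4, 2) 26 (cell 2 0 [:: 1] NoMore) (cell 2 0 [:: 1] NoMore)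
  NoMore) NoMore) (Cut (2, 1, 2, 0) 14 (cell 3 0 [:: 2] NoMore) (Cut (2, 0, 7, 4) 38 (cell 4 1 [::
  0] NoMore) (cell 2 0 [:: 1] NoMore) NoMore) (Cut (0, 0, 2, 1) 12 (cell 3 0 [:: 1] NoMore) (Cut
  (14, 0, 9, 6) 70 (Cut (0, 5, 6, 0) 18 (cell 3 2 [:: 0] NoMore) (Unused NoMore) NoMore) (cell 3 2
  [:: 0] NoMore) NoMore) NoMore))) (Cut (0, 1, 8, 4) 48 (cell 3 0 [:: 1] NoMore) (Cut (0, 4, 3, 2)
  22 (cell 3 2 [:: 0] NoMore) (cell 4 1 [:: 0; 2] (Cut (8, 6, 0, 4) 34 (cell 3 1 [:: 0] NoMore)
  (cell 3 0 [:: 1] NoMore) NoMore)) NoMore) NoMore)))) (Cut (0, 3, 5, 2) 12 (Cut (0, 4, 11, 6) 56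
  (cell 2 0 [:: 2] NoMore) (Cut (0, 2, 14, 8) 60 (cell 2 0 [:: 2] NoMore) (Cut (2, 0, 6, 4) 32
  (cell 2 1 [:: 0] NoMore) (Cut (0, 4, 3, 3) 13 (cell 3 6 [:: 0] NoMore) (cell 2 0 [:: 1] NoMore)
  NoMore) (Cut (6, 0, 1, 3) 34 (cell 3 1 [:: 0] NoMore) (cell 3 0 [:: 2] NoMore) NoMore)) (Cut (2,
  1, 0, 1) 11 (Cut (0, 3, 2, 1) 6 (cell 3 0 [:: 1] NoMore) (cell 2 0 [:: 0] (Unused NoMore))
  NoMore) (Cut (4, 1, 0, 2) 15 (cell 3 2 [:: 0] NoMore) (Unused NoMore) NoMore) NoMore)) NoMore)
  (Cut (0, 2, 4, 3) 9 (cell 2 0 [:: 1] NoMore) (cell 3 1 [:: 0] NoMore) NoMore) NoMore) (Cut (3,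
  1, 0, 0) 12 (Cut (0, 0, 4, 1) 16 (cell 2 0 [:: 1] NoMore) (Cut (4, 6, 0, 2) 32 (cell 3 5 [:: 0]
  NoMore) (Cut (11, 11, 0, 4) 67 (cell 3 1 [:: 0] NoMore) (Cut (2, 0, 0, 1) 8 (cell 3 0 [:: 1]
  NoMore) (cell 2 0 [:: 0] (Unused NoMore)) NoMore) (Cut (0, 7, 9, 3) 37 (cell 2 0 [:: 2] NoMore)
  (Cut (0, 9, 13, 8) 39 (cell 3 1 [:: 0] NoMore) (Cut (3, 5, 3, 0) 24 (cell 2 0 [:: 1] NoMore)
  (cell 2 0 [:: 1] NoMore) NoMore) NoMore) NoMore)) NoMore) (Cut (0, 2, 7, 2) 25 (cell 3 0 [:: 2]
  NoMore) (Cut (3, 1, 0, 1) 22 (cell 3 0 [:: 1] NoMore) (Cut (7, 4, 6, 0) 52 (cell 3 2 [:: 0]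
  NoMore) (cell 3 1 [:: 0] NoMore) NoMore) NoMore) NoMore)) (Cut (0, 10, 1, 3) 28 (cell 3 3 [:: 0]
  NoMore) (Cut (4, 4, 0, 3) 20 (cell 3 0 [:: 1] NoMore) (Cut (13, 1, 0, 5) 33 (cell 3 0 [:: 1]
  NoMore) (cell 3 0 [:: 1] NoMore) NoMore) NoMore) NoMore) NoMore))) (Cut (6, 0, 6, 3) 27 (Cut (0,
  0, 1, 1) 5 (cell 5 5 [:: 0] NoMore) (cell 5 0 [:: 1] NoMore) (Cut (0, 0, 12, 8) 52 (Cut (7, 10,
  0, 3) 39 (Cut (0, 2, 1, 2) 14 (cell 2 5 [:: 2] NoMore) (cell 2 0 [:: 0] (Unused NoMore)) NoMore)
  (cell 4 5 [:: 0] NoMore) NoMore) (Cut (0, 6, 2, 3) 31 (cell 2 1 [:: 2] NoMore) (Cut (0, 1, 1, 2)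
  8 (cell 4 0 [:: 2] NoMore) (cell 4 0 [:: 2] NoMore) NoMore) NoMore) (Cut (4, 0, 6, 3) 26 (Cut
  (0, 1, 1, 2) 12 (cell 4 5 [:: 0] NoMore) (Cut (7, 0, 8, 5) 44 (cell 4 12 [:: 1] NoMore) (cell 3
  1 [:: 3] NoMore) (Cut (0, 5, 3, 3) 25 (cell 3 3 [:: 1] NoMore) (Cut (0, 0, 0, 1) 3 (cell 3 1 [::
  0] NoMore) (cell 3 1 [:: 0] NoMore) NoMore) NoMore)) (Cut (0, 9, 3, 2) 35 (cell 3 1 [:: 0]
  NoMore) (Cut (1, 3, 0, 2) 16 (cell 3 5 [:: 0] NoMore) (Cut (0, 0, 3, 2) 14 (cell 3 5 [:: 0]
  NoMore) (Cut (7, 0, 6, 1) 37 (cell 3 12 [:: 0] NoMore) (cell 3 5 [:: 2] NoMore) NoMore) NoMore)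
  NoMore) NoMore)) (cell 4 0 [:: 1] NoMore) (Cut (0, 2, 9, 7) 28 (Cut (0, 13, 15, 8) 96 (cell 3 0
  [:: 2] NoMore) (Cut (0, 5, 1, 2) 20 (cell 3 10 [:: 0] NoMore) (Cut (3, 4, 0, 2) 22 (cell 3 0 [::
  1] NoMore) (Cut (2, 15, 0, 8) 58 (cell 3 5 [:: 0] NoMore) (cell 3 10 [:: 0] NoMore) NoMore)
  NoMore) NoMore) NoMore) (Cut (2, 0, 2, 1) 12 (cell 3 0 [:: 1] NoMore) (cell 3 0 [:: 1] NoMore)
  NoMore) NoMore)))) (cell 5 0 [:: 1] NoMore) (Cut (0, 0, 0, 2) 12 (cell 4 0 [:: 1] NoMore) (Cut
  (6, 0, 2, 4) 24 (Cut (1, 5, 0, 7) 37 (cell 4 0 [:: 2] NoMore) (Cut (3, 3, 5, 0) 22 (cell 4 17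
  [:: 0] NoMore) (cell 3 0 [:: 2] NoMore) NoMore) NoMore) (Cut (1, 1, 0, 2) 9 (cell 4 2 [:: 4]
  NoMore) (cell 4 3 [:: 0] NoMore) NoMore) NoMore) (Cut (1, 1, 0, 3) 24 (cell 2 0 [:: 1] NoMore)
  (Cut (8, 7, 2, 0) 25 (Cut (10, 0, 12, 7) 64 (cell 4 12 [:: 1] NoMore) (Cut (5, 0, 8, 3) 30 (cell
  4 1 [:: 14; 0] (Cut (2, 5, 0, 1) 22 (cell 3 9 [:: 1] NoMore) (cell 3 1 [:: 0] NoMore) NoMore))
  (Cut (4, 3, 1, 0) 21 (cell 4 0 [:: 2] NoMore) (cell 4 6 [:: 0] NoMore) NoMore) (Cut (5, 8, 0, 0)
  50 (cell 3 0 [:: 1] NoMore) (Cut (1, 0, 9, 5) 29 (Cut (2, 0, 8, 3) 29 (cell 3 5 [:: 0] NoMore)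
  (cell 3 11 [:: 0] NoMore) NoMore) (Cut (0, 2, 0, 1) 9 (cell 4 0 [:: 1] NoMore) (cell 3 1 [:: 0]
  NoMore) (Cut (2, 9, 0, 5) 53 (cell 3 0 [:: 1] NoMore) (Cut (3, 1, 3, 0) 15 (cell 3 1 [:: 0]
  NoMore) (cell 3 0 [:: 1; 2] NoMore) NoMore) NoMore)) NoMore) NoMore)) (Cut (1, 0, 9, 4) 35 (cell
  3 3 [:: 0] NoMore) (Cut (2, 9, 0, 5) 39 (Cut (0, 6, 0, 4) 38 (cell 3 0 [:: 1] NoMore) (Cut (0,
  7, 2, 5) 33 (Cut (12, 0, 5, 5) 37 (Cut (2, 2, 1, 0) 13 (cell 3 1 [:: 2] NoMore) (cell 3 1 [:: 2]
  NoMore) NoMore) (cell 3 7 [:: 0] NoMore) NoMore) (cell 3 0 [:: 7] NoMore) NoMore) NoMore) (Cut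
  (0, 6, 2, 5) 24 (cell 3 5 [:: 2] NoMore) (cell 3 12 [:: 0] NoMore) NoMore) NoMore) NoMore)) (Cut
  (3, 9, 0, 5) 34 (cell 4 2 [:: 1] NoMore) (cell 2 0 [:: 0] (Unused NoMore)) NoMore) NoMore)
  NoMore))) (Cut (2, 0, 0, 1) 9 (Cut (0, 2, 2, 2) 10 (cell 5 0 [:: 1] NoMore) (cell 5 0 [:: 1]
  (Cut (3, 0, 1, 1) 22 (cell 3 0 [:: 1] NoMore) (Cut (0, 3, 1, 1) 7 (cell 3 0 [:: 1] NoMore) (Cut
  (0, 5, 4, 0) 13 (cell 2 1 [:: 0] NoMore) (Cut (10, 0, 0, 5) 65 (cell 3 0 [:: 1] NoMore) (cell 2
  1 [:: 0] NoMore) NoMore) NoMore) NoMore) NoMore)) (Cut (0, 1, 1, 1) 6 (cell 4 0 [:: 1] NoMore)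
  (Cut (2, 0, 2, 1) 13 (Cut (1, 0, 0, 0) 7 (cell 3 0 [:: 1] NoMore) (Cut (0, 1, 3, 1) 9 (cell 3 1
  [:: 0] NoMore) (Cut (9, 1, 0, 5) 59 (cell 3 0 [:: 1] NoMore) (cell 3 8 [:: 0] NoMore) NoMore)
  NoMore) NoMore) (Cut (8, 8, 8, 0) 72 (cell 2 0 [:: 0] NoMore) (Cut (2, 0, 2, 4) 18 (cell 2 0 [::
  1] NoMore) (cell 2 0 [:: 1] NoMore) NoMore) NoMore) NoMore) (Cut (2, 0, 0, 1) 17 (cell 2 0 [::
  0] (Unused NoMore)) (Cut (0, 2, 2, 3) 19 (cell 3 0 [:: 1] NoMore) (Cut (0, 6, 12, 4) 46 (cell 2
  1 [:: 0] NoMore) (Cut (0, 7, 8, 6) 14 (Cut (0, 0, 1, 3) 12 (cell 3 0 [:: 1] NoMore) (Cut (0, 5,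
  2, 3) 18 (cell 3 0 [:: 1] NoMore) (Cut (0, 12, 4, 7) 31 (cell 3 3 [:: 1] NoMore) (Cut (4, 3, 0,
  7) 34 (cell 3 1 [:: 0] NoMore) (cell 3 4 [:: 0] NoMore) NoMore) NoMore) NoMore) NoMore) (cell 2
  0 [:: 1] NoMore) NoMore) NoMore) NoMore) NoMore))) (Cut (0, 0, 2, 1) 10 (cell 5 0 [:: 1] NoMore)
  (Cut (0, 2, 0, 1) 10 (cell 5 0 [:: 1] NoMore) (Cut (4, 2, 0, 2) 20 (cell 3 8 [:: 0] NoMore) (Cut
  (9, 0, 12, 6) 66 (cell 3 11 [:: 0] NoMore) (Cut (10, 2, 0, 7) 36 (cell 3 0 [:: 1] NoMore) (cell
  3 0 [:: 1] NoMore) NoMore) NoMore) NoMore) NoMore) (Cut (0, 2, 0, 1) 7 (Cut (0, 4, 0, 2) 24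
  (cell 3 0 [:: 1] NoMore) (Cut (4, 0, 4, 3) 25 (cell 3 2 [:: 1] NoMore) (Cut (2, 0, 0, 3) 15
  (cell 3 1 [:: 0] NoMore) (Cut (0, 14, 15, 7) 100 (Cut (8, 0, 14, 7) 58 (cell 3 2 [:: 1] NoMore)
  (cell 3 10 [:: 0] NoMore) NoMore) (Cut (0, 10, 1, 7) 51 (cell 3 0 [:: 2] NoMore) (cell 3 7 [::
  4] NoMore) NoMore) NoMore) (Cut (0, 6, 2, 3) 33 (cell 4 2 [:: 1] NoMore) (Cut (0, 10, 6, 3) 46
  (cell 4 7 [:: 1] NoMore) (cell 3 7 [:: 0] NoMore) NoMore) NoMore)) NoMore) NoMore) (Cut (2, 2,
  0, 1) 7 (Cut (1, 0, 0, 1) 5 (cell 3 4 [:: 0] NoMore) (cell 4 4 [:: 0] NoMore) NoMore) (cell 3 0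
  [:: 1] NoMore) NoMore) (Cut (0, 2, 0, 1) 12 (cell 3 0 [:: 1] NoMore) (Cut (1, 1, 0, 0) 7 (cell 3
  6 [:: 0] NoMore) (Cut (0, 0, 2, 1) 12 (cell 3 0 [:: 1] NoMore) (Cut (1, 6, 0, 3) 19 (Cut (14,
  12, 0, 6) 80 (cell 3 6 [:: 0] NoMore) (Cut (6, 3, 0, 5) 36 (cell 3 0 [:: 1] NoMore) (Cut (1, 0,
  1, 2) 11 (cell 3 0 [:: 1] NoMore) (Cut (2, 3, 0, 1) 15 (cell 3 11 [:: 0] NoMore) (Cut (6, 8, 0,
  5) 38 (cell 3 5 [:: 0] NoMore) (cell 3 0 [:: 1] NoMore) NoMore) NoMore) NoMore) NoMore) NoMore)
  (Cut (0, 3, 10, 5) 51 (cell 3 8 [:: 0] NoMore) (cell 3 8 [:: 0] NoMore) NoMore) NoMore) NoMore)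
  NoMore) NoMore))) (Cut (0, 0, 1, 1) 4 (Cut (2, 2, 0, 1) 8 (Cut (4, 2, 0, 2) 22 (cell 4 0 [:: 1]
  NoMore) (Cut (0, 1, 3, 2) 16 (Cut (5, 1, 0, 5) 25 (cell 4 8 [:: 0] (Cut (7, 7, 0, 3) 29 (Cut (2,
  0, 3, 1) 8 (cell 3 15 [:: 2] NoMore) (Unused NoMore) NoMore) (Cut (3, 3, 0, 1) 10 (Cut (6, 0, 5,
  3) 32 (cell 2 1 [:: 8] NoMore) (Unused NoMore) NoMore) (cell 2 1 [:: 2] NoMore) NoMore) (Cut (3,
  2, 3, 0) 10 (cell 3 0 [:: 1] NoMore) (Cut (3, 3, 0, 2) 19 (cell 2 0 [:: 2] NoMore) (Cut (7, 2,
  0, 4) 32 (cell 2 0 [:: 1] NoMore) (cell 2 2 [:: 0] NoMore) NoMore) NoMore) NoMore))) (cell 4 2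
  [:: 0] NoMore) (Cut (1, 1, 0, 0) 1 (Cut (5, 1, 3, 0) 24 (cell 2 6 [:: 0] NoMore) (Cut (2, 1, 2,
  0) 4 (Cut (1, 0, 0, 5) 22 (cell 3 6 [:: 0] NoMore) (Cut (4, 3, 3, 0) 22 (cell 3 16 [:: 0]
  NoMore) (cell 3 0 [:: 2] NoMore) NoMore) NoMore) (cell 2 0 [:: 2] NoMore) NoMore) NoMore) (cell
  2 0 [:: 0] NoMore) NoMore)) (Cut (15, 16, 0, 8) 87 (cell 4 2 [:: 0] NoMore) (cell 4 11 [:: 0]
  NoMore) NoMore) (Cut (0, 2, 6, 3) 33 (cell 3 2 [:: 0] NoMore) (Cut (8, 7, 0, 4) 43 (cell 4 8 [::
  0] NoMore) (Cut (1, 2, 2, 0) 6 (Cut (1, 0, 0, 2) 10 (cell 3 0 [:: 1] NoMore) (Cut (3, 0, 0, 1)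
  10 (cell 3 1 [:: 0] NoMore) (cell 4 8 [:: 0] NoMore) NoMore) NoMore) (cell 3 1 [:: 0] NoMore)
  NoMore) (Cut (0, 1, 1, 2) 11 (Cut (0, 5, 14, 8) 74 (cell 3 2 [:: 0] NoMore) (Cut (9, 6, 0, 2) 34
  (cell 3 16 [:: 0] NoMore) (Cut (2, 0, 2, 3) 21 (cell 3 8 [:: 0] NoMore) (cell 3 6 [:: 1] NoMore)
  NoMore) NoMore) NoMore) (Cut (0, 4, 11, 5) 54 (cell 3 15 [:: 0; 4] NoMore) (Cut (4, 0, 4, 2) 28
  (cell 3 11 [:: 0] NoMore) (cell 3 2 [:: 0] NoMore) NoMore) NoMore) NoMore)) NoMore)) (Cut (6, 8,
  7, 0) 45 (Cut (1, 3, 0, 2) 9 (Cut (2, 0, 3, 2) 17 (cell 3 5 [:: 0] NoMore) (Cut (5, 1, 6, 0) 27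
  (cell 3 6 [:: 0] NoMore) (cell 3 6 [:: 0] NoMore) NoMore) NoMore) (cell 3 1 [:: 0] NoMore)
  NoMore) (Cut (5, 2, 2, 0) 21 (cell 3 1 [:: 2] NoMore) (Cut (4, 0, 0, 1) 14 (cell 3 0 [:: 1]
  NoMore) (Cut (4, 0, 1, 2) 18 (cell 3 1 [:: 2] NoMore) (Cut (1, 0, 12, 7) 56 (cell 3 1 [:: 2]
  NoMore) (Cut (1, 0, 1, 2) 11 (cell 3 1 [:: 0] NoMore) (cell 3 9 [:: 0] NoMore) NoMore) NoMore)
  NoMore) NoMore) NoMore) NoMore)) (cell 4 0 [:: 1] NoMore) (Cut (0, 0, 0, 1) 7 (cell 3 0 [:: 1]
  NoMore) (Cut (2, 1, 0, 1) 12 (cell 3 0 [:: 1] NoMore) (Cut (1, 2, 0, 1) 12 (cell 3 0 [:: 1]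
  NoMore) (Cut (0, 0, 2, 1) 12 (cell 3 0 [:: 1] NoMore) (Cut (1, 1, 0, 2) 8 (Cut (7, 8, 0, 5) 49
  (cell 3 0 [:: 1] NoMore) (Cut (4, 12, 0, 7) 57 (cell 3 2 [:: 0] NoMore) (Cut (8, 0, 0, 2) 28
  (cell 3 1 [:: 2] NoMore) (Cut (9, 0, 10, 2) 46 (cell 3 2 [:: 0] NoMore) (cell 3 3 [:: 0] NoMore)
  NoMore) NoMore) NoMore) NoMore) (Cut (2, 0, 0, 1) 7 (cell 3 1 [:: 0] NoMore) (Cut (0, 3, 5, 1)
  31 (cell 3 2 [:: 0] NoMore) (cell 3 4 [:: 0] NoMore) NoMore) NoMore) NoMore) NoMore) NoMore)
  NoMore) NoMore)) (Cut (1, 2, 0, 1) 10 (Cut (0, 1, 0, 1) 5 (cell 4 0 [:: 1] NoMore) (cell 4 0 [::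
  1] NoMore) NoMore) (cell 4 1 [:: 0] NoMore) (Cut (0, 1, 0, 1) 6 (cell 3 0 [:: 1] NoMore) (Cut
  (1, 2, 0, 1) 12 (cell 3 0 [:: 1] NoMore) (Cut (0, 9, 4, 4) 31 (cell 3 1 [:: 0] NoMore) (Cut (0,
  1, 0, 1) 3 (cell 3 0 [:: 1] NoMore) (Cut (1, 0, 2, 1) 10 (cell 3 1 [:: 0] NoMore) (cell 3 0 [::
  1] NoMore) NoMore) NoMore) NoMore) NoMore) NoMore)) NoMore))) (Cut (0, 0, 0, 2) 14 (cell 3 0 [::
  1] NoMore) (Cut (1, 1, 0, 1) 5 (Cut (1, 0, 0, 0) 5 (cell 5 0 [:: 1] (Cut (3, 0, 1, 1) 22 (cell 3
  0 [:: 1] NoMore) (Cut (0, 3, 1, 1) 7 (cell 3 0 [:: 1] NoMore) (Cut (0, 5, 4, 0) 13 (cell 2 1 [::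
  0] NoMore) (Cut (10, 0, 0, 5) 65 (cell 3 0 [:: 1] NoMore) (cell 2 1 [:: 0] NoMore) NoMore)
  NoMore) NoMore) NoMore)) (Cut (0, 4, 0, 2) 24 (cell 3 0 [:: 1] NoMore) (Cut (0, 1, 0, 1) 6 (Cut
  (2, 2, 0, 0) 6 (Cut (0, 0, 4, 2) 14 (cell 3 2 [:: 0] NoMore) (Cut (2, 0, 4, 2) 14 (cell 3 0 [::
  1] NoMore) (cell 3 0 [:: 1] NoMore) NoMore) NoMore) (cell 3 2 [:: 0] NoMore) NoMore) (Cut (1, 0,
  0, 1) 5 (cell 5 1 [:: 0] (Cut (4, 0, 6, 3) 29 (Cut (9, 7, 0, 5) 51 (cell 3 2 [:: 0] NoMore) (Cut
  (1, 0, 0, 0) 3 (cell 3 1 [:: 0] NoMore) (cell 3 1 [:: 0] NoMore) NoMore) NoMore) (Cut (5, 7, 0,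
  1) 38 (cell 2 1 [:: 0] NoMore) (cell 2 1 [:: 0] NoMore) NoMore) NoMore)) (cell 5 0 [:: 1]
  NoMore) (Cut (0, 8, 12, 5) 60 (Cut (0, 1, 1, 0) 7 (cell 3 0 [:: 1] NoMore) (Cut (5, 1, 0, 3) 15
  (Cut (5, 6, 5, 0) 30 (Cut (16, 8, 0, 8) 56 (cell 3 2 [:: 0] NoMore) (Unused NoMore) NoMore)
  (cell 2 1 [:: 0] NoMore) NoMore) (cell 2 0 [:: 1] NoMore) NoMore) NoMore) (Cut (0, 8, 6, 4) 38
  (Cut (1, 3, 0, 1) 10 (cell 3 3 [:: 0] NoMore) (Unused NoMore) NoMore) (Cut (2, 0, 3, 1) 17 (cell
  3 0 [:: 1] NoMore) (Cut (8, 0, 6, 4) 48 (cell 3 2 [:: 1] NoMore) (cell 3 2 [:: 0] NoMore)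
  NoMore) NoMore) NoMore) (Cut (0, 1, 5, 3) 32 (cell 2 0 [:: 1] NoMore) (Cut (0, 2, 1, 1) 13 (cell
  2 0 [:: 0] NoMore) (Cut (0, 4, 3, 2) 23 (Cut (0, 2, 2, 1) 14 (cell 3 0 [:: 1] NoMore) (cell 2 4
  [:: 2] NoMore) NoMore) (Cut (0, 1, 1, 0) 3 (Cut (2, 1, 0, 2) 13 (cell 3 2 [:: 0] NoMore) (Cut
  (0, 7, 5, 3) 34 (cell 3 7 [:: 0] NoMore) (Cut (0, 13, 9, 6) 54 (cell 3 13 [:: 0] NoMore) (cell 3
  0 [:: 1] NoMore) NoMore) NoMore) NoMore) (cell 3 1 [:: 0] NoMore) NoMore) NoMore) NoMore)
  NoMore))) (Cut (10, 0, 8, 5) 71 (cell 3 0 [:: 1] (Cut (2, 0, 2, 0) 14 (cell 2 0 [:: 1] NoMore)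
  (Unused NoMore) NoMore)) (Cut (0, 8, 9, 2) 62 (Cut (1, 3, 5, 0) 31 (cell 2 0 [:: 1] NoMore)
  (cell 2 2 [:: 0] NoMore) NoMore) (Cut (13, 0, 5, 7) 54 (Cut (0, 3, 0, 2) 10 (Cut (7, 0, 8, 4) 31
  (cell 5 3 [:: 0] NoMore) (Unused NoMore) NoMore) (Cut (13, 0, 3, 6) 59 (Cut (0, 13, 1, 7) 24
  (cell 3 10 [:: 0] NoMore) (Unused NoMore) NoMore) (cell 3 0 [:: 1; 2] NoMore) NoMore) NoMore)
  (Cut (0, 4, 1, 3) 25 (cell 3 3 [:: 0] NoMore) (Cut (4, 5, 0, 4) 33 (cell 3 0 [:: 2] NoMore) (Cut
  (7, 5, 0, 3) 29 (cell 3 0 [:: 1] NoMore) (cell 3 2 [:: 0] NoMore) NoMore) NoMore) NoMore)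
  NoMore) (Cut (2, 5, 0, 3) 26 (Cut (1, 0, 4, 3) 11 (Cut (9, 0, 4, 4) 35 (cell 3 0 [:: 1] NoMore)
  (Cut (0, 0, 1, 2) 8 (cell 3 1 [:: 2] NoMore) (cell 3 1 [:: 2] NoMore) NoMore) NoMore) (cell 3 3
  [:: 0] NoMore) NoMore) (Cut (2, 1, 1, 0) 9 (Cut (6, 0, 10, 5) 54 (cell 3 10 [:: 1] NoMore) (Cut
  (0, 3, 1, 1) 12 (cell 3 1 [:: 2] NoMore) (cell 3 1 [:: 2] NoMore) NoMore) NoMore) (cell 5 3 [::
  0] NoMore) NoMore) NoMore)) (Cut (0, 11, 2, 3) 62 (cell 2 1 [:: 2] NoMore) (Cut (2, 0, 3, 1) 12
  (Cut (7, 7, 0, 3) 48 (cell 2 2 [:: 0] NoMore) (Cut (0, 1, 2, 3) 15 (cell 5 3 [:: 0] NoMore) (Cut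
  (1, 0, 2, 1) 11 (cell 3 0 [:: 2] NoMore) (Cut (3, 0, 3, 2) 19 (cell 3 2 [:: 1] NoMore) (cell 3 1
  [:: 2] NoMore) NoMore) NoMore) NoMore) (Cut (7, 4, 3, 0) 31 (cell 5 6 [:: 0] NoMore) (cell 5 3
  [:: 0] NoMore) NoMore)) (Cut (5, 5, 0, 2) 32 (Cut (9, 0, 8, 5) 45 (cell 2 0 [:: 1] NoMore) (Cut
  (3, 0, 4, 2) 15 (cell 2 1 [:: 0] NoMore) (cell 3 0 [:: 1] NoMore) NoMore) NoMore) (Cut (6, 0, 4,
  6) 36 (cell 3 1 [:: 0] NoMore) (cell 3 5 [:: 0] NoMore) NoMore) NoMore) NoMore) (Cut (3, 0, 5,
  5) 32 (Cut (0, 4, 1, 4) 27 (cell 3 2 [:: 0] NoMore) (Cut (3, 4, 3, 0) 21 (cell 3 0 [:: 1]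
  NoMore) (Cut (0, 1, 6, 3) 30 (cell 3 0 [:: 1] NoMore) (Cut (2, 3, 0, 1) 12 (cell 3 1 [:: 0]
  NoMore) (cell 3 1 [:: 0] NoMore) NoMore) NoMore) NoMore) NoMore) (Cut (4, 0, 0, 2) 18 (cell 3 0
  [:: 1] NoMore) (Cut (4, 2, 0, 2) 22 (cell 3 8 [:: 0] NoMore) (Cut (0, 3, 5, 2) 26 (Cut (1, 0, 7,
  5) 30 (cell 3 0 [:: 1] NoMore) (cell 3 6 [:: 0] NoMore) NoMore) (Cut (11, 0, 9, 4) 47 (cell 3 1
  [:: 0] NoMore) (cell 3 0 [:: 1; 2] NoMore) NoMore) NoMore) NoMore) NoMore) NoMore)))) NoMore)
  (Cut (2, 0, 7, 5) 28 (Cut (6, 0, 10, 5) 37 (Cut (0, 8, 7, 2) 57 (cell 2 0 [:: 1] NoMore) (Cut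
  (0, 8, 6, 3) 46 (cell 3 1 [:: 0] NoMore) (Cut (2, 0, 2, 1) 13 (Cut (2, 5, 0, 3) 19 (cell 3 1 [::
  0] NoMore) (Cut (0, 3, 2, 3) 16 (cell 3 0 [:: 1] NoMore) (Cut (2, 1, 1, 0) 13 (cell 3 1 [:: 2]
  NoMore) (cell 3 1 [:: 2] NoMore) NoMore) NoMore) NoMore) (Cut (0, 13, 1, 5) 45 (cell 3 1 [:: 0]
  NoMore) (Cut (0, 3, 3, 2) 18 (cell 3 7 [:: 0] NoMore) (cell 3 10 [:: 1] NoMore) NoMore) NoMore)
  NoMore) NoMore) NoMore) (Cut (0, 2, 9, 5) 35 (cell 2 1 [:: 0] NoMore) (Unused NoMore) NoMore)
  (Cut (12, 0, 14, 7) 68 (Cut (0, 1, 6, 3) 21 (Cut (4, 2, 0, 1) 17 (cell 3 1 [:: 2] NoMore) (Cut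
  (2, 0, 2, 1) 14 (cell 3 0 [:: 1] NoMore) (Cut (0, 0, 1, 5) 18 (Cut (2, 0, 5, 3) 29 (cell 3 3 [::
  0] NoMore) (cell 3 1 [:: 0] NoMore) NoMore) (cell 3 0 [:: 1] NoMore) NoMore) NoMore) NoMore)
  (Cut (1, 0, 1, 0) 6 (cell 3 1 [:: 0] NoMore) (cell 3 5 [:: 0] NoMore) NoMore) NoMore) (Cut (0,
  5, 4, 0) 23 (cell 3 2 [:: 1] NoMore) (cell 3 1 [:: 0] NoMore) NoMore) NoMore)) (Cut (0, 3, 4, 1)
  23 (cell 3 1 [:: 0] (Cut (4, 8, 5, 0) 55 (cell 2 0 [:: 1] NoMore) (Unused NoMore) NoMore)) (Cut
  (10, 0, 8, 5) 61 (Cut (5, 0, 2, 1) 34 (cell 3 0 [:: 1] NoMore) (cell 3 3 [:: 0] NoMore) NoMore)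
  (Cut (0, 6, 9, 4) 43 (cell 3 4 [:: 0] NoMore) (Cut (5, 0, 2, 2) 24 (cell 3 0 [:: 1] NoMore) (Cut
  (0, 5, 4, 3) 28 (cell 3 8 [:: 0] NoMore) (cell 3 0 [:: 2] NoMore) NoMore) NoMore) NoMore)
  NoMore) (Cut (3, 2, 0, 2) 15 (Cut (0, 1, 7, 3) 22 (cell 2 8 [:: 0] NoMore) (Cut (0, 8, 10, 6) 40
  (Cut (10, 0, 1, 2) 24 (Cut (3, 0, 4, 6) 22 (cell 3 6 [:: 1] NoMore) (cell 3 4 [:: 0] NoMore)
  NoMore) (cell 3 1 [:: 0] NoMore) NoMore) (Cut (0, 3, 5, 8) 25 (cell 2 0 [:: 2] NoMore) (Cut (9,
  0, 2, 1) 72 (cell 2 0 [:: 1] NoMore) (Cut (0, 3, 1, 1) 7 (cell 3 0 [:: 2] NoMore) (cell 3 1 [::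
  0] NoMore) NoMore) NoMore) NoMore) NoMore) NoMore) (cell 2 0 [:: 1] NoMore) NoMore)) (Cut (0, 2,
  0, 1) 12 (cell 3 0 [:: 1] NoMore) (Cut (4, 1, 0, 2) 32 (Cut (0, 6, 3, 5) 3 (cell 2 0 [:: 1]
  NoMore) (Unused NoMore) NoMore) (Cut (3, 0, 5, 0) 29 (cell 3 0 [:: 1] NoMore) (Cut (0, 2, 3, 1)
  16 (Cut (5, 0, 2, 7) 29 (cell 3 0 [:: 1] NoMore) (Cut (1, 0, 8, 7) 34 (cell 3 0 [:: 1] NoMore)
  (cell 3 6 [:: 0] NoMore) NoMore) NoMore) (Cut (10, 0, 1, 7) 52 (Cut (6, 2, 0, 3) 31 (Cut (0, 4,
  5, 3) 16 (Cut (5, 5, 1, 0) 26 (cell 3 4 [:: 0; 2] NoMore) (cell 3 0 [:: 1] NoMore) NoMore) (Cut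
  (14, 0, 3, 8) 97 (cell 3 1 [:: 0] NoMore) (cell 3 0 [:: 2] NoMore) NoMore) NoMore) (cell 3 1 [::
  0] NoMore) NoMore) (Cut (5, 0, 6, 4) 29 (Cut (0, 3, 4, 2) 22 (cell 3 18 [:: 0] NoMore) (Cut (5,
  0, 4, 3) 29 (cell 3 0 [:: 1] NoMore) (cell 3 1 [:: 0] NoMore) NoMore) NoMore) (Cut (4, 2, 0, 1)
  20 (cell 3 0 [:: 1] NoMore) (cell 3 0 [:: 1] NoMore) NoMore) NoMore) NoMore) NoMore) NoMore)
  NoMore) NoMore))) (cell 5 0 [:: 1] NoMore) (Cut (5, 0, 9, 2) 70 (Cut (10, 9, 0, 5) 5 (Cut (2, 2,
  0, 1) 2 (cell 2 1 [:: 0] NoMore) (Unused NoMore) NoMore) (Unused NoMore) (Cut (2, 3, 0, 2) 3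
  (cell 2 0 [:: 0] NoMore) (cell 2 0 [:: 0] NoMore) NoMore)) (Cut (7, 5, 0, 2) 36 (Cut (16, 0, 1,
  8) 104 (Cut (0, 6, 5, 5) 15 (cell 3 0 [:: 1] NoMore) (cell 3 0 [:: 1] NoMore) NoMore) (Cut (0,
  4, 4, 2) 24 (cell 3 1 [:: 0] NoMore) (Cut (4, 1, 0, 1) 21 (Cut (3, 6, 1, 0) 28 (cell 3 0 [:: 1]
  NoMore) (cell 3 13 [:: 1; 2] NoMore) NoMore) (Cut (1, 0, 2, 2) 10 (cell 3 2 [:: 0] NoMore) (cell
  3 2 [:: 0] NoMore) NoMore) NoMore) NoMore) NoMore) (Cut (6, 11, 0, 7) 27 (Cut (2, 3, 1, 0) 17
  (cell 3 6 [:: 0] NoMore) (Cut (0, 0, 1, 0) 3 (Cut (2, 0, 1, 1) 10 (Cut (0, 5, 1, 5) 18 (cell 3 0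
  [:: 1] NoMore) (cell 3 3 [:: 0] NoMore) NoMore) (Cut (2, 8, 0, 3) 27 (cell 3 0 [:: 1] NoMore)
  (Cut (3, 0, 9, 3) 51 (cell 3 0 [:: 1] NoMore) (cell 3 5 [:: 0] NoMore) NoMore) NoMore) NoMore)
  (Cut (2, 0, 2, 1) 10 (Cut (0, 10, 2, 7) 45 (cell 3 0 [:: 2] NoMore) (cell 3 0 [:: 1] NoMore)
  NoMore) (Cut (3, 0, 1, 5) 24 (cell 3 9 [:: 0] NoMore) (cell 3 6 [:: 0] NoMore) NoMore) NoMore)
  NoMore) NoMore) (Cut (3, 9, 0, 7) 14 (cell 3 5 [:: 0] NoMore) (cell 2 1 [:: 0] NoMore) NoMore)
  NoMore) NoMore) (Cut (0, 0, 2, 0) 14 (cell 3 0 [:: 1] NoMore) (Cut (1, 0, 0, 1) 4 (Cut (0, 4, 3,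
  3) 18 (Cut (5, 0, 2, 0) 13 (Cut (6, 0, 3, 5) 36 (Cut (0, 0, 0, 3) 12 (cell 3 1 [:: 2] NoMore)
  (cell 3 1 [:: 0] NoMore) NoMore) (Cut (0, 5, 2, 2) 21 (cell 3 2 [:: 0] NoMore) (cell 3 4 [:: 0]
  NoMore) NoMore) NoMore) (Cut (0, 1, 0, 2) 13 (cell 3 0 [:: 2] NoMore) (Cut (0, 0, 1, 2) 12 (cell
  3 1 [:: 2] NoMore) (Cut (2, 3, 1, 0) 13 (cell 3 4 [:: 0] NoMore) (cell 3 9 [:: 1] NoMore)
  NoMore) NoMore) NoMore) NoMore) (Cut (0, 0, 2, 1) 5 (Cut (4, 3, 0, 4) 26 (cell 3 0 [:: 1]
  NoMore) (cell 3 0 [:: 1] NoMore) NoMore) (Cut (1, 0, 0, 0) 7 (cell 3 0 [:: 1] NoMore) (Cut (7,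
  0, 6, 8) 52 (cell 3 0 [:: 1] NoMore) (cell 3 1 [:: 0] NoMore) NoMore) NoMore) NoMore) NoMore)
  (Cut (1, 1, 2, 0) 13 (Cut (1, 0, 1, 0) 7 (cell 3 0 [:: 1] NoMore) (cell 3 2 [:: 0] NoMore)
  NoMore) (Cut (4, 3, 0, 3) 18 (Cut (1, 1, 0, 0) 6 (cell 3 1 [:: 0] NoMore) (cell 3 0 [:: 1]
  NoMore) NoMore) (cell 3 0 [:: 1] NoMore) NoMore) NoMore) NoMore) NoMore))) NoMore)) (Cut (1, 0,
  0, 0) 8 (cell 2 0 [:: 1] NoMore) (Cut (1, 0, 3, 0) 23 (Cut (0, 0, 1, 1) 8 (cell 2 0 [:: 1]
  NoMore) (Unused NoMore) NoMore) (Cut (6, 0, 1, 3) 42 (cell 3 0 [:: 1] NoMore) (Cut (0, 4, 0, 2)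
  18 (Cut (1, 0, 1, 1) 5 (cell 5 0 [:: 1] NoMore) (cell 5 0 [:: 1] NoMore) NoMore) (Cut (3, 0, 2,
  1) 16 (Cut (4, 2, 0, 2) 18 (Cut (4, 9, 0, 5) 43 (cell 3 0 [:: 2] NoMore) (Cut (0, 0, 3, 1) 10
  (cell 3 0 [:: 1] NoMore) (Cut (3, 4, 0, 2) 21 (cell 3 5 [:: 0] NoMore) (cell 3 1 [:: 0] NoMore)
  NoMore) NoMore) NoMore) (Cut (0, 5, 1, 5) 15 (cell 3 1 [:: 2] NoMore) (Cut (3, 0, 0, 2) 5 (cell
  3 1 [:: 3] NoMore) (Unused NoMore) NoMore) NoMore) NoMore) (Cut (0, 3, 3, 0) 15 (cell 5 2 [:: 0]
  (Cut (9, 0, 2, 3) 31 (cell 2 2 [:: 0] NoMore) (Cut (2, 5, 0, 3) 20 (Cut (9, 0, 11, 7) 53 (cell 3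
  5 [:: 0] NoMore) (Unused NoMore) NoMore) (Cut (0, 2, 1, 0) 9 (cell 3 2 [:: 1] NoMore) (cell 3 2
  [:: 1] NoMore) NoMore) NoMore) NoMore)) (cell 5 7 [:: 0] NoMore) (Cut (0, 1, 4, 2) 16 (Cut (2,
  0, 0, 2) 10 (Cut (15, 3, 0, 8) 58 (cell 3 1 [:: 0] NoMore) (cell 3 4 [:: 0] NoMore) NoMore) (Cut
  (0, 3, 0, 2) 9 (Cut (3, 7, 0, 4) 28 (cell 3 0 [:: 1] NoMore) (cell 3 2 [:: 0] NoMore) NoMore)
  (cell 3 2 [:: 0] NoMore) NoMore) NoMore) (Cut (6, 0, 6, 1) 27 (cell 3 2 [:: 0] NoMore) (cell 3 0
  [:: 2] NoMore) NoMore) NoMore)) NoMore) (Cut (1, 4, 0, 1) 28 (cell 3 0 [:: 1] NoMore) (Cut (12,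
  0, 6, 5) 83 (Cut (1, 2, 0, 1) 6 (Cut (8, 4, 7, 0) 61 (cell 2 1 [:: 0] NoMore) (Unused NoMore)
  NoMore) (Unused NoMore) NoMore) (Cut (4, 1, 2, 0) 17 (Cut (0, 6, 9, 4) 40 (Cut (1, 0, 3, 1) 19
  (cell 3 1 [:: 0] NoMore) (Cut (0, 2, 4, 3) 21 (cell 3 2 [:: 0] NoMore) (cell 3 9 [:: 2] NoMore)
  NoMore) NoMore) (Cut (9, 0, 4, 7) 47 (Cut (4, 0, 2, 1) 24 (cell 3 2 [:: 0] NoMore) (Cut (4, 0,
  1, 3) 24 (cell 3 2 [:: 1] NoMore) (cell 3 7 [:: 1] NoMore) NoMore) NoMore) (cell 3 9 [:: 0]
  NoMore) NoMore) NoMore) (Cut (0, 0, 0, 1) 5 (cell 5 0 [:: 1] NoMore) (Cut (0, 1, 2, 0) 5 (Cut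
  (0, 3, 0, 2) 20 (cell 3 1 [:: 0] NoMore) (Cut (1, 1, 0, 0) 6 (cell 3 6 [:: 1] NoMore) (Cut (4,
  0, 5, 2) 33 (cell 3 1 [:: 2] NoMore) (Cut (3, 0, 4, 2) 24 (cell 3 5 [:: 2] NoMore) (Cut (3, 0,
  6, 5) 34 (cell 3 6 [:: 1] NoMore) (Cut (4, 0, 9, 2) 31 (cell 3 6 [:: 1] NoMore) (cell 3 0 [:: 1]
  NoMore) NoMore) NoMore) NoMore) NoMore) NoMore) NoMore) (cell 3 0 [:: 1] NoMore) NoMore) NoMore)
  NoMore) (Cut (4, 0, 1, 2) 20 (Cut (12, 6, 0, 4) 70 (Cut (0, 10, 5, 3) 25 (cell 3 0 [:: 1]
  NoMore) (cell 3 1 [:: 2] NoMore) NoMore) (Cut (3, 2, 4, 0) 24 (cell 3 1 [:: 0] NoMore) (Cut (6,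
  0, 1, 0) 20 (cell 3 1 [:: 2] NoMore) (cell 3 0 [:: 1] NoMore) NoMore) NoMore) NoMore) (Cut (0,
  7, 2, 2) 37 (Cut (0, 2, 0, 1) 13 (cell 3 0 [:: 1] NoMore) (Cut (1, 1, 3, 0) 12 (cell 3 2 [:: 0]
  NoMore) (cell 3 10 [:: 0; 1] NoMore) NoMore) NoMore) (Cut (3, 3, 0, 1) 21 (cell 3 1 [:: 0; 2]
  NoMore) (Cut (0, 4, 1, 5) 22 (Cut (4, 0, 9, 5) 55 (cell 3 1 [:: 0] NoMore) (Cut (2, 0, 9, 6) 34
  (Cut (2, 1, 0, 3) 18 (Cut (0, 12, 7, 4) 46 (cell 3 4 [:: 0] NoMore) (cell 3 7 [:: 0] NoMore)
  NoMore) (Cut (5, 6, 0, 2) 24 (cell 3 0 [:: 1] NoMore) (cell 3 2 [:: 1] NoMore) NoMore) NoMore)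
  (cell 3 6 [:: 0] NoMore) NoMore) NoMore) (Cut (0, 8, 5, 2) 38 (Cut (3, 2, 0, 4) 10 (cell 3 4 [::
  2] NoMore) (cell 3 9 [:: 0] NoMore) NoMore) (Cut (2, 8, 0, 7) 23 (cell 3 4 [:: 7] NoMore) (Cut
  (2, 3, 2, 0) 14 (cell 3 1 [:: 0] NoMore) (Unused NoMore) NoMore) NoMore) NoMore) NoMore) NoMore)
  NoMore) NoMore)) NoMore)) NoMore) (Cut (14, 0, 2, 6) 94 (Cut (4, 3, 0, 2) 28 (cell 3 0 [:: 1]
  NoMore) (cell 2 0 [:: 0] (Unused NoMore)) NoMore) (Cut (0, 0, 0, 1) 5 (cell 5 0 [:: 1] NoMore)
  (Cut (0, 1, 0, 0) 5 (cell 5 0 [:: 1] NoMore) (Cut (5, 0, 0, 3) 16 (Cut (0, 7, 2, 5) 26 (cell 5 4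
  [:: 0] NoMore) (Cut (2, 2, 4, 0) 24 (cell 3 1 [:: 0] NoMore) (Cut (0, 2, 9, 5) 33 (cell 3 3 [::
  0] NoMore) (Cut (0, 8, 5, 0) 18 (cell 3 0 [:: 1] NoMore) (cell 3 4 [:: 0] NoMore) NoMore)
  NoMore) NoMore) NoMore) (Cut (0, 1, 2, 1) 11 (Cut (8, 7, 0, 3) 20 (Cut (8, 0, 3, 6) 32 (cell 3 4
  [:: 0] NoMore) (Cut (0, 1, 2, 0) 12 (cell 3 9 [:: 0] NoMore) (cell 3 1 [:: 0] NoMore) NoMore)
  NoMore) (Cut (0, 1, 7, 2) 49 (cell 3 0 [:: 1] NoMore) (cell 3 0 [:: 1] NoMore) NoMore) NoMore)
  (cell 3 1 [:: 0] NoMore) NoMore) NoMore) (Cut (1, 0, 4, 1) 28 (cell 3 0 [:: 1] NoMore) (Cut (0,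
  4, 0, 1) 28 (cell 3 0 [:: 1] NoMore) (Cut (0, 2, 1, 0) 13 (cell 3 1 [:: 0] NoMore) (Cut (7, 1,
  0, 0) 24 (Cut (0, 1, 0, 0) 4 (cell 3 0 [:: 1] NoMore) (Cut (0, 3, 0, 2) 10 (cell 3 0 [:: 1]
  NoMore) (Cut (2, 0, 6, 3) 23 (Cut (0, 1, 6, 2) 19 (cell 3 0 [:: 2] NoMore) (cell 3 0 [:: 1]
  NoMore) NoMore) (cell 3 3 [:: 0] NoMore) NoMore) NoMore) NoMore) (Cut (9, 9, 0, 4) 62 (cell 3 0
  [:: 1] NoMore) (Cut (0, 1, 0, 1) 7 (cell 3 2 [:: 0] NoMore) (Cut (4, 0, 6, 2) 38 (Cut (2, 1, 1,
  0) 10 (cell 3 6 [:: 0] NoMore) (cell 3 1 [:: 0] NoMore) NoMore) (Cut (1, 0, 10, 8) 60 (cell 3 2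
  [:: 1] NoMore) (Cut (8, 0, 7, 3) 46 (cell 3 2 [:: 0] NoMore) (Cut (0, 1, 4, 1) 18 (cell 3 1 [::
  0] NoMore) (Cut (2, 6, 0, 3) 28 (cell 3 3 [:: 0] NoMore) (cell 3 5 [:: 0] NoMore) NoMore)
  NoMore) NoMore) NoMore) NoMore) NoMore) NoMore) NoMore) NoMore) NoMore) NoMore)) NoMore) (Cut
  (1, 2, 0, 1) 17 (cell 2 0 [:: 1] NoMore) (Cut (0, 0, 0, 1) 7 (cell 3 0 [:: 1] NoMore) (Cut (0,
  3, 0, 1) 22 (cell 2 1 [:: 0] NoMore) (Cut (1, 0, 0, 2) 14 (cell 2 0 [:: 1] NoMore) (Cut (0, 0,
  1, 0) 5 (cell 5 0 [:: 1] NoMore) (Cut (0, 1, 2, 0) 11 (cell 3 0 [:: 1] NoMore) (Cut (2, 0, 0, 1)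
  14 (cell 3 0 [:: 1] NoMore) (Cut (0, 0, 2, 1) 5 (Cut (6, 0, 5, 1) 28 (Cut (0, 8, 5, 4) 36 (cell
  3 0 [:: 1] NoMore) (Cut (9, 6, 0, 5) 52 (cell 3 1 [:: 0] NoMore) (Cut (0, 4, 5, 3) 24 (cell 3 2
  [:: 0] NoMore) (cell 3 8 [:: 0] NoMore) NoMore) NoMore) NoMore) (Cut (0, 6, 2, 1) 30 (cell 3 1
  [:: 0] NoMore) (Cut (0, 8, 9, 4) 50 (Cut (11, 0, 4, 7) 43 (cell 3 2 [:: 1] NoMore) (cell 3 2 [::
  1] NoMore) NoMore) (Cut (0, 5, 8, 3) 32 (cell 3 4 [:: 2] NoMore) (cell 3 4 [:: 0] NoMore)
  NoMore) NoMore) NoMore) NoMore) (Cut (3, 1, 0, 0) 10 (Cut (0, 6, 2, 1) 31 (cell 3 2 [:: 0]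
  NoMore) (Cut (0, 4, 3, 2) 14 (Cut (3, 0, 0, 1) 13 (cell 3 0 [:: 2] NoMore) (cell 3 1 [:: 0; 2]
  NoMore) NoMore) (cell 3 13 [:: 0] NoMore) NoMore) NoMore) (cell 3 0 [:: 2] NoMore) NoMore)
  NoMore) NoMore) NoMore) NoMore) (Cut (0, 4, 4, 1) 15 (Cut (5, 2, 0, 3) 15 (Cut (8, 3, 0, 5) 45
  (cell 3 0 [:: 1] NoMore) (Cut (9, 5, 0, 4) 51 (cell 3 0 [:: 1] NoMore) (Cut (2, 0, 2, 3) 12 (Cut
  (0, 3, 3, 2) 19 (Cut (0, 3, 2, 1) 17 (cell 3 2 [:: 1] NoMore) (Cut (0, 8, 4, 3) 39 (cell 3 7 [::
  1] NoMore) (Cut (1, 0, 3, 1) 15 (cell 3 8 [:: 0] NoMore) (cell 3 7 [:: 0] NoMore) NoMore)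
  NoMore) NoMore) (Cut (2, 1, 0, 1) 9 (Cut (6, 0, 9, 8) 54 (cell 3 1 [:: 0] NoMore) (cell 3 6 [::
  1] NoMore) NoMore) (cell 3 1 [:: 2] NoMore) NoMore) NoMore) (Cut (1, 0, 4, 3) 11 (cell 3 6 [::
  0; 1] NoMore) (cell 3 1 [:: 0; 2] NoMore) NoMore) NoMore) NoMore) NoMore) (Cut (0, 0, 1, 0) 7
  (cell 3 0 [:: 1] NoMore) (Cut (10, 8, 0, 2) 34 (cell 3 2 [:: 0] NoMore) (Cut (2, 0, 11, 8) 74
  (cell 3 0 [:: 1] NoMore) (cell 3 2 [:: 0] NoMore) NoMore) NoMore) NoMore) NoMore) (Cut (2, 0, 0,
  1) 14 (cell 3 0 [:: 1] NoMore) (Cut (0, 1, 0, 1) 6 (cell 3 0 [:: 1] NoMore) (Cut (3, 0, 2, 1) 20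
  (cell 3 1 [:: 0] NoMore) (Cut (4, 3, 3, 0) 23 (cell 3 0 [:: 1] NoMore) (cell 3 1 [:: 0] NoMore)
  NoMore) NoMore) NoMore) NoMore) (Cut (1, 0, 1, 2) 10 (Cut (0, 9, 10, 2) 43 (cell 5 1 [:: 0]
  NoMore) (Cut (0, 2, 0, 2) 14 (cell 3 0 [:: 1] NoMore) (Cut (0, 1, 1, 1) 7 (cell 3 1 [:: 0]
  NoMore) (Cut (0, 0, 0, 1) 4 (cell 3 0 [:: 1] NoMore) (Cut (5, 4, 0, 2) 31 (cell 3 1 [:: 0]
  NoMore) (cell 3 1 [:: 0] NoMore) NoMore) NoMore) NoMore) NoMore) NoMore) (Cut (2, 1, 0, 2) 13
  (Cut (1, 2, 2, 0) 12 (cell 3 0 [:: 1] NoMore) (Cut (0, 6, 12, 5) 33 (cell 3 0 [:: 1] NoMore)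
  (cell 3 0 [:: 1] NoMore) NoMore) NoMore) (Cut (6, 5, 0, 1) 25 (Cut (4, 1, 0, 3) 19 (cell 3 4 [::
  0] NoMore) (Cut (11, 10, 0, 3) 73 (cell 3 4 [:: 0] NoMore) (Cut (0, 1, 2, 1) 11 (cell 3 2 [:: 0]
  NoMore) (Cut (0, 1, 4, 1) 14 (cell 3 8 [:: 0] NoMore) (cell 3 6 [:: 0] NoMore) NoMore) NoMore)
  NoMore) NoMore) (cell 5 2 [:: 1] NoMore) NoMore) NoMore) NoMore))) NoMore) NoMore) NoMore)))
  (Cut (0, 1, 2, 1) 17 (cell 2 0 [:: 0] NoMore) (Cut (1, 0, 3, 2) 16 (Cut (1, 1, 0, 5) 36 (Cut (0,
  0, 3, 1) 9 (cell 2 0 [:: 1] NoMore) (cell 2 0 [:: 1] NoMore) NoMore) (Cut (1, 1, 2, 0) 7 (Cut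
  (0, 0, 5, 2) 34 (cell 3 0 [:: 1] NoMore) (Cut (2, 1, 1, 0) 10 (cell 4 1 [:: 2] NoMore) (Cut (1,
  5, 0, 3) 17 (cell 3 2 [:: 0] NoMore) (Cut (2, 0, 4, 1) 23 (cell 3 0 [:: 1; 2] NoMore) (cell 3 1
  [:: 0] NoMore) NoMore) NoMore) NoMore) NoMore) (cell 3 0 [:: 1] NoMore) NoMore) NoMore) (Cut (1,
  0, 0, 0) 6 (cell 4 0 [:: 1] NoMore) (Cut (0, 1, 2, 2) 8 (Cut (0, 0, 1, 1) 4 (Cut (1, 0, 2, 1) 8
  (Cut (4, 3, 0, 2) 21 (cell 4 1 [:: 0] NoMore) (cell 4 11 [:: 0] NoMore) NoMore) (cell 4 0 [:: 1]
  NoMore) NoMore) (Cut (0, 1, 2, 1) 9 (cell 4 2 [:: 0] NoMore) (cell 4 0 [:: 2] NoMore) NoMore)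
  NoMore) (cell 4 0 [:: 2] NoMore) NoMore) NoMore) NoMore) (Cut (1, 0, 0, 0) 6 (cell 4 0 [:: 1]
  NoMore) (Cut (0, 2, 0, 0) 12 (cell 4 0 [:: 1] NoMore) (Cut (2, 3, 0, 1) 12 (Cut (2, 0, 2, 1) 7
  (Cut (0, 1, 6, 3) 27 (cell 3 2 [:: 1] NoMore) (Cut (7, 0, 1, 4) 38 (cell 4 0 [:: 1] NoMore) (Cut
  (0, 8, 8, 3) 38 (Cut (0, 0, 1, 1) 4 (cell 4 6 [:: 0; 1] NoMore) (cell 4 6 [:: 0] NoMore) NoMore)
  (cell 4 0 [:: 1] NoMore) NoMore) NoMore) NoMore) (cell 3 0 [:: 1] NoMore) NoMore) (Cut (1, 3, 0,
  2) 13 (cell 4 2 [:: 1] NoMore) (Cut (0, 0, 1, 0) 6 (cell 4 0 [:: 1] NoMore) (Cut (4, 2, 2, 0) 18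
  (cell 4 1 [:: 2] NoMore) (cell 4 1 [:: 3] NoMore) NoMore) NoMore) NoMore) NoMore) NoMore) (Cut
  (8, 0, 15, 7) 76 (Cut (0, 0, 2, 0) 14 (cell 3 0 [:: 1] NoMore) (Cut (0, 1, 0, 1) 5 (cell 3 1 [::
  0] NoMore) (Cut (1, 1, 0, 0) 6 (cell 3 1 [:: 0] NoMore) (Cut (0, 12, 6, 4) 56 (cell 3 3 [:: 0]
  NoMore) (Cut (3, 3, 0, 2) 16 (cell 3 1 [:: 0] NoMore) (Cut (6, 4, 0, 3) 24 (cell 3 0 [:: 1]
  NoMore) (Cut (3, 0, 0, 1) 7 (cell 3 1 [:: 2] NoMore) (cell 3 7 [:: 0] NoMore) NoMore) NoMore)
  NoMore) NoMore) NoMore) NoMore) NoMore) (Cut (0, 1, 0, 0) 5 (cell 5 0 [:: 1] NoMore) (Cut (1, 2,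
  0, 0) 9 (cell 5 0 [:: 1] NoMore) (Cut (4, 4, 1, 0) 17 (cell 5 6 [:: 0] NoMore) (cell 5 0 [:: 1]
  (Cut (0, 0, 0, 1) 7 (cell 3 0 [:: 1] NoMore) (Cut (2, 0, 2, 1) 11 (cell 3 5 [:: 0] NoMore) (Cut
  (4, 14, 0, 7) 70 (cell 3 0 [:: 1] NoMore) (cell 3 2 [:: 0] NoMore) NoMore) NoMore) NoMore)) (Cut
  (0, 0, 1, 1) 4 (Cut (4, 16, 0, 8) 84 (cell 3 0 [:: 1] NoMore) (Cut (3, 3, 3, 0) 21 (cell 3 6 [::
  0] NoMore) (Cut (1, 3, 4, 0) 14 (cell 3 0 [:: 1] NoMore) (Cut (4, 0, 3, 1) 18 (cell 3 3 [:: 0]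
  NoMore) (Cut (0, 5, 2, 3) 25 (cell 3 2 [:: 0] NoMore) (cell 3 3 [:: 0] NoMore) NoMore) NoMore)
  NoMore) NoMore) NoMore) (cell 3 0 [:: 1] NoMore) NoMore)) (Cut (0, 1, 0, 3) 22 (cell 3 0 [:: 1]
  NoMore) (Cut (0, 1, 1, 0) 5 (Cut (1, 2, 0, 3) 15 (cell 3 1 [:: 0] NoMore) (Cut (11, 0, 4, 3) 34
  (cell 3 4 [:: 0] NoMore) (cell 3 1 [:: 2] NoMore) NoMore) NoMore) (Cut (7, 4, 2, 0) 29 (Cut (8,
  0, 5, 0) 53 (cell 3 0 [:: 1] NoMore) (Cut (4, 0, 4, 5) 32 (cell 3 0 [:: 1] NoMore) (Cut (6, 0,
  4, 1) 30 (cell 3 1 [:: 2] NoMore) (cell 3 0 [:: 1] NoMore) NoMore) NoMore) NoMore) (Cut (3, 0,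
  2, 1) 13 (cell 3 5 [:: 0] NoMore) (Cut (2, 0, 3, 5) 30 (cell 3 9 [:: 0] NoMore) (cell 3 4 [:: 0]
  NoMore) NoMore) NoMore) NoMore) NoMore) NoMore)) (Cut (0, 0, 5, 3) 17 (Cut (3, 7, 5, 0) 41 (cell
  3 2 [:: 0] NoMore) (Cut (0, 0, 1, 2) 14 (cell 3 0 [:: 1] NoMore) (Cut (5, 3, 7, 0) 27 (cell 3 5
  [:: 0] NoMore) (Cut (4, 0, 7, 4) 32 (cell 3 5 [:: 0] NoMore) (cell 3 2 [:: 0] NoMore) NoMore)
  NoMore) NoMore) NoMore) (Cut (3, 0, 3, 0) 21 (cell 3 0 [:: 1] NoMore) (Cut (10, 0, 11, 5) 65
  (cell 3 0 [:: 1] NoMore) (Cut (0, 1, 0, 0) 7 (cell 3 0 [:: 1] NoMore) (Cut (4, 1, 1, 0) 20 (cell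
  3 0 [:: 2] NoMore) (Cut (0, 2, 0, 1) 13 (cell 3 0 [:: 1] NoMore) (Cut (0, 11, 14, 6) 80 (cell 3
  9 [:: 0] NoMore) (Cut (6, 7, 0, 1) 43 (cell 3 0 [:: 2] NoMore) (Cut (3, 0, 3, 1) 14 (cell 3 2
  [:: 1] NoMore) (cell 3 0 [:: 1] NoMore) NoMore) NoMore) NoMore) NoMore) NoMore) NoMore) NoMore)
  NoMore) NoMore)) (Cut (0, 0, 1, 0) 7 (cell 3 0 [:: 1] NoMore) (Cut (4, 1, 0, 1) 33 (cell 2 0 [::
  1] NoMore) (Cut (8, 0, 7, 4) 34 (Cut (3, 0, 6, 0) 42 (cell 2 0 [:: 1] NoMore) (Cut (1, 4, 5, 0)
  26 (Cut (5, 6, 0, 5) 29 (cell 3 0 [:: 1] NoMore) (Cut (4, 0, 2, 1) 18 (cell 3 3 [:: 0] NoMore)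
  (Cut (1, 6, 3, 0) 28 (cell 3 1 [:: 0] NoMore) (cell 3 4 [:: 0] NoMore) NoMore) NoMore) NoMore)
  (Cut (5, 0, 2, 0) 25 (cell 5 1 [:: 2] NoMore) (Cut (0, 6, 5, 3) 28 (cell 5 7 [:: 0] NoMore)
  (cell 5 0 [:: 1] NoMore) NoMore) NoMore) NoMore) NoMore) (Cut (1, 0, 1, 2) 13 (cell 2 0 [:: 1]
  NoMore) (Cut (0, 0, 0, 1) 5 (cell 2 0 [:: 1] NoMore) (Cut (0, 1, 0, 0) 7 (cell 3 0 [:: 1]
  NoMore) (Cut (6, 0, 8, 5) 31 (cell 3 2 [:: 1] NoMore) (Cut (2, 1, 0, 0) 9 (cell 3 0 [:: 1]
  NoMore) (Cut (3, 4, 0, 2) 27 (cell 3 0 [:: 2] NoMore) (cell 3 2 [:: 1] NoMore) NoMore) NoMore)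
  NoMore) NoMore) NoMore) NoMore) NoMore) NoMore) (Cut (0, 4, 6, 2) 32 (Cut (2, 5, 0, 2) 42 (cell
  2 0 [:: 1] NoMore) (Cut (3, 0, 3, 1) 20 (Cut (11, 0, 6, 4) 63 (cell 2 1 [:: 2] NoMore) (Cut (0,
  3, 10, 5) 83 (cell 2 0 [:: 0] NoMore) (Cut (3, 2, 0, 5) 11 (cell 3 4 [:: 0] NoMore) (cell 3 3
  [:: 0] NoMore) NoMore) NoMore) NoMore) (Cut (5, 7, 0, 3) 45 (cell 3 2 [:: 0] NoMore) (Cut (2, 3,
  0, 2) 14 (Cut (1, 4, 6, 0) 33 (cell 3 0 [:: 1] NoMore) (cell 3 2 [:: 0] NoMore) NoMore) (Cut (2,
  9, 0, 4) 27 (cell 3 2 [:: 5] NoMore) (cell 3 2 [:: 0] NoMore) NoMore) NoMore) NoMore) NoMore)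
  NoMore) (Cut (1, 0, 0, 0) 5 (cell 5 0 [:: 1] (Cut (3, 0, 1, 1) 22 (cell 3 0 [:: 1] NoMore) (Cut
  (0, 3, 1, 1) 7 (cell 3 0 [:: 1] NoMore) (Cut (0, 5, 4, 0) 13 (cell 2 1 [:: 0] NoMore) (Cut (10,
  0, 0, 5) 65 (cell 3 0 [:: 1] NoMore) (cell 2 1 [:: 0] NoMore) NoMore) NoMore) NoMore) NoMore))
  (Cut (1, 0, 1, 2) 9 (Cut (0, 1, 3, 2) 15 (cell 5 1 [:: 8] NoMore) (cell 5 0 [:: 6] NoMore)
  NoMore) (cell 5 0 [:: 1] NoMore) NoMore) NoMore) (Cut (1, 7, 0, 2) 56 (cell 2 0 [:: 1] NoMore)
  (Cut (0, 4, 0, 2) 30 (cell 2 0 [:: 1] NoMore) (Cut (1, 0, 0, 0) 6 (cell 4 0 [:: 1] NoMore) (Cut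
  (2, 0, 1, 0) 10 (cell 5 1 [:: 2] NoMore) (Cut (0, 0, 0, 1) 5 (cell 5 0 [:: 1] NoMore) (Cut (0,
  8, 2, 6) 42 (Cut (0, 5, 1, 2) 27 (Cut (8, 0, 10, 3) 21 (Cut (10, 0, 7, 5) 29 (cell 3 1 [:: 2]
  NoMore) (cell 3 2 [:: 1] NoMore) NoMore) (cell 3 0 [:: 2] NoMore) NoMore) (Cut (3, 1, 0, 2) 13
  (cell 3 3 [:: 0] NoMore) (Cut (1, 0, 0, 1) 1 (Cut (0, 7, 8, 1) 41 (cell 3 2 [:: 0] NoMore)
  (Unused NoMore) NoMore) (Unused NoMore) NoMore) NoMore) NoMore) (Cut (0, 3, 2, 1) 15 (cell 5 7
  [:: 1] NoMore) (cell 5 3 [:: 0] NoMore) NoMore) NoMore) NoMore) NoMore) NoMore) NoMore)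
  NoMore))))))))%N.

(** All entries have degree 217 to 220, so that no further 2-point fits. *)
Definition surj_list9 : seq quint :=
  [:: (4, 4, 0, 0, 0); (4, 3, 1, 2, 0); (4, 2, 2, 5, 0); (4, 2, 3, 2, 0); (4, 2, 4, 0, 0); (4, 1,
  5, 2, 0); (4, 1, 6, 0, 0); (4, 0, 7, 2, 0); (4, 0, 8, 0, 0); (3, 5, 0, 3, 0); (3, 4, 1, 6, 0);
  (3, 4, 2, 3, 0); (3, 4, 3, 1, 0); (3, 3, 4, 3, 0); (3, 3, 5, 1, 0); (3, 2, 6, 3, 0); (3, 2, 7,
  1, 0); (3, 1, 8, 3, 0); (3, 1, 9, 1, 0); (3, 0, 10, 3, 0); (3, 0, 11, 1, 0); (2, 7, 0, 2, 0);
  (2, 7, 1, 0, 0); (2, 6, 2, 2, 0); (2, 6, 3, 0, 0); (2, 5, 4, 2, 0); (2, 5, 5, 0, 0); (2, 4, 6,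
  2, 0); (2, 4, 7, 0, 0); (2, 3, 8, 2, 0); (2, 3, 9, 0, 0); (2, 2, 10, 2, 0); (2, 2, 11, 0, 0);
  (2, 1, 12, 2, 0); (2, 1, 13, 0, 0); (2, 0, 14, 2, 0); (2, 0, 15, 0, 0); (1, 9, 0, 1, 0); (1, 8,
  1, 3, 0); (1, 8, 2, 1, 0); (1, 7, 3, 3, 0); (1, 7, 4, 1, 0); (1, 6, 5, 3, 0); (1, 6, 6, 1, 0);
  (1, 5, 7, 3, 0); (1, 5, 8, 1, 0); (1, 4, 9, 3, 0); (1, 4, 10, 1, 0); (1, 3, 11, 3, 0); (1, 3,
  12, 1, 0); (1, 2, 13, 3, 0); (1, 2, 14, 1, 0); (1, 1, 15, 3, 0); (1, 1, 16, 1, 0); (1, 0, 17, 3,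
  0); (1, 0, 18, 1, 0); (0, 11, 0, 0, 0); (0, 10, 1, 2, 0); (0, 10, 2, 0, 0); (0, 9, 3, 2, 0); (0,
  9, 4, 0, 0); (0, 8, 5, 2, 0); (0, 8, 6, 0, 0); (0, 7, 7, 2, 0); (0, 7, 8, 0, 0); (0, 6, 9, 2,
  0); (0, 6, 10, 0, 0); (0, 5, 11, 2, 0); (0, 5, 12, 0, 0); (0, 4, 13, 2, 0); (0, 4, 14, 0, 0);
  (0, 3, 15, 2, 0); (0, 3, 16, 0, 0); (0, 2, 17, 2, 0); (0, 2, 18, 0, 0); (0, 1, 19, 2, 0); (0, 1,
  20, 0, 0); (0, 0, 21, 2, 0); (0, 0, 22, 0, 0)]%N.

(** Some entries lie well above degree 220 because a smaller one is an exception: (4, 3, 2, 1)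
    follows (4, 3, 2, 0), and (3, 6, 0, 1) follows (3, 6, 0, 0). *)
Definition inj_list9 : seq quint :=
  [:: (4, 3, 1, 3, 0); (4, 3, 2, 1, 0); (4, 2, 3, 3, 0); (4, 1, 5, 3, 0); (4, 0, 7, 3, 0); (3, 6,
  0, 1, 0); (3, 5, 0, 4, 0); (3, 5, 1, 2, 0); (3, 5, 2, 0, 0); (3, 4, 2, 4, 0); (3, 4, 3, 2, 0);
  (3, 4, 4, 0, 0); (3, 3, 4, 4, 0); (3, 3, 5, 2, 0); (3, 3, 6, 0, 0); (3, 2, 6, 4, 0); (3, 2, 7,
  2, 0); (3, 2, 8, 0, 0); (3, 1, 8, 4, 0); (3, 1, 9, 2, 0); (3, 1, 10, 0, 0); (3, 0, 10, 4, 0);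
  (3, 0, 11, 2, 0); (3, 0, 12, 0, 0); (2, 7, 0, 3, 0); (2, 6, 2, 3, 0); (2, 5, 4, 3, 0); (2, 4, 6,
  3, 0); (2, 3, 8, 3, 0); (2, 2, 10, 3, 0); (2, 1, 12, 3, 0); (2, 0, 14, 3, 0); (1, 9, 0, 2, 0);
  (1, 9, 1, 0, 0); (1, 8, 1, 4, 0); (1, 8, 2, 2, 0); (1, 8, 3, 0, 0); (1, 7, 3, 4, 0); (1, 7, 4,
  2, 0); (1, 7, 5, 0, 0); (1, 6, 5, 4, 0); (1, 6, 6, 2, 0); (1, 6, 7, 0, 0); (1, 5, 7, 4, 0); (1,
  5, 8, 2, 0); (1, 5, 9, 0, 0); (1, 4, 9, 4, 0); (1, 4, 10, 2, 0); (1, 4, 11, 0, 0); (1, 3, 11, 4,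
  0); (1, 3, 12, 2, 0); (1, 3, 13, 0, 0); (1, 2, 13, 4, 0); (1, 2, 14, 2, 0); (1, 2, 15, 0, 0);
  (1, 1, 15, 4, 0); (1, 1, 16, 2, 0); (1, 1, 17, 0, 0); (1, 0, 17, 4, 0); (1, 0, 18, 2, 0); (1, 0,
  19, 0, 0); (0, 10, 1, 3, 0); (0, 9, 3, 3, 0); (0, 8, 5, 3, 0); (0, 7, 7, 3, 0); (0, 6, 9, 3, 0);
  (0, 5, 11, 3, 0); (0, 4, 13, 3, 0); (0, 3, 15, 3, 0); (0, 2, 17, 3, 0); (0, 1, 19, 3, 0); (0, 0,
  21, 3, 0)]%N.

(** The first five entries are filled up by simple points to degree 120, the number of monomials.
    Their transforms have degree 220 and hence also give surjectivity; by domination the simple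
    points are then dropped, or raised to 2-points for injectivity. *)
Definition inj_list7 : seq quint :=
  [:: (1, 0, 8, 1, 1); (1, 0, 7, 3, 3); (1, 0, 6, 6, 1); (1, 0, 5, 8, 3); (1, 0, 4, 11, 1); (1, 0,
  7, 4, 0); (1, 0, 8, 2, 0); (1, 0, 9, 0, 0); (1, 1, 5, 4, 0); (1, 1, 6, 2, 0); (1, 1, 7, 0, 0);
  (1, 2, 4, 2, 0); (1, 2, 5, 0, 0)]%N.

Definition inj_list5 : seq quint :=
  [:: (0, 0, 4, 4, 2); (0, 0, 5, 2, 2); (0, 0, 6, 0, 2); (0, 1, 4, 0, 2)]%N.

Lemma surj_list9P : all (mem (surj_results (monomials 9) cert9)) surj_list9.
Proof. by vm_compute. Qed.

Lemma inj_list9P : all (mem (inj_results (monomials 9) cert9)) inj_list9.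
Proof. by vm_compute. Qed.

Lemma inj_list7P : all (mem (inj_results (monomials 7) cert7)) inj_list7.
Proof. by vm_compute. Qed.

Lemma inj_list5P : all (mem (inj_results (monomials 5) cert5)) inj_list5.
Proof. by vm_compute. Qed.

(** * Coverage *)

(** Multiplicities are listed in decreasing order, so entrywise domination compares the numbers of
    points of multiplicity at least 5, 4, 3, 2 and 1. *)
Definition quint_le (s t : quint) : bool :=
  let: (a, b, c, e, f) := s in let: (a', b', c', e', f') := t in
  [&& a <= a', a + b <= a' + b', a + b + c <= a' + b' + c',
      a + b + c + e <= a' + b' + c' + e' & a + b + c + e + f <= a' + b' + c' + e' + f']%N.

Lemma nth_quint_mults a b c e f i : nth 0%N (quint_mults (a, b, c, e, f)) i =
  ((i < a) + (i < a + b) + (i < a + b + c) + (i < a + b + c + e) + (i < a + b + c + e + f))%N.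
Proof.
rewrite /quint_mults !nth_cat !size_nseq !nth_nseq.
do !case: ltnP => ?; lia.
Qed.

Lemma size_quint_mults a b c e f : size (quint_mults (a, b, c, e, f)) = (a + b + c + e + f)%N.
Proof. by rewrite !size_cat !size_nseq !addnA. Qed.

Lemma quint_le_nth s t : quint_le s t ->
  (size (quint_mults s) <= size (quint_mults t))%N /\
  forall i, (nth 0 (quint_mults s) i <= nth 0 (quint_mults t) i)%N.
Proof.
case: s t => [[[[a b] c] e] f] [[[[a' b'] c'] e'] f'] /and5P[h1 h2 h3 h4 h5].
rewrite !size_quint_mults; split=> // i; rewrite !nth_quint_mults.
have mono m n : (m <= n)%N -> (nat_of_bool (i < m) <= (i < n))%N by case: ltnP => // im mn; rewrite (leq_trans im mn).
by rewrite !leq_add ?mono.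
Qed.

Lemma mults_quint w x y z : mults w x y z = quint_mults (w, x, y, z, 0%N).
Proof. by rewrite /quint_mults cats0. Qed.

Lemma fat_deg_quint a b c e f :
  fat_deg (quint_mults (a, b, c, e, f)) = (35 * a + 20 * b + 10 * c + 4 * e + f)%N.
Proof.
rewrite fat_degE !map_cat !sumn_cat !map_nseq !sumn_nseq.
by rewrite (_ : 'C(5 + 2, 3) = 35) // (_ : 'C(4 + 2, 3) = 20) // (_ : 'C(3 + 2, 3) = 10) //
  (_ : 'C(2 + 2, 3) = 4) // (_ : 'C(1 + 2, 3) = 1)%N //; lia.
Qed.

Lemma quint_mults_le5 t : all (fun m => m <= 5)%N (quint_mults t).
Proof. by case: t => [[[[a b] c] e] f]; rewrite !all_cat !all_nseq /= !orbT. Qed.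

Lemma size_conditions_quint t : size (conditions (quint_mults t)) = fat_deg (quint_mults t).
Proof. exact/size_conditions/quint_mults_le5. Qed.

(* A cut of the twenty exponents of degree at most 3 into five simplices: a 4-point specializes
   to five 2-points. *)
Definition five_simplices : cert :=
  let axes := [:: (0, 1, 0, 0); (0, 0, 1, 0); (0, 0, 0, 1); (0, 1, 1, 1)]%N in
  let simplex := Cell 2 [:: axes; axes; axes] NoMore in
  (Cut (0, 1, 0, 0) 2 simplex
    (Cut (0, 0, 1, 0) 2 simplex
      (Cut (0, 0, 0, 1) 2 simplex (Cut (0, 1, 1, 1) 2 simplex simplex NoMore) NoMore) NoMore)
   NoMore)%N.

(** Based at four 3-points, degree 7 becomes 21 - 12 = 9 and each 3 becomes 14 - 9 = 5. *)
Definition cremona7 (t : quint) : quint :=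
  let: (a, b, c, e, f) := t in (a + 4, b, c - 4, e, f)%N.

(** Two transformations: (5; 1, 1, 3, 3) to (7; 3, 3, 5, 5), then as in [cremona7] on these two
    3-points and two more. *)
Definition cremona5 (t : quint) : quint :=
  let: (a, b, c, e, f) := t in (a + 6, b, c - 4, e, f - 2)%N.

Definition quint_deg (t : quint) : nat :=
  let: (a, b, c, e, f) := t in (35 * a + 20 * b + 10 * c + 4 * e + f)%N.

Definition surj_list : seq quint :=
  surj_list9 ++ [seq t <- [seq cremona7 t | t <- inj_list7] | quint_deg t == 220%N].

Definition inj_list : seq quint :=
  inj_list9 ++ [seq t <- surj_list9 | quint_deg t == 220%N] ++
  [seq cremona7 t | t <- inj_list7] ++ [seq cremona5 t | t <- inj_list5].

(* k is the number of 4-points that are split into 2-points. *)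
Definition surj_covered w x y z := has (fun k =>
  has (quint_le (w, x + k, y, z - 5 * k, 0)%N) surj_list) (iota 0 12).

Definition inj_covered w x y z := has (fun k => (5 * k <= z)%N &&
  has (fun t => quint_le t (w, x + k, y, z - 5 * k, 0)%N) inj_list) (iota 0 12).

(** By domination only the largest z with degree at most 220 has to be covered; if it is not, every
    smaller z must be an exception as well. *)
Definition surj_check w x y :=
  let deg := (35 * w + 20 * x + 10 * y)%N in let z := ((220 - deg) %/ 4)%N in
  (deg <= 220)%N ==>
    surj_covered w x y z || all (fun z' => (w, x, y, z') \in exceptions9) (iota 0 z.+1).

(** The constant 223 rounds up: z is the least number of 2-points that brings the degree to 220. If
    the first i values from there on are exceptions, covering the next one suffices by
    domination. *)
Definition inj_check w x y :=
  let z := ((223 - (35 * w + 20 * x + 10 * y)) %/ 4)%N in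
  has (fun i => inj_covered w x y (z + i) &&
    all (fun j => (w, x, y, z + j)%N \in exceptions9) (iota 0 i)) (iota 0 4).

Lemma surj_coverageP :
  all (fun w => all (fun x => all (surj_check w x) (iota 0 23)) (iota 0 12)) (iota 0 7).
Proof. by lazy. Qed.

Lemma inj_coverageP :
  all (fun w => all (fun x => all (inj_check w x) (iota 0 22)) (iota 0 11)) (iota 0 7).
Proof. by lazy. Qed.

(** Beyond seven 5-points, eleven 4-points or 22 3-points everything is dominated, which makes the
    remaining check finite. *)
Lemma inj_covered_ends : [&& inj_covered 7 0 0 0, inj_covered 0 11 0 0 & inj_covered 0 0 22 0].
Proof. by vm_compute. Qed.

Section Main.
Variable K : fieldType.
Hypothesis charK : [pchar K] =i pred0.
Local Notation S t := (surj_mults K 9 (quint_mults t)).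
Local Notation I t := (inj_mults K 9 (quint_mults t)).

Lemma surj_quint_le s t : quint_le s t -> S t -> S s.
Proof. by move=> /quint_le_nth[sz le]; apply: surj_mults_le. Qed.

Lemma inj_quint_le s t : quint_le s t -> I s -> I t.
Proof. by move=> /quint_le_nth[sz le]; apply: inj_mults_le. Qed.

Local Notation near := [seq a <- monomials 9 | 10 - 4 <= qdot (1, 0, 0, 0) a]%N.

Lemma perm_split w x y z : perm_eq ([:: 2; 2; 2; 2; 2] ++ quint_mults (w, x, y, z, 0))%N
  (quint_mults (w, x, y, z + 5, 0)%N).
Proof. by apply/seq.permP => p; rewrite count_cat !count_quint_mults /=; lia. Qed.

Lemma perm_first_4 w x y z : perm_eq (quint_mults (w, x.+1, y, z, 0)%N)
  (4%N :: quint_mults (w, x, y, z, 0)%N).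
Proof.
by apply/seq.permP => p; rewrite -cat1s [in RHS]count_cat !count_quint_mults /=; lia.
Qed.

Lemma near_five : [/\ uniq near, {subset near <= monomials 9},
  (0, 0, 0, 5, 0)%N \in surj_results near five_simplices &
  (0, 0, 0, 5, 0)%N \in inj_results near five_simplices].
Proof.
split; try by vm_compute.
by move=> a; rewrite mem_filter => /andP[].
Qed.

Lemma surj_split w x y z : S (w, x.+1, y, z, 0)%N -> S (w, x, y, z + 5, 0)%N.
Proof.
move=> s4; have [un sn sr _] := near_five.
have := perm_split w x y z; rewrite perm_sym => /surj_mults_perm; apply.
have {}s4 : surj_mults K 9 (4%N :: quint_mults (w, x, y, z, 0)%N).
  by apply: surj_mults_perm s4; rewrite perm_sym perm_first_4.
apply: (surj_mults_split charK (isT : (4 <= 9.+1)%N) _ s4).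
have [L [cL oL sL]] := surj_resultsP charK un sn sr.
by exists L; split; [exact: has_counts_perm cL| |].
Qed.

Lemma inj_split w x y z : I (w, x.+1, y, z, 0)%N -> I (w, x, y, z + 5, 0)%N.
Proof.
move=> s4; have [un sn _ sr] := near_five.
apply: (inj_mults_perm (perm_split w x y z)).
have {}s4 := inj_mults_perm (perm_first_4 w x y z) s4.
apply: (inj_mults_split charK (isT : (4 <= 9.+1)%N) _ s4).
have [L [cL oL sL]] := inj_resultsP charK un sn sr.
by exists L; split; [exact: has_counts_perm cL| |].
Qed.

Lemma surj_splits k w x y z : S (w, x + k, y, z, 0)%N -> S (w, x, y, z + 5 * k, 0)%N.
Proof.
elim: k z => [|k IHk] z; first by rewrite addn0 muln0 addn0.
by rewrite addnS mulnS addnA => /surj_split/IHk.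
Qed.

Lemma inj_splits k w x y z : I (w, x + k, y, z, 0)%N -> I (w, x, y, z + 5 * k, 0)%N.
Proof.
elim: k z => [|k IHk] z; first by rewrite addn0 muln0 addn0.
by rewrite addnS mulnS addnA => /inj_split/IHk.
Qed.

Lemma surj_list9_mults t : t \in surj_list9 -> S t.
Proof.
move=> tL; apply: (surj_at_mults (perm_refl _)).
exact: (surj_resultsP charK (uniq_monomials 9) (fun a => id) (allP surj_list9P t tL)).
Qed.

Lemma surj_of_inj t : quint_deg t = 220%N -> I t -> S t.
Proof.
case: t => [[[[a b] c] e] f] deg [A A0 Af]; exists A => //.
move: Af; rewrite /row_free /row_full => /eqP->.
by rewrite size_monomials size_conditions_quint fat_deg_quint -deg.
Qed.

Lemma inj_of_surj t : quint_deg t = 220%N -> S t -> I t.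
Proof.
case: t => [[[[a b] c] e] f] deg [A A0 Af]; exists A => //.
move: Af; rewrite /row_free /row_full => /eqP->.
by rewrite size_monomials size_conditions_quint fat_deg_quint -deg.
Qed.

Lemma inj_cremona7 t : inj_mults K 7 (quint_mults t) -> (4 <= t.1.1.2)%N -> I (cremona7 t).
Proof.
case: t => [[[[a b] c] e] f] I7 c4; have {}c4 : (4 <= c)%N := c4; rewrite /cremona7.
pose rest := quint_mults (a, b, c - 4, e, f)%N.
have {}I7 : inj_mults K 7 ([:: 3; 3; 3; 3]%N ++ rest).
  by apply: inj_mults_perm I7; apply/seq.permP => p; rewrite [in RHS]count_cat !count_quint_mults /=; nia.
have I9 := inj_mults_cremona charK (n := 9) (m0 := 5) (m1 := 5) (m2 := 5) (m3 := 5) (rest := rest) I7.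
apply: inj_mults_perm I9; apply/seq.permP => p.
by rewrite -[X in count p X]/([:: 5; 5; 5; 5]%N ++ rest) count_cat !count_quint_mults /=; lia.
Qed.

Lemma inj_cremona5 t : inj_mults K 5 (quint_mults t) -> (4 <= t.1.1.2)%N -> (2 <= t.2)%N ->
  I (cremona5 t).
Proof.
case: t => [[[[a b] c] e] f] I5 c4 f2.
have {}c4 : (4 <= c)%N := c4; have {}f2 : (2 <= f)%N := f2; rewrite /cremona5.
pose rest := quint_mults (a, b, c - 4, e, f - 2)%N.
have {}I5 : inj_mults K 5 ([:: 1; 1; 3; 3; 3; 3]%N ++ rest).
  by apply: inj_mults_perm I5; apply/seq.permP => p; rewrite [in RHS]count_cat !count_quint_mults /=; nia.
have I7 := inj_mults_cremona charK (n := 7) (m0 := 3) (m1 := 3) (m2 := 5) (m3 := 5)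
  (rest := [:: 3, 3 & rest]%N) I5.
have {}I7 : inj_mults K 7 ([:: 3; 3; 3; 3; 5; 5]%N ++ rest).
  by apply: inj_mults_perm I7; rewrite -[X in perm_eq X _]/([:: 3; 3; 5; 5; 3; 3]%N ++ rest) perm_cat2r.
have I9 := inj_mults_cremona charK (n := 9) (m0 := 5) (m1 := 5) (m2 := 5) (m3 := 5)
  (rest := [:: 5, 5 & rest]%N) I7.
apply: inj_mults_perm I9; apply/seq.permP => p.
by rewrite -[X in count p X]/([:: 5; 5; 5; 5; 5; 5]%N ++ rest) count_cat !count_quint_mults /=; lia.
Qed.

Lemma inj_cremona7_list t : t \in [seq cremona7 t | t <- inj_list7] -> I t.
Proof.
case/mapP => u uL ->.
have c4 : all (fun t : quint => 4 <= t.1.1.2)%N inj_list7 by [].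
apply: inj_cremona7 (allP c4 u uL); apply: (inj_at_mults (perm_refl _)).
exact: (inj_resultsP charK (uniq_monomials 7) (fun a => id) (allP inj_list7P u uL)).
Qed.

Lemma surj_list_mults t : t \in surj_list -> S t.
Proof.
rewrite mem_cat mem_filter => /orP[/surj_list9_mults//|/andP[/eqP deg /inj_cremona7_list]].
exact: surj_of_inj.
Qed.

Lemma inj_list_mults t : t \in inj_list -> I t.
Proof.
rewrite !mem_cat mem_filter => /or4P[tL|/andP[/eqP deg /surj_list9_mults]|/inj_cremona7_list//|].
- apply: (inj_at_mults (perm_refl _)).
  exact: (inj_resultsP charK (uniq_monomials 9) (fun a => id) (allP inj_list9P t tL)).
- exact: inj_of_surj.
case/mapP => u uL ->.
have cf : all (fun t : quint => (4 <= t.1.1.2) && (2 <= t.2))%N inj_list5 by [].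
have /andP[c4 f2] := allP cf u uL; apply: inj_cremona5 c4 f2; apply: (inj_at_mults (perm_refl _)).
exact: (inj_resultsP charK (uniq_monomials 5) (fun a => id) (allP inj_list5P u uL)).
Qed.

Lemma surj_covered_mults w x y z : surj_covered w x y z -> S (w, x, y, z, 0)%N.
Proof.
case/hasP => k _ /hasP[t tL le].
have /surj_splits := surj_quint_le le (surj_list_mults tL).
apply: surj_quint_le; rewrite /= !leqnn /=; lia.
Qed.

Lemma inj_covered_mults w x y z : inj_covered w x y z -> I (w, x, y, z, 0)%N.
Proof.
case/hasP => k _ /andP[kz /hasP[t tL le]].
have := inj_splits (inj_quint_le le (inj_list_mults tL)).
by rewrite subnK.
Qed.

Lemma surj_mults9 w x y z : (w, x, y, z) \notin exceptions9 ->
  (35 * w + 20 * x + 10 * y + 4 * z <= 220)%N -> S (w, x, y, z, 0)%N.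
Proof.
move=> nE le.
have hw : w \in iota 0 7 by rewrite mem_iota; lia.
have hx : x \in iota 0 12 by rewrite mem_iota; lia.
have hy : y \in iota 0 23 by rewrite mem_iota; lia.
have : surj_check w x y := allP (allP (allP surj_coverageP w hw) x hx) y hy.
rewrite /surj_check; move: (_ %/ 4)%N (leq_divRL z (220 - (35 * w + 20 * x + 10 * y)) (isT : 0 < 4)%N) => z1 zz1.
have {}zz1 : (z <= z1)%N by rewrite zz1; lia.
move=> /implyP/(_ ltac:(lia))/orP[/surj_covered_mults|/allP/(_ z)].
  by apply: surj_quint_le; rewrite /= !leqnn /= !addn0 leq_add2l zz1.
by rewrite mem_iota ltnS zz1 (negPf nE) => /(_ isT).
Qed.

Lemma inj_mults9 w x y z : (w, x, y, z) \notin exceptions9 ->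
  (220 <= 35 * w + 20 * x + 10 * y + 4 * z)%N -> I (w, x, y, z, 0)%N.
Proof.
move=> nE ge; have /and3P[/inj_covered_mults e1 /inj_covered_mults e2 /inj_covered_mults e3] := inj_covered_ends.
case: (leqP 7 w) => [w7|hw]; first by apply: inj_quint_le e1; rewrite /=; lia.
case: (leqP 11 x) => [x11|hx]; first by apply: inj_quint_le e2; rewrite /=; lia.
case: (leqP 22 y) => [y22|hy]; first by apply: inj_quint_le e3; rewrite /=; lia.
have hw' : w \in iota 0 7 by rewrite mem_iota.
have hx' : x \in iota 0 11 by rewrite mem_iota.
have hy' : y \in iota 0 22 by rewrite mem_iota.
have : inj_check w x y := allP (allP (allP inj_coverageP w hw') x hx') y hy'.
have z1z : ((223 - (35 * w + 20 * x + 10 * y)) %/ 4 <= z)%N by lia.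
rewrite /inj_check; move: (_ %/ 4)%N z1z => z1 z1z.
case/hasP => i _ /andP[/inj_covered_mults Ii /allP ex].
apply: inj_quint_le Ii; rewrite /= !leqnn /= !addn0 leq_add2l andbb leqNgt.
apply: contra nE => lt; have := ex (z - z1)%N; rewrite mem_iota subnKC //; apply.
by rewrite /= add0n ltn_subLR.
Qed.
End Main.

Theorem theorem32 (K : fieldType) (hK : [pchar K] =i pred0) (w x y z : nat) :
  ((w, x, y, z) \notin exceptions9 ->
     for_general (fun P : 'I_(size (mults w x y z)) -> proj3 K =>
       good_postulation 9 P)) /\
  ((w, x, y, z) \in exceptions9 ->
     for_general (fun P : 'I_(size (mults w x y z)) -> proj3 K =>
       ~ good_postulation 9 P)).
Proof.
have bin : 'C(9 + 3, 3) = 220%N by [].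
have deg := fat_deg_quint w x y z 0; rewrite -mults_quint addn0 in deg.
have cE : size (conditions (mults w x y z)) = fat_deg (mults w x y z).
  by rewrite mults_quint size_conditions_quint.
split=> [nE|].
  case: (leqP (fat_deg (mults w x y z)) 220) => [le|/ltnW ge].
    apply: good_of_surj => //; rewrite mults_quint; apply: surj_mults9 => //.
    by rewrite -deg.
  apply: good_of_inj => //; rewrite mults_quint; apply: inj_mults9 => //.
  by rewrite -deg.
have m10 : {in mults w x y z, forall m, m <= 10}%N.
  move=> m; rewrite mults_quint => /(allP (quint_mults_le5 _)) m5; exact: leq_trans m5 _.
(* All but six exceptions dominate five 5-points and a 4-point and have degree at most 220;
   surjectivity would be inherited by these six points, where the twisted cubic excludes it. *)
have cases : all (fun t => [|| t \in [:: (6, 0, 1, 1); (6, 0, 0, 3); (4, 3, 2, 0); (3, 6, 0, 0)],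
    t \in [:: (3, 5, 1, 0); (3, 5, 1, 1)] |
    quint_le (5, 1, 0, 0, 0) (t, 0) && (quint_deg (t, 0) <= 220)])%N exceptions9 by [].
move=> /(allP cases) /=; rewrite !inE -!orbA.
case/or4P => [/eqP[? ? ? ?]|/eqP[? ? ? ?]|/eqP[? ? ? ?]|]; try subst w x y z.
- by apply: (bad_of_inj hK); [rewrite deg | apply: not_inj_6011].
- by apply: (bad_of_inj hK); [rewrite deg | apply: not_inj_6003].
- by apply: (bad_of_inj hK); [rewrite deg | apply: not_inj_4320].
case/or4P => [/eqP[? ? ? ?]|/eqP[? ? ? ?]|/eqP[? ? ? ?]|]; try subst w x y z.
- by apply: (bad_of_inj hK); [rewrite deg | apply: not_inj_3600].
- by apply: (bad_of_surj hK); [rewrite deg | exact: m10 | apply: not_surj_351].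
- by apply: (bad_of_surj hK); [rewrite deg | exact: m10 | apply: not_surj_351].
move=> /andP[le deg220]; apply: (bad_of_surj hK _ m10); first by rewrite deg bin -[(_ + 4 * z)%N]addn0.
rewrite mults_quint => s; apply: (@not_surj_51 K hK).
exact: (@surj_quint_le K (5, 1, 0, 0, 0)%N (w, x, y, z, 0)%N le s).
Qed.
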